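(* Given $T>0$ and $M>0$, there exists a constant $C_M$ which depends only on $M$ and $T$ such that, for any $X_\alpha,X_\beta\in\mathcal H^M$ and $t\in[0,T]$, $$d_M(\bar S_tX_\alpha,\bar S_tX_\beta)\le C_M\,d_M(X_\alpha,X_\beta).$$
   Context: $\mathbb R_+=[0,\infty)$; the subscript ''per'' denotes 1-periodic functions. **Lagrangian set.** $W^{1,1}_{\rm per}$ has norm $\|f\|_{L^\infty([0,1])}+\|f_\xi\|_{L^1([0,1])}$, $L^1_{\rm per}$ has norm $\|f\|_{L^1([0,1])}$. $E$ is the set of $X=(y,U,\nu,r)$ with $(y-\mathrm{id},U,\nu,r)\in W^{1,1}_{\rm per}\times W^{1,1}_{\rm per}\times L^1_{\rm per}\times L^1_{\rm per}$, with $\|X\|_E=\|y-\mathrm{id}\|_{W^{1,1}_{\rm per}}+\|U\|_{W^{1,1}_{\rm per}}+\|\nu\|_{L^1_{\rm per}}+\|r\|_{L^1_{\rm per}}$ and $\|X-\tilde X\|_E=\|y-\tilde y\|_{W^{1,1}_{\rm per}}+\|U-\tilde U\|_{W^{1,1}_{\rm per}}+\|\nu-\tilde\nu\|_{L^1_{\rm per}}+\|r-\tilde r\|_{L^1_{\rm per}}$. $\mathcal F$ is the set of $(y,U,\nu,r)\in E$ with $y,U\in W^{1,\infty}_{\rm loc}(\mathbb R)$, $\nu,r\in L^\infty(\mathbb R)$, $y_\xi\ge0$, $\nu\ge0$, $y_\xi+\nu\ge c$ a.e. for some constant $c>0$, and $y_\xi\nu=y_\xi^2U^2+U_\xi^2+r^2$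 a.e. **Lagrangian flow.** $S_t:\mathcal F\to\mathcal F$, $t\ge0$, sends $\bar X$ to the value at time $t$ of the unique global solution $X=(y,U,\nu,r)\in C^1(\mathbb R_+,E)$ with $X(0)=\bar X$ of $\zeta_t=U$, $U_t=-Q$, $\nu_t=-2QUy_\xi+(3U^2-2P)U_\xi$, $r_t=0$, where $y(t,\xi)=\xi+\zeta(t,\xi)$ and, for $\xi\in[0,1]$ (extended 1-periodically), $P(t,\xi)=\frac1{2(e-1)}\int_0^1\cosh(y(t,\xi)-y(t,\theta))(U^2y_\xi+\nu)(t,\theta)d\theta+\frac14\int_0^1e^{-\mathrm{sgn}(\xi-\theta)(y(t,\xi)-y(t,\theta))}(U^2y_\xi+\nu)(t,\theta)d\theta$, $Q(t,\xi)=\frac1{2(e-1)}\int_0^1\sinh(y(t,\xi)-y(t,\theta))(U^2y_\xi+\nu)(t,\theta)d\theta-\frac14\int_0^1\mathrm{sgn}(\xi-\theta)e^{-\mathrm{sgn}(\xi-\theta)(y(t,\xi)-y(t,\theta))}(U^2y_\xi+\nu)(t,\theta)d\theta$. (This solution exists, is unique, and stays in $\mathcal F$.) **Relabeling and projection.** $G$ is the set of invertible $f\in W^{1,\infty}_{\rm loc}(\mathbb R)$ with $f(\xi+1)=f(\xi)+1$ and $f-\mathrm{id},f^{-1}-\mathrm{id}\in W^{1,\infty}_{\rm per}$. For $X=(y,U,\nu,r)\in\mathcal F$, $f\in G$: $X\bullet f=(y\circ f,U\circ f,(\nu\circ f)f_\xi,(r\circ f)f_\xi)$. With $h=\|\nu\|_{L^1_{\rm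 per}}$, $\mathcal F_0=\{X\in\mathcal F: y_\xi+\nu=1+h\}$, $\mathcal H=\{X\in\mathcal F_0:\int_0^1y\,d\xi=0\}$ and, for $M>0$, $\mathcal H^M=\{X\in\mathcal H: h\le M\}$. $\Pi=\Pi_2\circ\Pi_1:\mathcal F\to\mathcal H$, where $\Pi_1(X)=X\bullet f^{-1}$ with $f(\xi)=\frac1{1+h}\big(y(\xi)+\int_0^\xi\nu\,d\theta\big)\in G$, and $\Pi_2(X)(\xi)=X(\xi-a)$ with $a=\int_0^1y\,d\xi$. $\bar S_t=\Pi\circ S_t$ (it maps $\mathcal H^M$ to itself). **Metric.** $J(X_\alpha,X_\beta)=\inf_{f,g\in G}\|X_\alpha\bullet f-X_\beta\bullet g\|_E$. For $X_\alpha,X_\beta\in\mathcal H^M$, $d_M(X_\alpha,X_\beta)=\inf\sum_{n=1}^NJ(X_{n-1},X_n)$, the infimum over all finite sequences $\{X_n\}_{n=0}^N$ in $\mathcal H^M$ with $X_0=X_\alpha$, $X_N=X_\beta$. *)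

(* Defs.v *)
From HB Require Import structures.
From mathcomp Require Import all_boot all_order all_algebra.
From mathcomp Require Import all_classical all_reals all_analysis.
Set Implicit Arguments.
Unset Strict Implicit.
Unset Printing Implicit Defensive.
Import Order.TTheory GRing.Theory Num.Theory.
Import numFieldNormedType.Exports.
Local Open Scope classical_set_scope.
Local Open Scope ring_scope.

(* In ring_scope this notation otherwise means the derivative of polynomials.  *)
Local Notation "f ^` ()" := (derive1 f) : ring_scope.

(* Elements of Sobolev and Lebesgue spaces are represented by functions        *)
(* R -> R.  Sobolev functions are their continuous representatives, with f_xi   *)
(* the pointwise derivative f^`(), which exists a.e. when f is absolutely       *)
(* continuous and has a default value elsewhere.  Elements of L^1_per are       *)
(* Borel representatives that are 1-periodic everywhere; the norms below are    *)
(* therefore seminorms, which identify functions that are equal a.e.            *)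

Section FunctionSpaces.
Variable R : realType.
Implicit Types f : R -> R.
Local Notation mu := (@lebesgue_measure R).
Local Notation I01 := (`[0%R, 1%R]%classic : set R).

Definition normLp (p : \bar R) (D : set R) f : \bar R :=
  'N[mu]_p[(EFin \o f) \_ D].

Definition normL1per f : \bar R := normLp 1%E I01 f.

Definition normW11per f : \bar R :=
  (normLp +oo I01 f + normL1per (f^`())%R)%E.

(* W^{1,1}_loc(R): the locally absolutely continuous functions.                *)
Definition W11loc f : Prop :=
  locally_integrable [set: R] f^`() /\
  forall a b : R, a <= b -> f b - f a = \int[mu]_(x in `[a, b]) f^`() x.

Definition Linfloc f : Prop :=
  measurable_fun [set: R] f /\
  forall a b : R, (normLp +oo `[a, b] f < +oo)%E.

Definition W1infloc f : Prop := [/\ W11loc f, Linfloc f & Linfloc f^`()].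

Definition W11per f : Prop := periodic f 1 /\ W11loc f.

Definition W1infper f : Prop := periodic f 1 /\ W1infloc f.

Definition L1per f : Prop :=
  periodic f 1 /\ mu.-integrable I01 (EFin \o f).

Definition Linf f : Prop :=
  measurable_fun [set: R] f /\ (normLp +oo [set: R] f < +oo)%E.

(* The integral from a to b, with the usual sign convention when b < a.        *)
Definition oriented_int (a b : R) f : R :=
  if a <= b then \int[mu]_(x in `[a, b]) f x
  else - \int[mu]_(x in `[b, a]) f x.

Definition cosh (x : R) : R := (expR x + expR (- x)) / 2.
Definition sinh (x : R) : R := (expR x - expR (- x)) / 2.

End FunctionSpaces.

(* Quadruples (y, U, nu, r).  The type is also used for differences and        *)
(* velocities, whose first component is periodic.                              *)
Record lagr (R : realType) := Lagr {
  ly : R -> R;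
  lU : R -> R;
  lnu : R -> R;
  lr : R -> R }.

Section LagrangianSets.
Variable R : realType.
Implicit Types X Y V : lagr R.
Local Notation mu := (@lebesgue_measure R).
Local Notation I01 := (`[0%R, 1%R]%classic : set R).

Definition lagr_sub X Y : lagr R :=
  Lagr (ly X \- ly Y) (lU X \- lU Y) (lnu X \- lnu Y) (lr X \- lr Y).

Definition lagr_scale (a : R) X : lagr R :=
  Lagr (a \*: ly X) (a \*: lU X) (a \*: lnu X) (a \*: lr X).

(* The Banach space W11per x W11per x L1per x L1per on which E is modelled:    *)
(* X belongs to E iff X - (id, 0, 0, 0) belongs to it.                         *)
Definition Etangent V : Prop :=
  [/\ W11per (ly V), W11per (lU V), L1per (lnu V) & L1per (lr V)].

Definition Enorm V : \bar R :=
  (normW11per (ly V) + normW11per (lU V)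
   + normL1per (lnu V) + normL1per (lr V))%E.

Definition Edist X Y : \bar R := Enorm (lagr_sub X Y).

Definition setE X : Prop :=
  [/\ W11per (ly X \- id), W11per (lU X), L1per (lnu X) & L1per (lr X)].

Definition setF X : Prop :=
  setE X /\
  [/\ W1infloc (ly X), W1infloc (lU X), Linf (lnu X) & Linf (lr X)] /\
  [/\ {ae mu, forall x, 0 <= (ly X)^`() x},
      {ae mu, forall x, 0 <= lnu X x},
      exists2 c : R, 0 < c & {ae mu, forall x, c <= (ly X)^`() x + lnu X x} &
      {ae mu, forall x, (ly X)^`() x * lnu X x =
        (ly X)^`() x ^+ 2 * lU X x ^+ 2 + (lU X)^`() x ^+ 2 + lr X x ^+ 2}].

End LagrangianSets.

Section LagrangianFlow.
Variable R : realType.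
Implicit Types X : lagr R.
Local Notation mu := (@lebesgue_measure R).
Local Notation I01 := (`[0%R, 1%R]%classic : set R).
Local Notation e := (expR 1 : R).

Definition energy X (th : R) : R :=
  lU X th ^+ 2 * (ly X)^`() th + lnu X th.

Definition P01 X (xi : R) : R :=
  1 / (2 * (e - 1)) *
    (\int[mu]_(th in I01) (cosh (ly X xi - ly X th) * energy X th)) +
  1 / 4 *
    (\int[mu]_(th in I01)
       (expR (- Num.sg (xi - th) * (ly X xi - ly X th)) * energy X th)).

Definition Q01 X (xi : R) : R :=
  1 / (2 * (e - 1)) *
    (\int[mu]_(th in I01) (sinh (ly X xi - ly X th) * energy X th)) -
  1 / 4 *
    (\int[mu]_(th in I01)
       (Num.sg (xi - th) * expR (- Num.sg (xi - th) * (ly X xi - ly X th))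
        * energy X th)).

(* 1-periodic extension; P01 and Q01 take equal values at 0 and 1 for X in E.  *)
Definition per_ext (f : R -> R) (xi : R) : R := f (xi - (Num.floor xi)%:~R).

Definition lagrP X : R -> R := per_ext (P01 X).
Definition lagrQ X : R -> R := per_ext (Q01 X).

Definition lagr_rhs X : lagr R :=
  Lagr (lU X)
       (fun xi => - lagrQ X xi)
       (fun xi => - 2 * lagrQ X xi * lU X xi * (ly X)^`() xi
                  + (3 * lU X xi ^+ 2 - 2 * lagrP X xi) * (lU X)^`() xi)
       (fun=> 0).

(* X is in C^1([0, +oo), E) with derivative V; at t = 0 the limits are         *)
(* one-sided.                                                                  *)
Definition C1_with_derivative (X V : R -> lagr R) : Prop :=
  forall t : R, 0 <= t ->
  [/\ setE (X t),
      Etangent (V t),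
      Enorm (lagr_sub (lagr_scale (s - t)^-1 (lagr_sub (X s) (X t))) (V t))
        @[s --> within [set s | 0 <= s] t^'] --> 0%E &
      Edist (V s) (V t) @[s --> within [set s | 0 <= s] (nbhs t)] --> 0%E].

(* S t X is the value at time t of the global solution starting from X; S is   *)
(* unconstrained outside t >= 0 and X in setF.                                 *)
Definition lagrangian_flow (S : R -> lagr R -> lagr R) : Prop :=
  forall X, setF X ->
  [/\ S 0 X = X,
      forall t, 0 <= t -> setF (S t X) &
      C1_with_derivative (fun t => S t X) (fun t => lagr_rhs (S t X))].

End LagrangianFlow.

Section Relabeling.
Variable R : realType.
Implicit Types (X Y : lagr R) (f g : R -> R).
Local Notation mu := (@lebesgue_measure R).
Local Notation I01 := (`[0%R, 1%R]%classic : set R).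

Definition setG f : Prop :=
  [/\ W1infloc f, forall x, f (x + 1) = f x + 1 &
      exists g, [/\ cancel f g, cancel g f,
                    W1infper (f \- id) & W1infper (g \- id)]].

Definition relabel X f : lagr R :=
  Lagr (ly X \o f) (lU X \o f)
       (fun x => lnu X (f x) * f^`() x) (fun x => lr X (f x) * f^`() x).

(* normL1per (lnu X) is finite for X in E, so that fine loses nothing.         *)
Definition lagr_h X : R := fine (normL1per (lnu X)).

Definition setF0 X : Prop :=
  setF X /\ {ae mu, forall x, (ly X)^`() x + lnu X x = 1 + lagr_h X}.

Definition setH X : Prop :=
  setF0 X /\ \int[mu]_(x in I01) ly X x = 0.

Definition setHM (M : R) X : Prop := setH X /\ lagr_h X <= M.

Definition Pi1_fun X (xi : R) : R :=
  1 / (1 + lagr_h X) * (ly X xi + oriented_int 0 xi (lnu X)).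

Definition Pi1 X : lagr R := relabel X (pinv [set: R] (Pi1_fun X)).

Definition lagr_translate (a : R) X : lagr R :=
  Lagr (fun x => ly X (x - a)) (fun x => lU X (x - a))
       (fun x => lnu X (x - a)) (fun x => lr X (x - a)).

Definition Pi2 X : lagr R :=
  lagr_translate (\int[mu]_(x in I01) ly X x) X.

Definition lagrPi X : lagr R := Pi2 (Pi1 X).

Definition Sbar (S : R -> lagr R -> lagr R) (t : R) X : lagr R :=
  lagrPi (S t X).

Definition lagrJ X Y : \bar R :=
  ereal_inf [set d | exists f g,
    [/\ setG f, setG g & d = Edist (relabel X f) (relabel Y g)]].

Definition dM (M : R) X Y : \bar R :=
  ereal_inf [set d | exists (N : nat) (Z : nat -> lagr R),
    [/\ Z 0%N = X, Z N = Y,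
        forall n, (n <= N)%N -> setHM M (Z n) &
        d = (\sum_(n < N) lagrJ (Z n) (Z n.+1))%E]].

End Relabeling.

(* Main.v *)
(** The seminorm of E is invariant under relabeling and the vector field commutes
    with relabeling, so for f, g in G the curves S_t X . f and S_t Y . g both solve
    the differential equation.  The constraint y_xi nu = y_xi^2 U^2 + U_xi^2 + r^2
    bounds sup |U|, int |U_xi| and int (U^2 y_xi + nu) in terms of h = int nu, so on
    the part of F where h <= M the vector field is Lipschitz with a constant that
    depends only on M: P and Q are integrals against the 1-periodic Green function
    of 1 - d^2/dx^2 and satisfy P_xi = Q y_xi, Q_xi = P y_xi - (U^2 y_xi + nu) / 2.
    Moreover nu_t = (U^3 - 2 P U)_xi, hence h is conserved and Gronwall's lemma
    gives J(S_t X, S_t Y) <= exp(L t) J(X, Y).  Finally Pi X is a relabeling of X, so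
    Pi does not increase J; as Pi o S_t maps H^M into itself, the estimate is summed
    along chains in H^M. *)

Require Import Defs.
From HB Require Import structures.
From mathcomp Require Import all_boot all_order all_algebra.
From mathcomp Require Import all_classical all_reals all_analysis.
From mathcomp Require Import measurable_realfun ess_sup_inf.
From mathcomp Require Import ring lra.
Set Implicit Arguments.
Unset Strict Implicit.
Unset Printing Implicit Defensive.
Import Order.TTheory GRing.Theory Num.Theory.
Import numFieldNormedType.Exports.
Local Open Scope classical_set_scope.
Local Open Scope ring_scope.
Local Notation "f ^` ()" := (derive1 f) : ring_scope.

(** * Interval integrals and primitives *)

(** The constant must not see f and g. A relabeling multiplies y_xi, U_xi, nu and r by a factor that
    is bounded for each f but not uniformly over G, so neither the L^infty norms of an element of F
    nor its lower bound c may enter the Lipschitz estimate. Only quantities that relabeling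
    preserves are allowed: h, sup norms of U, P and Q, and L^1 norms of densities.

    The norm of the difference of two solutions need not be differentiable in t, so Gronwall's lemma
    is proved from one-sided increments by induction along the real line.

    The pointwise derivative obeys the sum, product and chain rules only a.e. Computations therefore
    use the relation [primitive F f], with f any representative of the density, and equality of
    quadruples is weakened to [lagr_ae]. The way back to pointwise derivatives, [primitive_W11loc],
    rests on a.e. differentiability and on the measurability of the derivative. Substitution along
    absolutely continuous bijections is derived from the uniqueness of Lebesgue measure. *)

Section LocInt.
Context {R : realType}.
Local Notation mu := (@lebesgue_measure R).
Implicit Types (f g h F G : R -> R) (a b c x : R).

(* Distinct elaborations of the integral notation are not syntactically equal,
   hence a constant. *)
Definition itg a b f : R := \int[mu]_(x in `[a, b]) f x.

Lemma aeS (P Q : R -> Prop) : (forall x, P x -> Q x) ->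
  {ae mu, forall x, P x} -> {ae mu, forall x, Q x}.
Proof. by move=> PQ; apply: (@filterS _ _ (ae_filter_ringOfSetsType mu)). Qed.

Lemma aeS2 (P P' Q : R -> Prop) : (forall x, P x -> P' x -> Q x) ->
  {ae mu, forall x, P x} -> {ae mu, forall x, P' x} -> {ae mu, forall x, Q x}.
Proof. by move=> PQ; apply: (@filterS2 _ _ (ae_filter_ringOfSetsType mu)). Qed.

Lemma aeS3 (P P' P'' Q : R -> Prop) : (forall x, P x -> P' x -> P'' x -> Q x) ->
  {ae mu, forall x, P x} -> {ae mu, forall x, P' x} -> {ae mu, forall x, P'' x} ->
  {ae mu, forall x, Q x}.
Proof. by move=> PQ; apply: (@filterS3 _ _ (ae_filter_ringOfSetsType mu)). Qed.

Lemma locintP f : locally_integrable [set: R] f <->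
  measurable_fun [set: R] f /\ forall a b, mu.-integrable `[a, b] (EFin \o f).
Proof.
split=> [[mf _ intf]|[mf intf]]; split=> //.
- move=> a b; apply/integrableP; split.
    by apply/measurable_EFinP; exact: measurable_funS mf.
  by apply: intf => //; exact: segment_compact.
- exact: openT.
- move=> K _ cK; have [r [_ rK]] := compact_bounded cK.
  have {}rK : K `<=` `[- (r + 1), r + 1].
    move=> x Kx /=; rewrite in_itv/= -ler_norml; apply: (rK (r + 1)) => //.
    by rewrite ltrDl.
  have /integrableP[_] := intf (- (r + 1)) (r + 1).
  apply: le_lt_trans; apply: ge0_subset_integral => //=.
    exact: compact_measurable.
  by apply/measurable_EFinP/measurableT_comp => //; exact: measurable_funS mf.
Qed.

Lemma locint_measurable f : locally_integrable [set: R] f -> measurable_fun [set: R] f.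
Proof. by case. Qed.

Lemma locint_int f a b : locally_integrable [set: R] f ->
  mu.-integrable `[a, b] (EFin \o f).
Proof. by move=> /locintP[]. Qed.

Hint Resolve locint_int : core.

Lemma locint_cst c : locally_integrable [set: R] (fun=> c).
Proof.
apply/locintP; split=> // a b; apply: measurable_bounded_integrable => //=.
  by rewrite lebesgue_measure_itv/=; case: ifP => _; rewrite ?ltry// -EFinB ltry.
exact: bounded_cst.
Qed.

Lemma locintM_bnd f g : (forall a b, exists c, forall x, a <= x <= b -> `|g x| <= c) ->
  measurable_fun [set: R] g -> locally_integrable [set: R] f ->
  locally_integrable [set: R] (g \* f).
Proof.
move=> bg mg /locintP[mf intf]; apply/locintP; split; first exact: measurable_funM.
move=> a b; have [c gc] := bg a b.
have : mu.-integrable `[a, b] (EFin \o (c \*: f)).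
  apply: eq_integrable (integrableZl _ c (intf a b)) => //.
apply: le_integrable => //.
- apply/measurable_EFinP; apply: measurable_funS (measurable_funM mg mf) => //.
- move=> x /=; rewrite in_itv/= => xab; rewrite lee_fin !normrM ler_wpM2r//.
  by rewrite (le_trans (gc _ xab))// ler_norm.
Qed.

Lemma continuous_bnd g : continuous g -> forall a b, exists c, forall x, a <= x <= b -> `|g x| <= c.
Proof.
move=> cg a b.
have cwg : {within `[a, b], continuous g} by exact: continuous_subspaceT.
have [r [_ rK]] := compact_bounded (continuous_compact cwg (@segment_compact R a b)).
exists (r + 1) => x xab; apply: (rK (r + 1)); first by rewrite ltrDl.
by exists x => //=; rewrite in_itv.
Qed.

Lemma locintM_cont f g : continuous g -> locally_integrable [set: R] f ->
  locally_integrable [set: R] (g \* f).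
Proof.
move=> cg; apply: locintM_bnd; first exact: continuous_bnd.
exact: continuous_measurable_fun.
Qed.

Lemma locintZ c f : locally_integrable [set: R] f -> locally_integrable [set: R] (c \*: f).
Proof. by apply: (@locintM_cont _ (fun=> c)) => x; exact: cvg_cst. Qed.

Lemma locint_norm f : locally_integrable [set: R] f ->
  locally_integrable [set: R] (fun x => `|f x|).
Proof.
move=> /locintP[mf intf]; apply/locintP; split; first exact: measurableT_comp.
by move=> a b; have := integrable_norm (intf a b).
Qed.

Lemma locint_cont f : continuous f -> locally_integrable [set: R] f.
Proof.
move=> cf; have := locintM_cont cf (locint_cst 1).
by congr (locally_integrable _ _); apply/funext => x /=; rewrite mulr1.
Qed.

Lemma itgD f g a b : locally_integrable [set: R] f -> locally_integrable [set: R] g ->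
  itg a b (fun x => f x + g x) =
  itg a b f + itg a b g.
Proof. by move=> lf lg; apply: RintegralD => //; exact: locint_int. Qed.

Lemma itgB f g a b : locally_integrable [set: R] f -> locally_integrable [set: R] g ->
  itg a b (fun x => f x - g x) =
  itg a b f - itg a b g.
Proof. by move=> lf lg; apply: RintegralB => //; exact: locint_int. Qed.

Lemma itgZ f a b c : locally_integrable [set: R] f ->
  itg a b (fun x => c * f x) = c * itg a b f.
Proof. by move=> lf; apply: RintegralZl => //; exact: locint_int. Qed.

Lemma itg_cst a b c : a <= b -> itg a b (fun=> c) = c * (b - a).
Proof.
move=> ab; rewrite /itg Rintegral_cst//=; congr (_ * _).
rewrite lebesgue_measure_itv/= lte_fin; case: ltP => //= ba.
by have -> : a = b by [apply/le_anti; rewrite ab ba]; rewrite subrr.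
Qed.

Lemma ae_eq_itg f g a b : measurable_fun [set: R] f -> measurable_fun [set: R] g ->
  {ae mu, forall x, f x = g x} ->
  itg a b f = itg a b g.
Proof.
move=> mf mg fg; congr fine; apply: ae_eq_integral => //.
- by apply/measurable_EFinP; exact: measurable_funS mf.
- by apply/measurable_EFinP; exact: measurable_funS mg.
- by apply: aeS fg => x -> _.
Qed.

Lemma itg_split f a b c : locally_integrable [set: R] f -> a <= b -> b <= c ->
  itg a c f =
  itg a b f + itg b c f.
Proof.
move=> lf ab bc.
have := @Rintegral_itvB R f (BLeft a) (BRight c) b (locint_int _ _ lf).
rewrite !bnd_simp => /(_ ab bc) /(canRL (subrK _)) bcE; rewrite /itg bcE addrC; congr (_ + _).
rewrite Rintegral_itv_obnd_cbnd//.
by apply: integrableS (locint_int b c lf) => //; apply: subset_itvr; rewrite bnd_simp.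
Qed.

Lemma le_itg_ae f g a b : locally_integrable [set: R] f -> locally_integrable [set: R] g ->
  {ae mu, forall x, f x <= g x} ->
  itg a b f <= itg a b g.
Proof.
move=> lf lg fg; rewrite -subr_ge0 -itgB//.
(* The sign is known only a.e.; the absolute value is a representative that is nonnegative
   everywhere. *)
rewrite (@ae_eq_itg _ (fun x => `|g x - f x|)).
- by apply: Rintegral_ge0 => x _.
- by apply: measurable_funB; exact: locint_measurable.
- by apply: measurableT_comp => //; apply: measurable_funB; exact: locint_measurable.
- by apply: aeS fg => x fgx; rewrite ger0_norm// subr_ge0.
Qed.

Lemma itg_ge0_ae f a b : measurable_fun [set: R] f -> {ae mu, forall x, 0 <= f x} ->
  0 <= itg a b f.
Proof.
move=> mf f0; rewrite (@ae_eq_itg _ (fun x => `|f x|)) => //.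
- by apply: Rintegral_ge0 => x _.
- exact: measurableT_comp.
- by apply: aeS f0 => x fgx; rewrite ger0_norm.
Qed.

Lemma le_itg f g a b : locally_integrable [set: R] f -> locally_integrable [set: R] g ->
  (forall x, a <= x <= b -> f x <= g x) ->
  itg a b f <= itg a b g.
Proof.
move=> lf lg fg; apply: le_Rintegral => //; try exact: locint_int.
Qed.

Lemma itg_norm_le f a b : locally_integrable [set: R] f ->
  `|itg a b f| <= itg a b (fun x => `|f x|).
Proof. by move=> lf; apply: le_normr_Rintegral => //; exact: locint_int. Qed.

Lemma itg_sub f a b c d : locally_integrable [set: R] f ->
  (forall x, 0 <= f x) -> c <= a -> a <= b -> b <= d ->
  itg a b f <= itg c d f.
Proof.
move=> lf f0 ca ab bd.
rewrite (@itg_split f c a d)// ?(le_trans ab)//.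
rewrite (@itg_split f a b d)//.
have i0 u v : 0 <= itg u v f by apply: Rintegral_ge0 => x _.
by have := i0 c a; have := i0 b d; lra.
Qed.

End LocInt.
#[local] Hint Resolve locint_int : core.

(** * Absolutely continuous functions and their densities *)

Section Primitive.
Context {R : realType}.
Local Notation mu := (@lebesgue_measure R).
Implicit Types (f g h F G : R -> R) (a b c x : R).

(** The density is a free parameter, determined only up to null sets, so that each calculus rule can
    give an explicit one; [W11loc F] is the case of the pointwise derivative. *)
Definition primitive F f : Prop := locally_integrable [set: R] f /\
  forall a b, a <= b -> F b - F a = itg a b f.

Lemma primitive_W11 F : W11loc F <-> primitive F F^`().
Proof. by []. Qed.

Lemma primitive_continuous F f : primitive F f -> continuous F.
Proof.
move=> [lf FE] x.
have xx : x - 1 < x + 1 by lra.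
have := parameterized_integral_continuous (ltW xx) (locint_int (x - 1) (x + 1) lf).
move=> /(continuous_within_itvP _ xx)[+ _ _] => /(_ x).
rewrite in_itv/= => /(_ _)/wrap[]; first by apply/andP; split; lra.
move=> cx; have FEn : \forall y \near x, F (x - 1) + itg (x - 1) y f = F y.
  near=> y; rewrite -FE ?subrKC//.
  by apply/ltW; near: y; apply: lt_nbhsr; lra.
rewrite /continuous_at -(nbhs_singleton FEn).
by apply: cvg_trans (cvgD (cvg_cst (F (x - 1))) cx); exact: near_eq_cvg.
Unshelve. all: by end_near. Qed.

(** [FTC1] differentiates an integral with a fixed left end point. The points -n are countably many,
    and some of them lies to the left of any given x. *)
Lemma primitive_is_derive F f : primitive F f ->
  {ae mu, forall x, is_derive x 1 F (f x)}.
Proof.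
move=> [lf FE].
have : {ae mu, forall x, forall n : nat, - n%:R < x ->
   is_derive x 1 (fun y => itg (- n%:R) y f) (f x)}.
  apply: ae_foralln => n.
  have := @FTC1 R f (BLeft (- n%:R)) (fun y => locint_int _ _ lf) lf.
  apply: aeS => x nx nx'.
  have [|dx xE] := nx; first by rewrite /= lte_fin.
  by apply: DeriveDef => //; rewrite -derive1E.
apply: aeS => x nx.
have [n xn] : exists n : nat, - n%:R < x.
  exists (Num.truncn `|x|).+1; rewrite ltrNl (le_lt_trans (ler_norm _))//.
  by rewrite normrN truncnS_gt.
have := is_deriveD (is_derive_cst (F (- n%:R)) x 1) (nx n xn).
rewrite add0r; apply: near_eq_is_derive; near=> y.
rewrite -[LHS]/(F (- n%:R) + itg (- n%:R) y f) -FE ?subrKC//.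
by near: y; exact: lt_le_nbhsr.
Unshelve. all: by end_near. Qed.

(** Let s be the supremum of the points x such that P holds on [a, x]. The left-limit condition
    gives P s, and the right-extension condition would lead beyond s if s < b. *)
Lemma real_induction (P : R -> Prop) a b : a <= b -> P a ->
  (forall x, a <= x < b -> (forall y, a <= y <= x -> P y) ->
    exists2 d, 0 < d & forall y, x < y < x + d -> y <= b -> P y) ->
  (forall x, a < x <= b -> (forall y, a <= y < x -> P y) -> P x) -> P b.
Proof.
move=> ab Pa Pr Pl.
pose S := [set x | a <= x <= b /\ forall y, a <= y <= x -> P y].
have Sa : S a by split; [rewrite lexx|move=> y /le_anti <-].
have hS : has_sup S by split; [exists a|exists b => x [/andP[]]].
have aS : a <= sup S by exact: ub_le_sup (proj2 hS) _ Sa.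
have Sb : sup S <= b by apply: ge_sup => [|x [/andP[]]//]; exists a.
have Slt y : a <= y < sup S -> P y.
  move=> /andP[ay yS]; have [||x [_ Px] yx] := @sup_gt _ S y; [by exists a|by []|].
  by apply: Px; rewrite ay ltW.
have PS : P (sup S).
  have [<-//|aS'] := eqVneq a (sup S).
  by apply: Pl => //; rewrite Sb lt_neqAle aS' aS.
have Sle y : a <= y <= sup S -> P y.
  by move=> /andP[ay]; rewrite le_eqVlt => /predU1P[->//|yS]; apply: Slt; rewrite ay.
have [Sb'|bS] := ltP (sup S) b; last by apply: Sle; rewrite ab.
have [|d d0 Pd] := Pr _ _ Sle; first by rewrite aS.
pose z := Num.min b (sup S + d / 2).
have zb : z <= b by rewrite ge_min lexx.
have Sz : sup S < z by rewrite lt_min Sb'/=; lra.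
suff : S z by move=> /(ub_le_sup (proj2 hS)); rewrite leNgt Sz.
split; first by rewrite zb (le_trans aS (ltW Sz)).
move=> y /andP[ay yz]; have [yS|Sy] := leP y (sup S); first by apply: Sle; rewrite ay.
apply: Pd; last exact: le_trans yz zb.
by rewrite Sy (le_lt_trans yz)// gt_min; apply/orP; right; lra.
Qed.

(** K is a control such as int |f|. The bound |D x - D a| <= e (K x - K a) travels from a to b by
    [real_induction]: pairs with u = x extend it to the right of x, pairs with v = x carry it to a
    limit from the left. Then e tends to 0. *)
Lemma eq_of_small_increments (D K : R -> R) a b : a <= b ->
  (forall e x, 0 < e -> a <= x <= b -> exists2 d, 0 < d &
     forall u v, a <= u <= x -> x <= v <= b -> x - d < u -> v < x + d ->
       `|D v - D u| <= e * (K v - K u)) ->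
  D b = D a.
Proof.
move=> ab H; apply/eqP; rewrite -subr_eq0 -normr_le0.
apply/ler_addgt0Pl => e0 e0_gt0; rewrite addr0.
(* With e = e0 / c one has e (K b - K a) <= e0; the summand 1 keeps c positive. *)
pose c := 1 + `|K b - K a|.
have c0 : 0 < c by rewrite ltr_wpDr.
pose e := e0 / c; have e_gt0 : 0 < e by rewrite divr_gt0.
have : `|D b - D a| <= e * (K b - K a).
  apply: (@real_induction (fun y => `|D y - D a| <= e * (K y - K a)) a b) => //.
  - by rewrite !subrr normr0 mulr0.
  - move=> x /andP[ax xb] Px; have [|d d0 Hd] := H e x e_gt0; first by rewrite ax ltW.
    exists d => // y /andP[xy yd] yb.
    have := Hd x y; rewrite ax lexx (ltW xy) yb yd; have -> : x - d < x by lra.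
    move=> /(_ erefl erefl erefl erefl) h1; have := Px x; rewrite ax lexx => /(_ erefl) h2.
    have -> : D y - D a = (D y - D x) + (D x - D a) by ring.
    by apply: le_trans (ler_normD _ _) _; rewrite mulrBr in h1; rewrite mulrBr in h2; lra.
  - move=> x /andP[ax xb] Px; have [|d d0 Hd] := H e x e_gt0; first by rewrite xb ltW.
    pose u := Num.max a (x - d / 2).
    have au : a <= u by rewrite le_max lexx.
    have ux : u < x by rewrite gt_max ax/=; lra.
    have du : x - d < u by rewrite lt_max; apply/orP; right; lra.
    have := Hd u x; rewrite au (ltW ux) lexx xb du; have -> : x < x + d by lra.
    move=> /(_ erefl erefl erefl erefl) h1; have := Px u; rewrite au ux => /(_ erefl) h2.
    have -> : D x - D a = (D x - D u) + (D u - D a) by ring.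
    by apply: le_trans (ler_normD _ _) _; rewrite mulrBr in h1; rewrite mulrBr in h2; lra.
move=> /le_trans; apply; rewrite (@le_trans _ _ (e * c))//.
  by rewrite ler_pM2l// (le_trans (ler_norm _))// lerDr.
by rewrite divfK// gt_eqF.
Qed.

End Primitive.

Section PrimitiveOps.
Context {R : realType}.
Local Notation mu := (@lebesgue_measure R).
Implicit Types (f g h F G : R -> R) (a b c x : R).

Lemma primitive_cst c : primitive (fun=> c) (fun=> 0).
Proof.
split; first exact: locint_cst.
by move=> a b ab; rewrite itg_cst// subrr mul0r.
Qed.

Lemma primitive_id : primitive (@id R) (fun=> 1).
Proof.
split; first exact: locint_cst.
by move=> a b ab; rewrite itg_cst// mul1r.
Qed.

Lemma primitiveD F f G g : primitive F f -> primitive G g ->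
  primitive (F \+ G) (f \+ g).
Proof.
move=> [lf Ff] [lg Gg]; split; first exact: locally_integrableD.
by move=> a b ab; rewrite itgD// -Ff// -Gg//=; ring.
Qed.

Lemma primitiveZ F f c : primitive F f -> primitive (c \*: F) (c \*: f).
Proof.
move=> [lf Ff]; split; first exact: locintZ.
by move=> a b ab; rewrite itgZ// -Ff//= /GRing.scale/=; ring.
Qed.

Lemma primitiveB F f G g : primitive F f -> primitive G g ->
  primitive (F \- G) (f \- g).
Proof.
move=> [lf Ff] [lg Gg]; split; first exact: locally_integrableB.
by move=> a b ab; rewrite itgB// -Ff// -Gg//=; ring.
Qed.

Lemma primitive_ae F f g : measurable_fun [set: R] g -> {ae mu, forall x, f x = g x} ->
  primitive F f -> primitive F g.
Proof.
move=> mg fg [lf Ff]; have mf := locint_measurable lf.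
have lg : locally_integrable [set: R] g.
  apply/locintP; split=> // a b; have /integrableP[_] := locint_int a b lf.
  move=> foo; apply/integrableP; split.
    by apply/measurable_EFinP; exact: measurable_funS mg.
  apply: le_lt_trans foo; rewrite le_eqVlt; apply/orP; left; apply/eqP.
  apply: ae_eq_integral => //.
  - by apply/measurable_EFinP/measurableT_comp => //; exact: measurable_funS mg.
  - by apply/measurable_EFinP/measurableT_comp => //; exact: measurable_funS mf.
  - by apply: aeS fg => x /= -> _.
by split=> // a b ab; rewrite Ff//; exact: ae_eq_itg.
Qed.

Lemma primitive_itg f : locally_integrable [set: R] f ->
  primitive (fun x => oriented_int 0 x f) f.
Proof.
move=> lf; split=> // a b ab; rewrite /oriented_int -!/(itg _ _ _).
case: (leP 0 b) => b0; case: (leP 0 a) => a0.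
- by rewrite (@itg_split _ f 0 a b)//; ring.
- by rewrite (@itg_split _ f a 0 b)//; [ring|exact: ltW].
- by exfalso; lra.
- by rewrite (@itg_split _ f a b 0)//; [ring|exact: ltW].
Qed.

Lemma primitive_nondecreasing F f : primitive F f -> {ae mu, forall x, 0 <= f x} ->
  {homo F : x y / x <= y}.
Proof.
move=> [lf Ff] f0 x y xy; rewrite -subr_ge0 Ff//; apply: itg_ge0_ae => //.
exact: locint_measurable.
Qed.

Lemma primitive_lipschitz F f a b c : primitive F f -> {ae mu, forall x, `|f x| <= c} ->
  a <= b -> `|F b - F a| <= c * (b - a).
Proof.
move=> [lf Ff] fc ab; rewrite Ff// (le_trans (itg_norm_le _ _ lf))//.
rewrite -itg_cst//; apply: le_itg_ae => //; first exact: locint_norm.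
exact: locint_cst.
Qed.

(* The increment of [phi \o F] over a short interval around x is
   [phi' c * int f] by the mean value theorem, where c lies between two values
   of F close to F x. *)
Lemma primitive_comp phi dphi F f :
  (forall z : R, is_derive z 1 phi (dphi z)) -> continuous dphi -> primitive F f ->
  primitive (phi \o F) (fun x => dphi (F x) * f x).
Proof.
move=> dP cd PF; have cF := primitive_continuous PF; have [lf Ff] := PF.
have cphi : continuous phi.
  by move=> z; apply: differentiable_continuous; apply/derivable1_diffP.
have lg : locally_integrable [set: R] (fun x => dphi (F x) * f x).
  by apply: (@locintM_cont _ _ (dphi \o F)) => // x; apply: continuous_comp; [exact: cF|exact: cd].
split=> // a b ab.
(* [D] is the defect of the claimed formula, to be shown constant; [K], the integral of |f|,
   controls its increments. *)
pose g x := dphi (F x) * f x.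
pose K x := itg a x (fun x => `|f x|).
pose D x := phi (F x) - itg a x g.
suff : D b = D a.
  rewrite /D /= (_ : itg a a g = 0) ?subr0.
    by move/eqP; rewrite subr_eq => /eqP ->; rewrite addrAC subrr add0r.
  by have := @itg_split R g a a a lg (lexx _) (lexx _); lra.
apply: (@eq_of_small_increments _ D K) => // e x e0 /andP[ax xb].
have /cvgrPdist_lt/(_ (e / 2)) := cd (F x).
have e20 : 0 < e / 2 by rewrite divr_gt0.
move=> /(_ e20) [eta /= eta0 Heta].
have /cvgrPdist_lt/(_ eta eta0) [d /= d0 Hd] := cF x.
exists d => // u v /andP[au ux] /andP[xv vb] du dv.
have uv : u <= v by exact: le_trans xv.
have near y : u <= y <= v -> `|F x - F y| < eta.
  move=> /andP[uy yv]; apply: Hd => /=; rewrite ltr_norml; apply/andP; split; lra.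
have conv z p q : `|z - p| < eta -> `|z - q| < eta -> forall c, p <= c <= q -> `|z - c| < eta.
  by rewrite !ltr_norml => /andP[? ?] /andP[? ?] c /andP[? ?]; rewrite ltr_norml; apply/andP; split; lra.
have [c cn cE] : exists2 c, `|F x - c| < eta & phi (F v) - phi (F u) = dphi c * (F v - F u).
  have nu : `|F x - F u| < eta by apply: near; rewrite lexx.
  have nv : `|F x - F v| < eta by apply: near; rewrite lexx uv.
  have [FE|FF|FF] := ltgtP (F u) (F v).
  - have [c] := @MVT R phi dphi (F u) (F v) FE (fun z _ => dP z) (continuous_subspaceT cphi).
    rewrite in_itv/= => /andP[uc cv] ->; exists c => //.
    by apply: (conv _ (F u) (F v)) => //; rewrite !ltW.
  - have [c] := @MVT R phi dphi (F v) (F u) FF (fun z _ => dP z) (continuous_subspaceT cphi).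
    rewrite in_itv/= => /andP[uc cv] E; exists c; last first.
      by rewrite -opprB E; ring.
    by apply: (conv _ (F v) (F u)) => //; rewrite !ltW.
  - by exists (F u) => //; rewrite FF !subrr mulr0.
have lnf := locint_norm lf.
have -> : D v - D u = itg u v (fun y => (dphi c - dphi (F y)) * f y).
  rewrite /D (@itg_split R g a u v)//.
  transitivity (dphi c * itg u v f - itg u v g).
    by rewrite -Ff// -cE; ring.
  rewrite -itgZ// -itgB//; last exact: locintZ.
  by congr itg; apply/funext => y; rewrite /g; ring.
have lh : locally_integrable [set: R] (fun y => (dphi c - dphi (F y)) * f y).
  apply: (@locintM_cont _ _ (fun y => dphi c - dphi (F y))) => // y.
  by apply: cvgB; [exact: cvg_cst|apply: continuous_comp; [exact: cF|exact: cd]].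
rewrite (le_trans (itg_norm_le _ _ lh))//.
have -> : K v - K u = itg u v (fun x => `|f x|).
  by rewrite /K (@itg_split R _ a u v)//; ring.
rewrite -itgZ//; apply: le_itg; [exact: locint_norm|exact: locintZ|].
move=> y uyv; rewrite normrM ler_wpM2r//.
have -> : dphi c - dphi (F y) = (dphi (F x) - dphi (F y)) - (dphi (F x) - dphi c) by ring.
rewrite (le_trans (ler_normB _ _))//.
have := Heta c cn; have := Heta (F y) (near y uyv); lra.
Qed.

Lemma primitive_sqr F f : primitive F f -> primitive (fun x => F x ^+ 2) (fun x => 2 * F x * f x).
Proof.
move=> PF; have := @primitive_comp (fun z => z ^+ 2) (fun z => 2 * z) F f _ _ PF.
apply=> [z|z].
  by apply: is_derive_eq; rewrite /GRing.scale/=; ring.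
by apply: cvgM; [exact: cvg_cst|exact: cvg_id].
Qed.

Lemma primitive_expR F f : primitive F f -> primitive (fun x => expR (F x)) (fun x => expR (F x) * f x).
Proof.
move=> PF; have := @primitive_comp expR expR F f _ _ PF; apply.
exact: continuous_expR.
Qed.

Lemma primitive_eq F f F' f' : primitive F f -> F =1 F' -> f =1 f' -> primitive F' f'.
Proof. by move=> PF /funext <- /funext <-. Qed.

(** Polarization: 4 F G = (F + G)^2 - (F - G)^2, so the chain rule for squares is enough. *)
Lemma primitiveM F f G g : primitive F f -> primitive G g ->
  primitive (F \* G) (fun x => f x * G x + F x * g x).
Proof.
move=> PF PG.
have P1 := primitive_sqr (primitiveD PF PG); have P2 := primitive_sqr (primitiveB PF PG).
apply: primitive_eq (primitiveZ (1/4) (primitiveB P1 P2)) _ _ => x /=.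
  by rewrite /GRing.scale/=; field.
by rewrite /GRing.scale/=; field.
Qed.

End PrimitiveOps.

(** * Change of variables *)

Section Density.
Context {R : realType}.
Local Notation mu := (@lebesgue_measure R).
Variable d : R -> R.
Hypothesis md : measurable_fun [set: R] d.
Hypothesis d0 : forall x, 0 <= d x.
Local Open Scope ereal_scope.

(* [md] and [d0] are arguments so that the measure instance can be inferred. *)
Definition density_measure (A : set (measurableTypeR R))  : \bar R :=
  let _ := md in let _ := d0 in \int[mu]_(x in A) (d x)%:E.

Let density0 : density_measure set0 = 0.
Proof. by rewrite /density_measure integral_set0. Qed.

Let density_ge0 A : 0 <= density_measure A.
Proof. by apply: integral_ge0 => x _; rewrite lee_fin. Qed.

Let density_sigma : semi_sigma_additive density_measure.
Proof.
move=> F mF tF mUF; rewrite /density_measure ge0_integral_bigcup//; last 2 first.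
- by apply/measurable_EFinP; exact: measurable_funS md.
- by move=> x _; rewrite lee_fin.
apply: (is_cvg_ereal_nneg_natsum_cond) => n _ _.
exact: density_ge0.
Qed.

HB.instance Definition _ := isMeasure.Build _ _ _ density_measure
  density0 density_ge0 density_sigma.

Import HBNNSimple.

(** True for indicators by definition of the measure, for simple functions by linearity, and in
    general by monotone convergence on both sides along [nnsfun_approx]. *)
Lemma ge0_integral_density (g : R -> \bar R) : measurable_fun [set: R] g ->
  (forall x, 0 <= g x) ->
  \int[density_measure]_x g x = \int[mu]_x (g x * (d x)%:E).
Proof.
move=> mg g0.
pose g_ := @nnsfun_approx _ (measurableTypeR R) R setT measurableT g mg.
have gE x : limn (fun n => (g_ n x)%:E) = g x.
  by apply/cvg_lim => //; apply: cvg_nnsfun_approx.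
transitivity (limn (fun n => \int[density_measure]_x (g_ n x)%:E)).
  rewrite -monotone_convergence//.
  - by apply: eq_integral => x _; rewrite gE.
  - by move=> n; apply/measurable_EFinP; exact: measurable_funPT.
  - by move=> n x _; rewrite lee_fin.
  - by move=> x _ m n mn; rewrite lee_fin; exact/lefP/nd_nnsfun_approx.
transitivity (limn (fun n => \int[mu]_x ((g_ n x)%:E * (d x)%:E))); last first.
  rewrite -monotone_convergence//.
  - apply: eq_integral => x _; rewrite -gE; apply/cvg_lim => //.
    apply: cvgeZr => //; apply: ereal_nondecreasing_is_cvgn => m n mn.
    by rewrite lee_fin; exact/lefP/nd_nnsfun_approx.
  - move=> n; under eq_fun do rewrite -EFinM.
    by apply/measurable_EFinP/measurable_funM.
  - by move=> n x _; rewrite -EFinM lee_fin mulr_ge0.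
  - move=> x _ m n mn; rewrite lee_wpmul2r ?lee_fin//.
    exact/lefP/nd_nnsfun_approx.
congr (limn _); apply/funext => n.
have mgn r : measurable (g_ n @^-1` [set r]) by exact: measurable_funPTI.
transitivity (\sum_(k \in range (g_ n))
    \int[mu]_x ((k * \1_(g_ n @^-1` [set k]) x)%:E * (d x)%:E)); last first.
  rewrite -ge0_integral_fsum//.
  - apply: eq_integral => x _; rewrite -ge0_mule_fsuml.
      by rewrite fsumEFin// -fimfunE.
    by move=> r; rewrite nnfun_muleindic_ge0.
  - move=> r; under eq_fun do rewrite -EFinM.
    by apply/measurable_EFinP/measurable_funM => //; exact/measurable_funM.
  - by move=> r x _; rewrite mule_ge0 ?lee_fin// -lee_fin nnfun_muleindic_ge0.
under eq_integral do rewrite fimfunE -fsumEFin//.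
rewrite ge0_integral_fsum//; last 2 first.
- by move=> r; exact/measurable_EFinP/measurable_funM.
- by move=> r x _; rewrite nnfun_muleindic_ge0.
apply: eq_fsbigr => r; rewrite inE => -[x _ <-].
have r0 : (0 <= g_ n x)%R by [].
rewrite (integralZl_indic _ (fun r => g_ n @^-1` [set r]))//; last first.
  by move=> r0'; rewrite preimage_nnfun0.
rewrite integral_indic//= setIT.
under [RHS]eq_integral do rewrite EFinM -muleA.
rewrite ge0_integralZl//.
- congr (_ * _); rewrite /= /density_measure integral_mkcond.
  apply: eq_integral => y _; rewrite restrict_EFin//= patchE indicE.
  by case: (y \in _); rewrite ?mul1e ?mul0e.
- under eq_fun do rewrite -EFinM.
  by apply/measurable_EFinP/measurable_funM.
- by move=> y _; rewrite -EFinM lee_fin mulr_ge0.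
Qed.

End Density.

(** * Almost everywhere derivatives of primitives *)

Section MeasurableDerive.
Context {R : realType}.
Local Notation mu := (@lebesgue_measure R).
Implicit Types (f g F G : R -> R) (a b c x h : R).

Let dq F (h x : R) := h^-1 * (F (h + x) - F x).

Let derivable_cvg F x : derivable F x 1 <-> cvg (dq F h x @[h --> 0^']).
Proof.
rewrite /derivable.
suff -> : (fun h : R => h^-1 *: ((F \o shift x) (h *: 1) - F x)) = (fun h => dq F h x) by [].
by apply/funext => h; rewrite /dq /= /GRing.scale/= mulr1.
Qed.

(* Differentiability at x is the Cauchy criterion for the difference quotients;
   each instance of it is a closed condition on x when F is continuous. *)
Let cauchy_set F (k m : nat) := \bigcap_(h in [set h : R | 0 < `|h| < m.+1%:R^-1])
  \bigcap_(h' in [set h : R | 0 < `|h| < m.+1%:R^-1])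
    [set x | `|dq F h x - dq F h' x| <= k.+1%:R^-1].

Let derivableE F : [set x | derivable F x 1] = \bigcap_k \bigcup_m cauchy_set F k m.
Proof.
apply/seteqP; split => [x /= /derivable_cvg/cvg_ex[l /cvgrPdist_lt Fl] k _|x Ax /=].
  have [|d /= d0 Hd] := Fl (k.+1%:R^-1 / 2); first by rewrite divr_gt0.
  have [m [_]] : exists m, True /\ m.+1%:R^-1 < d.
    exists (Num.truncn d^-1); split=> //; rewrite invf_plt ?posrE//.
    exact: truncnS_gt.
  move=> md; exists m => // h /= /andP[h0 hm] h' /= /andP[h'0 h'm].
  have H z : 0 < `|z| -> `|z| < m.+1%:R^-1 -> `|l - dq F z x| < k.+1%:R^-1 / 2.
    move=> z0 zm; apply: Hd => /=; last by rewrite -normr_gt0.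
    by rewrite sub0r normrN (lt_trans zm).
  have -> : dq F h x - dq F h' x = (l - dq F h' x) - (l - dq F h x) by ring.
  rewrite (le_trans (ler_normB _ _))//.
  by rewrite [leRHS]splitr ltW// ltrD// H.
apply/derivable_cvg/cauchy_cvgP; apply: cauchy_exP => e e0.
have [k ke] : exists k, k.+1%:R^-1 < e.
  by exists (Num.truncn e^-1); rewrite invf_plt ?posrE//; exact: truncnS_gt.
have [m _ Hm] := Ax k Logic.I.
pose h0 : R := m.+1%:R^-1 / 2.
have m0 : 0 < m.+1%:R^-1 :> R by rewrite invr_gt0.
exists (dq F h0 x); exists (m.+1%:R^-1) => //= h /=; rewrite sub0r normrN => hm h_neq0.
rewrite /ball/= (le_lt_trans _ ke)//; apply: (Hm h0 _ h) => /=; last first.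
  by rewrite normr_gt0 h_neq0.
have h00 : 0 < h0 by rewrite divr_gt0.
by rewrite gtr0_norm// h00 /h0 ltr_pdivrMr// ltr_pMr// ltr1n.
Qed.

Let dq_continuous F z : continuous F -> continuous (dq F z).
Proof.
move=> cF y; apply: cvgM; first exact: cvg_cst.
apply: cvgB; last exact: cF.
by apply: (@continuous_comp _ _ _ (fun y => z + y) F); [apply: cvgD; [exact: cvg_cst|exact: cvg_id]|exact: cF].
Qed.

Lemma measurable_derivable F : continuous F -> measurable [set x | derivable F x 1].
Proof.
move=> cF; rewrite derivableE; apply: bigcap_measurable => // k _.
apply: bigcup_measurable => // m _; apply: closed_measurable.
apply: closed_bigI => h _; apply: closed_bigI => h' _.
have -> : [set x | `|dq F h x - dq F h' x| <= k.+1%:R^-1] =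
  (fun x => `|dq F h x - dq F h' x|) @^-1` [set y | y <= k.+1%:R^-1] by [].
apply: preimage_closed; last exact: closed_le.
by move=> y _; apply: cvg_norm; apply: cvgB; exact: dq_continuous.
Qed.

(** On the measurable set where F is differentiable, the derivative is the limit of the quotients
    with step 1 / (n + 1); elsewhere it is [point], the value of [lim] on a divergent family. *)
Lemma measurable_derive1 F : continuous F -> measurable_fun [set: R] F^`().
Proof.
move=> cF.
pose h (n : nat) x := if x \in [set x | derivable F x 1] then dq F n.+1%:R^-1 x else point.
apply: (@measurable_fun_cvg _ _ _ _ h).
  move=> m; apply: measurable_fun_ifT => //.
    apply: (@measurable_fun_bool _ _ _ _ true); rewrite setTI.
    rewrite (_ : _ @^-1` _ = [set x | derivable F x 1]); first exact: measurable_derivable.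
    by apply/seteqP; split => x /= => [/set_mem//|dFx]; exact: mem_set.
  by apply: continuous_measurable_fun; exact: dq_continuous.
move=> x _; have [dF|dF] := pselect (derivable F x 1); last first.
  have -> : h ^~ x = (fun=> point).
    by apply/funext => n; rewrite /h memNset.
  rewrite /derive1 dvgP; first exact: cvg_cst.
  by move=> c; apply: dF; apply/derivable_cvg.
have -> : h ^~ x = (fun n => dq F n.+1%:R^-1 x).
  by apply/funext => n; rewrite /h mem_set.
have /derivable_cvg := dF.
move=> /cvg_ex[l Fl]; have -> : F^`() x = l by rewrite /derive1; apply/cvg_lim => //.
apply: (iffLR (cvgr_dnbhsP _ _ _) Fl).
by split; [move=> n; rewrite invr_neq0|exact: cvg_harmonic].
Qed.

Lemma primitive_derive1 F f : primitive F f -> {ae mu, forall x, F^`() x = f x}.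
Proof.
move=> /primitive_is_derive; apply: aeS => x dF.
by rewrite derive1E; exact: derive_val.
Qed.

(** Any density can be exchanged for the pointwise derivative: they agree a.e., and the derivative
    of a continuous function is measurable. *)
Lemma primitive_W11loc F f : primitive F f -> W11loc F.
Proof.
move=> PF; apply/primitive_W11; apply: (primitive_ae _ _ PF).
  exact: measurable_derive1 (primitive_continuous PF).
by apply: aeS (primitive_derive1 PF) => x ->.
Qed.

End MeasurableDerive.

Lemma nondecreasing_primitive_ge0 {R : realType} (f df : R -> R) :
  primitive f df -> {homo f : x y / x <= y} ->
  {ae @lebesgue_measure R, forall x, 0 <= df x}.
Proof.
move=> Pf ndf; apply: aeS (primitive_is_derive Pf) => x dfx.
have : derivable f x 1 by exact: ex_derive.
have <- : 'D_1 f x = df x by exact: derive_val.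
move=> D; rewrite /derive; apply: limr_ge => //; near=> h.
have [h0|h0] := leP 0 h.
  by rewrite /GRing.scale/= mulr_ge0// ?invr_ge0// subr_ge0 mulr1 ndf// lerDr.
rewrite /GRing.scale/= mulr_le0// ?invr_le0 ?subr_le0 ?mulr1; [exact: ltW|].
by rewrite ndf// gerDr ltW.
Unshelve. all: by end_near. Qed.

(** * Substitution along a monotone absolutely continuous bijection *)

Section ChangeOfVariables.
Context {R : realType}.
Local Notation mu := (@lebesgue_measure R).
Implicit Types (a b c x : R) (h : R -> R).
Variables f g df : R -> R.
Hypothesis Pf : primitive f df.
Hypothesis ndf : {homo f : x y / x <= y}.
Hypotheses (fK : cancel f g) (gK : cancel g f).

Let leg x y : (x <= f y) = (g x <= y).
Proof.
apply/idP/idP => [xy|xy]; last by rewrite -(gK x) ndf.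
rewrite leNgt; apply/negP => ygx.
have /ndf := ltW ygx; rewrite gK => fyx.
have E : x = f y by apply/le_anti; rewrite xy fyx.
by move: ygx; rewrite E fK ltxx.
Qed.

Let ltg x y : (x < f y) = (g x < y).
Proof.
by rewrite lt_neqAle leg [RHS]lt_neqAle -(can_eq fK (g x) y) gK.
Qed.

Let gleg x y : (f x <= y) = (x <= g y). Proof. by rewrite -[y in LHS]gK !leNgt ltg gK. Qed.

Let df_ge0 : {ae mu, forall x, 0 <= df x}.
Proof. exact: nondecreasing_primitive_ge0 Pf ndf. Qed.

Let cf : continuous f := primitive_continuous Pf.

Let mf : measurable_fun [set: R] f. Proof. exact: continuous_measurable_fun. Qed.

(** [density_measure] asks for a density that is nonnegative everywhere, while [df] is so only
    a.e. *)
Let d x := `|df x|.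
Let md : measurable_fun [set: R] d.
Proof. by apply: measurableT_comp => //; apply: locint_measurable; case: Pf. Qed.

Let d0 x : 0 <= d x. Proof. exact: normr_ge0. Qed.

Let ld : locally_integrable [set: R] d.
Proof. by apply: locint_norm; case: Pf. Qed.

Let itg_d a b : a <= b -> itg a b d = f b - f a.
Proof.
case: Pf => ldf fE ab; rewrite fE//; apply: ae_eq_itg => //.
  exact: locint_measurable.
by apply: aeS df_ge0 => x dx; rewrite /d ger0_norm.
Qed.

(* The image by f of the measure of density f' has the mass of Lebesgue measure
   on intervals. *)
Let push (A : set (measurableTypeR R)) : measurable A ->
  lebesgue_measure A = pushforward (density_measure md d0) (f : measurableTypeR R -> measurableTypeR R) A.
Proof.
move=> mA; apply: lebesgue_measure_unique => // _ [[a b]] _ <-.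
rewrite /= /pushforward /density_measure/=.
have -> : f @^-1` `]a, b] = `]g a, g b]%classic.
  by apply/seteqP; split => x /=; rewrite !in_itv/= ltg gleg.
have [ab|ba] := ltP a b; last first.
  rewrite !set_itv_ge ?integral_set0 ?measure0// -leNgt bnd_simp//.
  by rewrite -leg gK.
have gab : g a <= g b by rewrite -leg gK ltW.
rewrite integral_itv_obnd_cbnd; last first.
  by apply/measurable_EFinP; exact: measurable_funS md.
rewrite lebesgue_measure_itv/= lte_fin ab -[RHS]fineK; last first.
  by apply: integrable_fin_num => //; exact: (locint_int (g a) (g b) ld).
by rewrite -/(Rintegral _ _ _) -/(itg _ _ _) itg_d// !gK.
Qed.

Lemma ge0_change_of_variables (h : R -> \bar R) : measurable_fun [set: R] h ->
  (forall x, (0 <= h x)%E) ->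
  (\int[mu]_y h y = \int[mu]_x (h (f x) * `|df x|%:E))%E.
Proof.
move=> mh h0.
rewrite -(ge0_integral_density md d0 (g := h \o f)) //; last first.
  by move=> x /=; exact: h0.
  exact: measurableT_comp.
transitivity (\int[pushforward (density_measure md d0) (f : measurableTypeR R -> measurableTypeR R)]_y h y)%E.
  apply: eq_measure_integral => A mA _; exact: push.
by rewrite ge0_integral_pushforward// preimage_setT.
Qed.

Let preim a b : f @^-1` `[f a, f b] = `[a, b]%classic.
Proof. by apply/seteqP; split => x /=; rewrite !in_itv/= leg gleg !fK. Qed.

Lemma ge0_substitution h a b : measurable_fun [set: R] h -> (forall x, 0 <= h x) ->
  (\int[mu]_(y in `[f a, f b]) (h y)%:E = \int[mu]_(x in `[a, b]) (h (f x) * `|df x|)%:E)%E.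
Proof.
move=> mh h0; rewrite integral_mkcond ge0_change_of_variables.
- rewrite [RHS]integral_mkcond; apply: eq_integral => x _.
  rewrite !patchE -(preim a b); case: ifPn => xab.
    by rewrite mem_set ?EFinM//; exact: set_mem xab.
  by rewrite memNset ?mul0e//; apply/negP; apply: contra xab => /mem_set.
- by apply/(measurable_restrictT _ _).1 => //; apply/measurable_EFinP; exact: measurable_funS mh.
- by move=> x; rewrite patchE; case: ifP; rewrite ?lee_fin.
Qed.

Let mhf h : measurable_fun [set: R] h -> measurable_fun [set: R] (fun x => h (f x) * d x).
Proof.
by move=> mh; apply: measurable_funM => //; exact: measurableT_comp.
Qed.

Let locint_subst_norm h : locally_integrable [set: R] h ->
  locally_integrable [set: R] (fun x => h (f x) * d x).
Proof.
move=> lh; have /locintP[mh _] := lh.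
apply/locintP; split; first exact: mhf.
move=> a b; have /locintP[mnh inh] := locint_norm lh.
apply/integrableP; split.
  by apply/measurable_EFinP; apply: measurable_funS (mhf mh).
have /integrableP[_] := inh (f a) (f b).
apply: le_lt_trans; rewrite le_eqVlt; apply/orP; left; apply/eqP.
under [RHS]eq_integral do rewrite /= normr_id.
rewrite (@ge0_substitution (fun x => `|h x|))//.
by apply: eq_integral => x _ /=; rewrite normrM (ger0_norm (d0 x)).
Qed.

Let ddf : {ae mu, forall x, d x = df x}.
Proof. by apply: aeS df_ge0 => x; exact: ger0_norm. Qed.

Lemma locint_substitution h : locally_integrable [set: R] h ->
  locally_integrable [set: R] (fun x => h (f x) * df x).
Proof.
move=> lh; have /locintP[mh _] := lh.
(* [primitive_ae] transfers local integrability from [d] to the a.e. equal [df]; only that half of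
   [primitive] is kept. *)
have [] : primitive (fun x => oriented_int 0 x (fun x => h (f x) * d x)) (fun x => h (f x) * df x); last by [].
apply: primitive_ae (primitive_itg (locint_subst_norm lh)).
  by apply: measurable_funM; [exact: measurableT_comp|apply: locint_measurable; case: Pf].
by apply: aeS ddf => x ->.
Qed.

Lemma substitution h a b : locally_integrable [set: R] h ->
  itg (f a) (f b) h = itg a b (fun x => h (f x) * df x).
Proof.
move=> lh; have /locintP[mh _] := lh.
transitivity (itg a b (fun x => h (f x) * d x)); last first.
  apply: ae_eq_itg; [exact: mhf|exact: locint_measurable (locint_substitution lh)|].
  by apply: aeS ddf => x ->.
have H u : (forall x, 0 <= u x) -> locally_integrable [set: R] u ->
    itg (f a) (f b) u = itg a b (fun x => u (f x) * d x).
  move=> u0 lu; rewrite /itg /Rintegral; congr fine.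
  by rewrite ge0_substitution//; exact: locint_measurable.
have lnh := locint_norm lh.
(* [u] and [v] are the positive and the negative part of h. *)
pose u x := 2^-1 * (`|h x| + h x); pose v x := 2^-1 * (`|h x| - h x).
have hE : h = fun x => u x - v x by apply/funext => x; rewrite /u /v; field.
have u0 x : 0 <= u x by rewrite mulr_ge0// -lerBlDr sub0r ler_normr lexx orbT.
have v0 x : 0 <= v x by rewrite mulr_ge0// subr_ge0 ler_norm.
have lu : locally_integrable [set: R] u by apply: locintZ; exact: locally_integrableD.
have lv : locally_integrable [set: R] v by apply: locintZ; exact: locally_integrableB.
rewrite hE itgB// !H// -itgB; [|exact: locint_subst_norm|exact: locint_subst_norm].
by congr itg; apply/funext => x; rewrite mulrBl.
Qed.

Lemma primitive_substitution H h : primitive H h ->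
  primitive (H \o f) (fun x => h (f x) * df x).
Proof.
move=> [lh HE]; split; first exact: locint_substitution.
by move=> a b ab; rewrite /= HE ?ndf// substitution.
Qed.

(** If N is null, then 1_N (f x) |df x| has integral mu N = 0, so df vanishes a.e. on the preimage
    of N. The preimage itself may have positive measure, as the inverse of f need not be absolutely
    continuous. *)
Lemma ae_substitution (P : R -> Prop) : {ae mu, forall y, P y} ->
  {ae mu, forall x, df x != 0 -> P (f x)}.
Proof.
move=> [N [mN N0 PN]].
have mNf : measurable (f @^-1` N) by rewrite -[_ @^-1` _]setTI; exact: mf.
have : ae_eq mu setT (fun x => (\1_N (f x) * `|df x|)%:E) (cst 0%E).
  apply/ae_eq_integral_abs => //.
    apply/measurable_EFinP; apply: mhf; exact: measurable_indic.
  under eq_integral do rewrite gee0_abs ?lee_fin ?mulr_ge0//.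
  under eq_integral do rewrite EFinM.
  rewrite -(@ge0_change_of_variables (EFin \o \1_N)).
  - by rewrite integral_indic// setIT.
  - by apply/measurable_EFinP; exact: measurable_indic.
  - by move=> x; rewrite lee_fin.
apply: aeS => x /(_ Logic.I) /= [] H dx0; apply: contrapT => nP.
have : N (f x) by apply: PN.
move=> Nfx; move: H; rewrite indicE mem_set//= mul1r => /eqP.
by rewrite normr_eq0 (negbTE dx0).
Qed.

End ChangeOfVariables.

(** * Periodic functions *)

Section Periodic.
Context {R : realType}.
Local Notation mu := (@lebesgue_measure R).
Local Notation I01 := (`[0%R, 1%R]%classic : set R).
Implicit Types (a b c x : R) (f : R -> R).

Let primitive_shift c : primitive (fun x => x + c) (fun=> 1).
Proof.
apply: primitive_eq (primitiveD (@primitive_id R) (primitive_cst c)) _ _ => x //=.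
by rewrite addr0.
Qed.

Let shift_homo c : {homo (fun x => x + c) : x y / x <= y}.
Proof. by move=> x y xy; rewrite lerD2r. Qed.

Lemma ae_shift (P : R -> Prop) c : {ae mu, forall x, P x} -> {ae mu, forall x, P (x + c)}.
Proof.
move=> aeP.
have := ae_substitution (primitive_shift c) (@shift_homo c) (addrK c) (subrK c) aeP.
by apply: aeS => x; apply; exact: oner_neq0.
Qed.

Lemma itg_shift (h : R -> R) a b c : locally_integrable [set: R] h ->
  itg (a + c) (b + c) h = itg a b (fun x => h (x + c)).
Proof.
move=> lh; have := substitution (primitive_shift c) (@shift_homo c) (addrK c) (subrK c) a b lh.
by move=> ->; congr itg; apply/funext => x; rewrite mulr1.
Qed.

Lemma locint_shift (h : R -> R) c : locally_integrable [set: R] h ->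
  locally_integrable [set: R] (fun x => h (x + c)).
Proof.
move=> lh; have := locint_substitution (primitive_shift c) (@shift_homo c) (addrK c) (subrK c) lh.
by congr (locally_integrable _ _); apply/funext => x; rewrite mulr1.
Qed.

Lemma primitive_comp_shift H (h : R -> R) c : primitive H h ->
  primitive (fun x => H (x + c)) (fun x => h (x + c)).
Proof.
move=> PH; have := primitive_substitution (primitive_shift c) (@shift_homo c) (addrK c) (subrK c) PH.
by move/primitive_eq; apply => x //=; rewrite mulr1.
Qed.

(** As a function of x, the integral over [x, x + 1] has density h (x + 1) - h x = 0. *)
Lemma itg_periodic (h : R -> R) a : locally_integrable [set: R] h -> (forall x, h (x + 1) = h x) ->
  itg a (a + 1) h = itg 0 1 h.
Proof.
move=> lh hp; pose H x := oriented_int 0 x h.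
have PH : primitive H h by exact: primitive_itg.
have PD := primitiveB (primitive_comp_shift 1 PH) PH.
have HE x : itg x (x + 1) h = H (x + 1) - H x.
  by case: PH => _ ->//; rewrite lerDl.
have -> : itg 0 1 h = itg 0 (0 + 1) h by rewrite add0r.
rewrite !HE.
have D0 x y : x <= y -> (H (y + 1) - H y) = (H (x + 1) - H x).
  move=> xy; apply/eqP; rewrite -subr_eq0; apply/eqP.
  have [_ /(_ x y xy) /= ->] := PD.
  transitivity (itg x y (fun=> 0)); last by rewrite itg_cst// mul0r.
  by congr itg; apply/funext => z /=; rewrite hp subrr.
by have [a0|/ltW a0] := leP a 0; [rewrite (D0 a 0)|rewrite (D0 0 a)].
Qed.

Lemma periodic_nat f n x : periodic f 1 -> f (x + n%:R) = f x.
Proof.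
move=> pf; elim: n => [|n ih]; first by rewrite addr0.
by rewrite -natr1 addrA pf.
Qed.

Lemma periodic_int f (k : int) x : periodic f 1 -> f (x + k%:~R) = f x.
Proof.
move=> pf; case: (intP k) => [|n|n]; first by rewrite addr0.
  exact: periodic_nat.
by rewrite -[LHS](@periodic_nat f n.+1)// rmorphN/= subrK.
Qed.

Lemma frac_itv x : 0 <= x - (Num.floor x)%:~R <= 1.
Proof.
by rewrite subr_ge0 ge_floor/= lerBlDl ltW// -intrD1 floorD1_gt.
Qed.

Lemma periodic_frac f x : periodic f 1 -> f (x - (Num.floor x)%:~R) = f x.
Proof.
by move=> pf; rewrite -[RHS](@periodic_int f (- Num.floor x))// rmorphN.
Qed.

Lemma measurable_frac : measurable_fun [set: R] (fun x => x - (Num.floor x)%:~R : R).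
Proof.
apply: measurable_funB => //; apply: nondecreasing_measurable => // x y xy.
by rewrite ler_int le_floor.
Qed.

(** f is its restriction to [0, 1] composed with the fractional part. *)
Lemma measurable_periodic f : periodic f 1 -> measurable_fun I01 f ->
  measurable_fun [set: R] f.
Proof.
move=> pf mf.
have -> : f = (f \_ I01) \o (fun x => x - (Num.floor x)%:~R).
  apply/funext => x /=; rewrite patchE mem_set ?periodic_frac//=.
  by rewrite in_itv/= frac_itv.
apply: measurableT_comp; last exact: measurable_frac.
by apply/(measurable_restrictT _ _).1.
Qed.

(** [a, b] is covered by finitely many intervals [k, k + 1], k an integer from the floor of a on,
    and each is a translate of [0, 1]. *)
Lemma L1per_locint f : L1per f -> locally_integrable [set: R] f.
Proof.
move=> [pf intf]; have mf : measurable_fun [set: R] f.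
  by apply: measurable_periodic => //; apply/measurable_EFinP; exact: measurable_int intf.
have mnf : measurable_fun [set: R] (fun x => `|f x|) by exact: measurableT_comp.
have nf0 x : 0 <= `|f x| by [].
apply/locintP; split=> // a b.
have fin1 (k : int) : (\int[mu]_(y in `[k%:~R, (k%:~R + 1)%R]) (`|f y|%R)%:E < +oo)%E.
  have /integrableP[_] := intf.
  have := @ge0_substitution _ _ _ _ (primitive_shift k%:~R) (@shift_homo k%:~R) (addrK k%:~R) (subrK k%:~R) _ 0 1 mnf nf0.
  rewrite add0r addrC => ->; apply: le_lt_trans; rewrite le_eqVlt; apply/orP; left; apply/eqP.
  by apply: eq_integral => x _; rewrite normr1 mulr1 periodic_int.
have fin (k : int) (m : nat) : (\int[mu]_(y in `[k%:~R, (k%:~R + m%:R)%R]) (`|f y|%R)%:E < +oo)%E.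
  elim: m => [|m ih]; first by rewrite addr0 set_itv1 integral_set1.
  rewrite (@itv_bndbnd_setU _ _ _ (BRight (k%:~R + m%:R))) ?bnd_simp ?lerDl ?lerD2l ?ler_nat//.
  rewrite ge0_integral_setU//=; last 2 first.
    by apply/measurable_EFinP; exact: measurable_funS mnf.
    by apply: lt_disjoint => x y; rewrite !in_itv/= => /andP[_ xk] /andP[+ _]; exact: le_lt_trans.
  apply: lte_add_pinfty => //; rewrite integral_itv_obnd_cbnd; last first.
    by apply/measurable_EFinP; exact: measurable_funS mnf.
  have := fin1 (k + m%:Z); rewrite rmorphD/= -natr1 addrA; exact.
apply/integrableP; split; first by apply/measurable_EFinP; exact: measurable_funS mf.
have [m bm] : exists m : nat, b <= (Num.floor a)%:~R + m%:R.
  exists (Num.truncn `|b - (Num.floor a)%:~R|).+1.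
  by rewrite -lerBlDl (le_trans (ler_norm _))// ltW// truncnS_gt.
apply: le_lt_trans (fin (Num.floor a) m).
apply: ge0_subset_integral => //=.
  by apply/measurable_EFinP; exact: measurable_funS mnf.
by apply: subset_itv; rewrite bnd_simp// ge_floor.
Qed.

Lemma locint_L1per f : periodic f 1 -> locally_integrable [set: R] f -> L1per f.
Proof. by move=> pf lf; split=> //; exact: locint_int. Qed.

(** The constant c covers periodic functions, with c = 0, as well as y and relabelings, with c =
    1. *)
Lemma derive1_periodic f c : (forall x, f (x + 1) = f x + c) -> forall x, f^`() (x + 1) = f^`() x.
Proof.
move=> fp x; rewrite /derive1.
suff -> : (fun h : R => h^-1 *: (f (h + (x + 1)) - f (x + 1))) = (fun h => h^-1 *: (f (h + x) - f x)) by [].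
by apply/funext => h; rewrite addrA !fp opprD addrACA subrr addr0.
Qed.

End Periodic.

(** * The seminorm of E *)

Section Norms.
Context {R : realType}.
Local Notation mu := (@lebesgue_measure R).
Local Notation I01 := (`[0%R, 1%R]%classic : set R).
Implicit Types (a b c x : R) (f g : R -> R) (V W X Y : lagr R).

(** The norm with exponent +oo is by definition the essential supremum only on a space of positive
    measure. *)
Lemma lebesgue_setT_gt0 : (0 < mu [set: R])%E.
Proof.
apply: (@lt_le_trans _ _ (mu I01)); last by apply: le_measure; rewrite ?inE.
by rewrite lebesgue_measure_itv/= lte_fin ltr01 oppr0 adde0 lte_fin.
Qed.

Lemma normLy_leP D f c : 0 <= c ->
  (normLp +oo D f <= c%:E)%E <-> {ae mu, forall x, D x -> `|f x| <= c}.
Proof.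
move=> c0; rewrite /normLp unlock lebesgue_setT_gt0.
split=> [/ess_supP|H].
  apply: aeS => x + Dx; rewrite /= patchE mem_set//=.
apply/ess_supP; apply: aeS H => x H /=; rewrite patchE; case: ifPn => [xD|_] /=.
  by rewrite lee_fin H//; exact: set_mem xD.
by rewrite normr0.
Qed.

Lemma normLy_ge0 D f : (0 <= normLp +oo D f)%E.
Proof. exact: Lnorm_ge0. Qed.

(** A value above c at one point would persist on a subinterval of [a, b] of positive length, which
    no null set contains. *)
Lemma ae_le_continuous f a b c : a < b -> continuous f ->
  {ae mu, forall x, a <= x <= b -> f x <= c} -> forall x, a <= x <= b -> f x <= c.
Proof.
move=> ab cf aef x /andP[ax xb]; rewrite leNgt; apply/negP => cfx.
have [d /= d0 Hd] : \forall y \near x, c < f y.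
  by have := cf x; move/cvgr_gt; apply.
pose u := Num.max a (x - d / 2); pose v := Num.min b (x + d / 2).
have uv : u < v.
  rewrite gt_max !lt_min ab/=; apply/andP; split; first lra.
  by apply/andP; split; lra.
have [N [mN N0 HN]] := aef.
have : (mu `[u, v] <= mu N)%E.
  apply: le_measure; rewrite ?inE//; apply: subset_trans HN => y /=.
  rewrite in_itv/= /u /v ge_max le_min => /andP[/andP[ay dy] /andP[yb yd]] /(_ _)/wrap[].
    by rewrite ay.
  rewrite leNgt => /negP; apply; apply: Hd => /=.
  by rewrite ltr_norml; apply/andP; split; lra.
by rewrite N0 lebesgue_measure_itv/= lte_fin uv leNgt -EFinB lte_fin subr_gt0 uv.
Qed.

(** Real-valued norms, so that estimates take place in R; they represent the extended norms
    faithfully for continuous, respectively locally integrable, functions. *)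
Definition supn f : R := fine (normLp +oo I01 f).
Definition l1n f : R := itg 0 1 (fun x => `|f x|).

Lemma continuous_supnE f : continuous f -> normLp +oo I01 f = (supn f)%:E.
Proof.
move=> cf; rewrite /supn fineK// ge0_fin_numE ?normLy_ge0//.
have [c cfc] := continuous_bnd cf 0 1.
apply: le_lt_trans (ltry `|c|); apply/normLy_leP => //.
by apply: aeW => x /=; rewrite in_itv/= => /cfc /le_trans; apply; exact: ler_norm.
Qed.

Lemma supn_ge0 f : 0 <= supn f.
Proof. by rewrite fine_ge0// normLy_ge0. Qed.

Lemma supn_le f c : continuous f -> (forall x, 0 <= x <= 1 -> `|f x| <= c) -> supn f <= c.
Proof.
move=> cf fc; have c0 : 0 <= c by rewrite (le_trans _ (fc 0 _))// lexx ler01.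
rewrite -lee_fin -continuous_supnE//; apply/normLy_leP => //.
by apply: aeW => x /=; rewrite in_itv/=; exact: fc.
Qed.

Lemma le_supn f x : continuous f -> 0 <= x <= 1 -> `|f x| <= supn f.
Proof.
move=> cf x01; apply: (@ae_le_continuous (fun x => `|f x|) 0 1) => //.
  by move=> y; apply: cvg_norm; exact: cf.
have : (normLp +oo I01 f <= (supn f)%:E)%E by rewrite continuous_supnE.
by move/(normLy_leP _ _ (supn_ge0 f)); apply: aeS => y /=; rewrite in_itv.
Qed.

Lemma le_supn_periodic f x : continuous f -> periodic f 1 -> `|f x| <= supn f.
Proof.
by move=> cf pf; rewrite -(periodic_frac x pf) le_supn// frac_itv.
Qed.

Lemma supnD f g : continuous f -> continuous g -> supn (f \+ g) <= supn f + supn g.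
Proof.
move=> cf cg; apply: supn_le => [x|x x01]; first by apply: cvgD; [exact: cf|exact: cg].
by rewrite (le_trans (ler_normD _ _))// lerD// le_supn.
Qed.

Lemma supnZ f c : continuous f -> supn (c \*: f) <= `|c| * supn f.
Proof.
move=> cf; apply: supn_le => [x|x x01].
  by apply: cvgM; [exact: cvg_cst|exact: cf].
by rewrite /= /GRing.scale/= normrM ler_wpM2l// le_supn.
Qed.

Lemma l1n_ge0 f : 0 <= l1n f.
Proof. by apply: Rintegral_ge0. Qed.

Lemma l1nE f : locally_integrable [set: R] f -> normL1per f = (l1n f)%:E.
Proof.
move=> lf; rewrite /normL1per /normLp Lnorm1 /l1n /itg /Rintegral fineK; last first.
  by apply: integrable_fin_num => //; exact: (locint_int 0 1 (locint_norm lf)).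
rewrite [RHS]integral_mkcond; apply: eq_integral => x _.
by rewrite !patchE; case: ifP => //=; rewrite normr0.
Qed.

Lemma l1n_ae f g : measurable_fun [set: R] f -> measurable_fun [set: R] g ->
  {ae mu, forall x, f x = g x} -> l1n f = l1n g.
Proof.
move=> mf mg fg; apply: ae_eq_itg; [exact: measurableT_comp|exact: measurableT_comp|].
by apply: aeS fg => x ->.
Qed.

Lemma l1n_le f g : locally_integrable [set: R] f -> locally_integrable [set: R] g ->
  {ae mu, forall x, `|f x| <= g x} -> l1n f <= itg 0 1 g.
Proof. by move=> lf lg fg; apply: le_itg_ae => //; exact: locint_norm. Qed.

Lemma l1nD f g : locally_integrable [set: R] f -> locally_integrable [set: R] g ->
  l1n (f \+ g) <= l1n f + l1n g.
Proof.
move=> lf lg; have lnf := locint_norm lf; have lng := locint_norm lg.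
rewrite /l1n -itgD//; apply: l1n_le; [exact: locally_integrableD|exact: locally_integrableD|].
by apply: aeW => x; exact: ler_normD.
Qed.

Lemma l1nZ f c : locally_integrable [set: R] f -> l1n (c \*: f) = `|c| * l1n f.
Proof.
move=> lf; rewrite /l1n -itgZ; last exact: locint_norm.
by congr itg; apply/funext => x; rewrite /= normrM.
Qed.

Lemma W11loc_continuous f : W11loc f -> continuous f.
Proof. by move/primitive_W11/primitive_continuous. Qed.

Lemma W11loc_locint f : W11loc f -> locally_integrable [set: R] f^`().
Proof. by case. Qed.

Definition w11n f : R := supn f + l1n f^`().

Lemma w11nE f : W11loc f -> normW11per f = (w11n f)%:E.
Proof.
by move=> wf; rewrite /normW11per continuous_supnE ?l1nE//; [case: wf|exact: W11loc_continuous].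
Qed.

Lemma W11locD f g : W11loc f -> W11loc g -> W11loc (f \+ g).
Proof. by move=> wf wg; exact: primitive_W11loc (primitiveD wf wg). Qed.

Lemma W11locB f g : W11loc f -> W11loc g -> W11loc (f \- g).
Proof. by move=> wf wg; exact: primitive_W11loc (primitiveB wf wg). Qed.

Lemma W11locZ f c : W11loc f -> W11loc (c \*: f).
Proof. by move=> wf; exact: primitive_W11loc (primitiveZ c wf). Qed.

Lemma w11nD f g : W11loc f -> W11loc g -> w11n (f \+ g) <= w11n f + w11n g.
Proof.
move=> wf wg; rewrite /w11n (@l1n_ae (f \+ g)^`() (f^`() \+ g^`())).
- rewrite addrACA; apply: lerD; first by apply: supnD; exact: W11loc_continuous.
  by apply: l1nD; exact: W11loc_locint.
- by apply: locint_measurable; apply: W11loc_locint; exact: W11locD.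
- by apply: measurable_funD; apply: locint_measurable; exact: W11loc_locint.
- exact: primitive_derive1 (primitiveD wf wg).
Qed.

Lemma w11nZ f c : W11loc f -> w11n (c \*: f) <= `|c| * w11n f.
Proof.
move=> wf; rewrite /w11n (@l1n_ae (c \*: f)^`() (c \*: f^`())).
- rewrite mulrDr; apply: lerD; first by apply: supnZ; exact: W11loc_continuous.
  by rewrite l1nZ//; exact: W11loc_locint.
- by apply: locint_measurable; apply: W11loc_locint; exact: W11locZ.
- by apply: measurable_funM => //; apply: locint_measurable; exact: W11loc_locint.
- exact: primitive_derive1 (primitiveZ c wf).
Qed.

Definition Enormr V : R := w11n (ly V) + w11n (lU V) + l1n (lnu V) + l1n (lr V).

Lemma EnormE V : Etangent V -> Enorm V = (Enormr V)%:E.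
Proof.
move=> [[_ wy] [_ wU] /L1per_locint ln /L1per_locint lr].
by rewrite /Enorm !w11nE// !l1nE.
Qed.

Lemma Enormr_ge0 V : 0 <= Enormr V.
Proof. by rewrite !addr_ge0 ?supn_ge0 ?l1n_ge0. Qed.

Definition lagr_add V W : lagr R :=
  Lagr (ly V \+ ly W) (lU V \+ lU W) (lnu V \+ lnu W) (lr V \+ lr W).

Lemma periodicD f g : periodic f 1 -> periodic g 1 -> periodic (f \+ g) 1.
Proof. by move=> pf pg x /=; rewrite pf pg. Qed.

Lemma periodicB f g : periodic f 1 -> periodic g 1 -> periodic (f \- g) 1.
Proof. by move=> pf pg x /=; rewrite pf pg. Qed.

Lemma periodicZ f c : periodic f 1 -> periodic (c \*: f) 1.
Proof. by move=> pf x /=; rewrite pf. Qed.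

Lemma Etangent_add V W : Etangent V -> Etangent W -> Etangent (lagr_add V W).
Proof.
move=> [[py wy] [pU wU] ln lr] [[py' wy'] [pU' wU'] ln' lr'].
split; [split|split| |].
- exact: periodicD.
- exact: W11locD.
- exact: periodicD.
- exact: W11locD.
- apply: locint_L1per; first by apply: periodicD; [case: ln|case: ln'].
  by apply: locally_integrableD; exact: L1per_locint.
- apply: locint_L1per; first by apply: periodicD; [case: lr|case: lr'].
  by apply: locally_integrableD; exact: L1per_locint.
Qed.

Lemma Etangent_scale V c : Etangent V -> Etangent (lagr_scale c V).
Proof.
move=> [[py wy] [pU wU] ln lr].
split; [split|split| |].
- exact: periodicZ.
- exact: W11locZ.
- exact: periodicZ.
- exact: W11locZ.
- apply: locint_L1per; first by apply: periodicZ; case: ln.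
  by apply: locintZ; exact: L1per_locint.
- apply: locint_L1per; first by apply: periodicZ; case: lr.
  by apply: locintZ; exact: L1per_locint.
Qed.

Lemma lagr_subE V W : lagr_sub V W = lagr_add V (lagr_scale (-1) W).
Proof.
by rewrite /lagr_sub /lagr_add /lagr_scale/=; congr Lagr; apply/funext => x;
  rewrite /= /GRing.scale/= mulN1r.
Qed.

Lemma Etangent_sub V W : Etangent V -> Etangent W -> Etangent (lagr_sub V W).
Proof. by move=> tV tW; rewrite lagr_subE; apply: Etangent_add => //; exact: Etangent_scale. Qed.

Lemma EnormrD V W : Etangent V -> Etangent W -> Enormr (lagr_add V W) <= Enormr V + Enormr W.
Proof.
move=> [[_ wy] [_ wU] /L1per_locint ln /L1per_locint lr].
move=> [[_ wy'] [_ wU'] /L1per_locint ln' /L1per_locint lr'].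
have H (a a1 a2 b b1 b2 c c1 c2 d d1 d2 : R) : a <= a1 + a2 -> b <= b1 + b2 ->
  c <= c1 + c2 -> d <= d1 + d2 -> a + b + c + d <= (a1 + b1 + c1 + d1) + (a2 + b2 + c2 + d2) by lra.
by apply: H; [exact: w11nD|exact: w11nD|exact: l1nD|exact: l1nD].
Qed.

Lemma EnormrZ V c : Etangent V -> Enormr (lagr_scale c V) <= `|c| * Enormr V.
Proof.
move=> [[_ wy] [_ wU] /L1per_locint ln /L1per_locint lr].
have H (k a a1 b b1 d d1 e e1 : R) : a <= k * a1 -> b <= k * b1 -> d = k * d1 ->
  e = k * e1 -> a + b + d + e <= k * (a1 + b1 + d1 + e1) by lra.
by apply: H; [exact: w11nZ|exact: w11nZ|exact: l1nZ|exact: l1nZ].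
Qed.

Lemma EnormrB V W : Etangent V -> Etangent W -> Enormr (lagr_sub V W) <= Enormr V + Enormr W.
Proof.
move=> tV tW; rewrite lagr_subE; apply: le_trans (EnormrD tV (Etangent_scale (-1) tW)) _.
by rewrite lerD2l (le_trans (EnormrZ (-1) tW))// normrN normr1 mul1r.
Qed.

Lemma setE_sub X Y : setE X -> setE Y -> Etangent (lagr_sub X Y).
Proof.
move=> [[py wy] [pU wU] ln lr] [[py' wy'] [pU' wU'] ln' lr'].
have yE : ly X \- ly Y = (ly X \- id) \- (ly Y \- id).
  by apply/funext => x /=; ring.
split; [split|split| |] => /=.
- by rewrite yE; exact: periodicB.
- by rewrite yE; exact: W11locB.
- exact: periodicB.
- exact: W11locB.
- apply: locint_L1per; first by apply: periodicB; [case: ln|case: ln'].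
  by apply: locally_integrableB; exact: L1per_locint.
- apply: locint_L1per; first by apply: periodicB; [case: lr|case: lr'].
  by apply: locally_integrableB; exact: L1per_locint.
Qed.

Lemma EdistE X Y : setE X -> setE Y -> Edist X Y = (Enormr (lagr_sub X Y))%:E.
Proof. by move=> eX eY; rewrite /Edist EnormE//; exact: setE_sub. Qed.

End Norms.

(** * Relabeling *)

Section EssBounds.
Context {R : realType}.
Local Notation mu := (@lebesgue_measure R).
Implicit Types (a b c x L : R) (f g h : R -> R).

(** The bound on [0, 1] is translated by every integer, at the price of countably many null sets;
    each x falls into [0, 1] after subtraction of its floor. *)
Lemma Linfloc_periodic_bnd h : Linfloc h -> periodic h 1 ->
  exists2 L, 0 <= L & {ae mu, forall x, `|h x| <= L}.
Proof.
move=> [mh hoo] ph; have := hoo 0 1.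
rewrite -ge0_fin_numE ?normLy_ge0// => /fineK hE.
have L0 : 0 <= fine (normLp +oo `[0, 1] h) by rewrite fine_ge0 ?normLy_ge0.
exists (fine (normLp +oo `[0, 1] h)) => //.
have : (normLp +oo `[0%R, 1%R] h <= (fine (normLp +oo `[0%R, 1%R] h))%:E)%E by rewrite hE.
move=> /(normLy_leP _ _ L0) H.
have Hn (c : nat -> R) : {ae mu, forall x, forall n, `[0, 1]%classic (x + c n) -> `|h (x + c n)| <= fine (normLp +oo `[0, 1] h)}.
  by apply: ae_foralln => n; exact: (ae_shift (c n) H).
apply: aeS2 (Hn (fun n => n%:R)) (Hn (fun n => - n%:R)) => x Hp Hm.
have x01 : `[0, 1]%classic (x - (Num.floor x)%:~R) by rewrite /= in_itv/= frac_itv.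
rewrite -(periodic_frac x ph); move: x01.
case: (intP (Num.floor x)) => [|n|n].
- by rewrite mulr0z subr0 => H0; have := Hp 0%N; rewrite addr0; exact.
- exact: (Hm n.+1).
- by rewrite rmorphN/= opprK; exact: (Hp n.+1).
Qed.

Lemma Linfloc_bnd h L : measurable_fun [set: R] h -> {ae mu, forall x, `|h x| <= L} -> Linfloc h.
Proof.
move=> mh hL; split=> // a b; apply: le_lt_trans (ltry `|L|).
by apply/normLy_leP => //; apply: aeS hL => x hx _; rewrite (le_trans hx)// ler_norm.
Qed.

Lemma Linfloc_continuous h : continuous h -> Linfloc h.
Proof.
move=> ch; split=> [|a b]; first exact: continuous_measurable_fun.
have [c hc] := continuous_bnd ch a b.
apply: le_lt_trans (ltry `|c|); apply/normLy_leP => //; apply: aeW => x /=.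
by rewrite in_itv/= => /hc/le_trans; apply; exact: ler_norm.
Qed.

Lemma W1infloc_intro f df L : primitive f df -> {ae mu, forall x, `|df x| <= L} -> W1infloc f.
Proof.
move=> Pf dfL; have wf := primitive_W11loc Pf; split=> //.
  exact/Linfloc_continuous/(primitive_continuous Pf).
apply: (@Linfloc_bnd _ L); first by apply: locint_measurable; case: wf.
by apply: aeS2 (primitive_derive1 Pf) dfL => x ->.
Qed.

Lemma Linf_bnd h : Linf h -> exists2 L, 0 <= L & {ae mu, forall x, `|h x| <= L}.
Proof.
move=> [mh hoo]; move: hoo.
rewrite -ge0_fin_numE ?normLy_ge0// => /fineK hE.
have L0 : 0 <= fine (normLp +oo setT h) by rewrite fine_ge0 ?normLy_ge0.
exists (fine (normLp +oo setT h)) => //.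
have : (normLp +oo setT h <= (fine (normLp +oo setT h))%:E)%E by rewrite hE.
by move=> /(normLy_leP _ _ L0); apply: aeS => x; apply.
Qed.

Lemma bnd_Linf h L : measurable_fun [set: R] h -> {ae mu, forall x, `|h x| <= L} -> Linf h.
Proof.
move=> mh hL; split=> //; apply: le_lt_trans (ltry `|L|).
by apply/normLy_leP => //; apply: aeS hL => x hx _; rewrite (le_trans hx)// ler_norm.
Qed.

End EssBounds.

Section Relabelings.
Context {R : realType}.
Local Notation mu := (@lebesgue_measure R).
Implicit Types (a b c x L : R) (f g h : R -> R).

(* What is used of an element f of G and of its inverse g. *)
Record relabeling f g : Prop := Relabeling {
  relabK : cancel f g;
  relabKV : cancel g f;
  relab_prim : primitive f f^`();
  relab_homo : {homo f : x y / x <= y};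
  relab_per : forall x, f (x + 1) = f x + 1;
  relab_ub : exists2 L, 0 <= L & {ae mu, forall x, `|f^`() x| <= L};
  relab_lb : exists2 c, 0 < c & {ae mu, forall x, c <= f^`() x} }.

Lemma W1infper_id_bnd f : W1infper (f \- id) -> primitive f f^`() /\
  exists2 L, 0 < L & {ae mu, forall x, `|f^`() x| <= L}.
Proof.
move=> [pf [wf _ Lf]].
have fp x : f (x + 1) = f x + 1 by have := pf x; rewrite /=; lra.
have Pf : primitive f ((f \- id)^`() \+ (fun=> 1)).
  by apply: primitive_eq (primitiveD wf (@primitive_id R)) _ _ => x //=; rewrite subrK.
split; first exact: primitive_W11loc Pf.
have [L L0 HL] : exists2 L, 0 <= L & {ae mu, forall x, `|(f \- id)^`() x| <= L}.
  apply: Linfloc_periodic_bnd Lf _ => x.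
  by apply: (@derive1_periodic _ _ 0) => y; rewrite /= fp; lra.
exists (L + 1); first by rewrite ltr_wpDl.
apply: aeS2 HL (primitive_derive1 Pf) => x xL -> /=.
by rewrite (le_trans (ler_normD _ _))// normr1 lerD2r.
Qed.

(** A continuous injection of the line is monotone, and f 1 = f 0 + 1 decides in which direction. *)
Lemma periodic_injective_homo f g : continuous f -> cancel f g ->
  (forall x, f (x + 1) = f x + 1) -> {homo f : x y / x <= y}.
Proof.
move=> cf fK fp.
have H := @itv_continuous_inj_le R f `]-oo, +oo[.
move=> x y xy; rewrite H//=.
- exists 0, 1; split=> //; rewrite ?in_itv//.
  by rewrite -[1]add0r fp lerDl.
- exact: continuous_subspaceT.
- by move=> u v _ _; exact: (can_inj fK).
Qed.

Lemma homo_inv f g : cancel f g -> cancel g f -> {homo f : x y / x <= y} ->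
  {homo g : x y / x <= y}.
Proof.
move=> fK gK hf x y xy; rewrite leNgt; apply/negP => gyx.
have := hf _ _ (ltW gyx); rewrite !gK => yx.
have E : x = y by apply/le_anti; rewrite xy yx.
by move: gyx; rewrite E ltxx.
Qed.

(** g is L-Lipschitz, so f increases at least at rate 1 / L: f - id / L is nondecreasing and its
    density is nonnegative. *)
Lemma relabeling_lb f g L : primitive f f^`() -> cancel f g -> cancel g f ->
  {homo f : x y / x <= y} -> primitive g g^`() -> 0 < L ->
  {ae mu, forall x, `|g^`() x| <= L} -> {ae mu, forall x, L^-1 <= f^`() x}.
Proof.
move=> Pf fK gK hf Pg L0 gL.
have P : primitive (f \- L^-1 \*: id) (f^`() \- L^-1 \*: (fun=> 1)).
  by apply: primitiveB => //; apply: primitiveZ; exact: primitive_id.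
have h : {homo f \- L^-1 \*: id : x y / x <= y}.
  move=> x y xy /=; have := primitive_lipschitz Pg gL (hf _ _ xy).
  rewrite !fK ger0_norm ?subr_ge0// -ler_pdivrMl// mulrBr /GRing.scale/=; lra.
apply: aeS (nondecreasing_primitive_ge0 P h) => x /=.
by rewrite /GRing.scale/= mulr1 subr_ge0.
Qed.

Lemma setG_relabeling f : setG f -> exists g, relabeling f g /\ relabeling g f.
Proof.
move=> [wf fp [g [fK gK pf pg]]]; exists g.
have [Pf [L L0 HL]] := W1infper_id_bnd pf.
have [Pg [L' L'0 HL']] := W1infper_id_bnd pg.
have hf : {homo f : x y / x <= y} by exact: periodic_injective_homo (primitive_continuous Pf) fK fp.
have hg := homo_inv fK gK hf.
have gp x : g (x + 1) = g x + 1 by have := pg.1 x; rewrite /=; lra.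
split; split=> //.
- by exists L => //; exact: ltW.
- exists L'^-1; first by rewrite invr_gt0.
  exact: relabeling_lb Pg L'0 HL'.
- by exists L' => //; exact: ltW.
- exists L^-1; first by rewrite invr_gt0.
  exact: relabeling_lb Pf L0 HL.
Qed.

(* The density of the inverse is [1 / df] composed with it; [df] is first
   replaced by a version bounded above and below everywhere. *)
Lemma primitive_inverse f g df c L : primitive f df -> cancel f g -> cancel g f ->
  {homo f : x y / x <= y} -> 0 < c -> {ae mu, forall x, c <= df x <= L} ->
  exists2 dg, primitive g dg & {ae mu, forall x, `|dg x| <= c^-1}.
Proof.
move=> Pf fK gK hf c0 dfc.
have hg := homo_inv fK gK hf.
pose d x := Num.max c (df x).
have mdf : measurable_fun [set: R] df by apply: locint_measurable; case: Pf.
have md : measurable_fun [set: R] d by apply: measurable_maxr.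
have dc x : c <= d x by rewrite le_max lexx.
have d0 x : 0 < d x by exact: lt_le_trans (dc x).
have Pd : primitive f d.
  by apply: primitive_ae Pf => //; apply: aeS dfc => x /andP[cx _]; rewrite /d max_r.
have dgc x : `|(d (g x))^-1| <= c^-1.
  by rewrite gtr0_norm ?invr_gt0// lef_pV2 ?posrE.
have mg : measurable_fun [set: R] g by apply: nondecreasing_measurable => //; exact: measurableT.
have mdg : measurable_fun [set: R] (fun x => (d (g x))^-1).
  (* 1 / max (c, z) is a nonincreasing function of z, hence measurable. *)
  apply: (measurableT_comp (f := fun z => (Num.max c z)^-1)); last exact: measurableT_comp.
  apply: nonincreasing_measurable => //.
  move=> x y xy; rewrite lef_pV2 ?posrE ?lt_max ?c0//.
  by rewrite ge_max !le_max lexx xy orbT.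
exists (fun x => (d (g x))^-1); last by apply: aeW.
have lg : locally_integrable [set: R] (fun x => (d (g x))^-1).
  have : locally_integrable [set: R] ((fun x => (d (g x))^-1) \* (fun=> 1)).
    apply: locintM_bnd => //; last exact: locint_cst.
    by move=> a b; exists c^-1 => x _.
  by congr (locally_integrable _ _); apply/funext => x /=; rewrite mulr1.
split=> // a b ab.
rewrite -(gK a) -(gK b) (substitution Pd hf fK gK)// !gK.
transitivity (itg (g a) (g b) (fun=> 1)); first by rewrite itg_cst ?mul1r// hg.
by congr itg; apply/funext => x; rewrite fK mulVf// gt_eqF.
Qed.

(** Only a set-theoretic inverse is required: the lower bound on the density of f makes that inverse
    Lipschitz. *)
Lemma setG_intro f g df c L : primitive f df -> cancel f g -> cancel g f ->
  (forall x, f (x + 1) = f x + 1) ->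
  {homo f : x y / x <= y} -> 0 < c -> {ae mu, forall x, c <= df x <= L} -> setG f.
Proof.
move=> Pf fK gK fp hf c0 dfc.
have dfL : {ae mu, forall x, `|df x| <= L}.
  by apply: aeS dfc => x /andP[cx xL]; rewrite ger0_norm// (le_trans (ltW c0)).
have [dg Pg dgL] := primitive_inverse Pf fK gK hf c0 dfc.
have gp x : g (x + 1) = g x + 1 by apply: (can_inj fK); rewrite fp !gK.
have sub h dh C : primitive h dh -> (forall x, h (x + 1) = h x + 1) ->
    {ae mu, forall x, `|dh x| <= C} -> W1infper (h \- id).
  move=> Ph hp hC; split; first by move=> x /=; rewrite hp; lra.
  apply: (@W1infloc_intro _ _ _ (C + 1) (primitiveB Ph (@primitive_id R))).
  by apply: aeS hC => x hx; rewrite (le_trans (ler_normB _ _))// normr1 lerD2r.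
split=> //; first exact: W1infloc_intro Pf dfL.
by exists g; split=> //; [exact: sub Pf fp dfL|exact: sub Pg gp dgL].
Qed.

(** The positive lower bound on the derivative removes the exceptional set of [ae_substitution]. *)
Lemma relabeling_ae f g (P : R -> Prop) : relabeling f g ->
  {ae mu, forall x, P x} -> {ae mu, forall x, P (f x)}.
Proof.
move=> [fK gK Pf hf _ _ [c c0 hc]] aeP.
apply: aeS2 (ae_substitution Pf hf fK gK aeP) hc => x + cx; apply.
by rewrite gt_eqF// (lt_le_trans c0).
Qed.

Lemma relabeling_primitive f g H h : relabeling f g -> primitive H h ->
  primitive (H \o f) (fun x => h (f x) * f^`() x).
Proof. case=> fK gK Pf hf _ _ _ PH; exact: (primitive_substitution Pf hf fK gK PH). Qed.

Lemma relabeling_locint f g h : relabeling f g -> locally_integrable [set: R] h ->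
  locally_integrable [set: R] (fun x => h (f x) * f^`() x).
Proof. by case=> fK gK Pf hf _ _ _ lh; exact: (locint_substitution Pf hf fK gK lh). Qed.

Lemma relabeling_itg f g h a b : relabeling f g -> locally_integrable [set: R] h ->
  itg (f a) (f b) h = itg a b (fun x => h (f x) * f^`() x).
Proof. by case=> fK gK Pf hf _ _ _ lh; exact: (substitution Pf hf fK gK _ _ lh). Qed.

Lemma relabeling_ge0 f g : relabeling f g -> {ae mu, forall x, 0 <= f^`() x}.
Proof. by case=> fK gK Pf hf _ _ _; exact: nondecreasing_primitive_ge0 Pf hf. Qed.

Lemma relabeling_setG f g : relabeling f g -> setG f.
Proof.
move=> [fK gK Pf hf fp [L L0 HL] [c c0 Hc]].
apply: (@setG_intro f g _ c L Pf) => //.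
by apply: aeS2 HL Hc => x xL ->; rewrite (le_trans (ler_norm _)).
Qed.

Lemma setG_comp f f' : setG f -> setG f' -> setG (f \o f').
Proof.
move=> /setG_relabeling[g [rf rg]] /setG_relabeling[g' [rf' rg']].
have [c c0 Hc] := relab_lb rf; have [c' c'0 Hc'] := relab_lb rf'.
have [L L0 HL] := relab_ub rf; have [L' L'0 HL'] := relab_ub rf'.
apply: (@setG_intro _ (g' \o g) _ (c * c') (L * L') (relabeling_primitive rf' (relab_prim rf))).
- exact: can_comp (relabK rf) (relabK rf').
- exact: can_comp (relabK rg') (relabK rg).
- by move=> x /=; rewrite (relab_per rf') (relab_per rf).
- by move=> x y xy /=; apply: (relab_homo rf); exact: (relab_homo rf').
- exact: mulr_gt0.
- have := relabeling_ae rf' HL; have := relabeling_ae rf' Hc => H1 H2.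
  apply: aeS2 (aeS2 (fun x => @conj _ _) H1 H2) (aeS2 (fun x => @conj _ _) Hc' HL') => x [h1 h2] [h3 h4].
  move: h1 h2 h3 h4; move: (f^`() (f' x)) (f'^`() x) => p q h2 h1 h3 h4.
  have p0 : 0 <= p by exact: le_trans (ltW c0) h2.
  have q0 : 0 <= q by exact: le_trans (ltW c'0) h3.
  rewrite (ler_pM (ltW c0) (ltW c'0) h2 h3)/=.
  by apply: ler_pM => //; [rewrite (le_trans (ler_norm _))|rewrite (le_trans (ler_norm _))].
Qed.

Lemma setG_shift a : setG (fun x => x + a).
Proof.
apply: (@setG_intro _ (fun x => x - a) _ 1 1 (primitive_comp_shift a (@primitive_id R))).
- exact: addrK.
- exact: subrK.
- by move=> x; rewrite addrAC.
- by move=> x y; rewrite lerD2r.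
- exact: ltr01.
- by apply: aeW => x; rewrite lexx.
Qed.

End Relabelings.

(** * Action of relabelings on E, F and J *)

Section RelabelLagr.
Context {R : realType}.
Local Notation mu := (@lebesgue_measure R).
Implicit Types (a b c x L : R) (f g h v : R -> R) (X Y V W : lagr R).

Lemma relabeling_derive1_per f g : relabeling f g -> forall x, f^`() (x + 1) = f^`() x.
Proof. by move=> rf; apply: (@derive1_periodic _ _ 1); exact: relab_per rf. Qed.

Lemma L1per_relabel f g h : relabeling f g -> L1per h -> L1per (fun x => h (f x) * f^`() x).
Proof.
move=> rf Lh; apply: locint_L1per.
  by move=> x; rewrite (relab_per rf) Lh.1 (relabeling_derive1_per rf).
exact: (relabeling_locint rf (L1per_locint Lh)).
Qed.

Lemma itg_relabel f g h : relabeling f g -> L1per h ->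
  itg 0 1 (fun x => h (f x) * f^`() x) = itg 0 1 h.
Proof.
move=> rf Lh; have lh := L1per_locint Lh.
(* f maps [0, 1] onto [f 0, f 0 + 1], again a full period. *)
rewrite -(relabeling_itg _ _ rf lh) -[X in itg _ (f X) _]add0r (relab_per rf).
by apply: itg_periodic => //; exact: Lh.1.
Qed.

Lemma L1per_norm h : L1per h -> L1per (fun x => `|h x|).
Proof.
move=> Lh; apply: locint_L1per; first by move=> x; rewrite Lh.1.
exact/locint_norm/L1per_locint.
Qed.

Lemma l1n_relabel f g h : relabeling f g -> L1per h ->
  l1n (fun x => h (f x) * f^`() x) = l1n h.
Proof.
move=> rf Lh; rewrite /l1n -(itg_relabel rf (L1per_norm Lh)).
have Lf := L1per_relabel rf Lh.
apply: ae_eq_itg.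
- exact: (locint_measurable (locint_norm (L1per_locint Lf))).
- by apply: locint_measurable; apply: L1per_locint; exact: (L1per_relabel rf (L1per_norm Lh)).
- by apply: aeS (relabeling_ge0 rf) => x f0; rewrite normrM (ger0_norm f0).
Qed.

Lemma W11per_relabel f g v : relabeling f g -> W11per v -> W11per (v \o f).
Proof.
move=> rf [pv wv]; split; first by move=> x /=; rewrite (relab_per rf) pv.
exact: primitive_W11loc (relabeling_primitive rf wv).
Qed.

Lemma derive1_relabel f g v : relabeling f g -> W11loc v ->
  {ae mu, forall x, (v \o f)^`() x = v^`() (f x) * f^`() x}.
Proof. by move=> rf wv; exact: primitive_derive1 (relabeling_primitive rf wv). Qed.

Lemma W11per_L1per v : W11per v -> L1per v^`().
Proof.
move=> [pv wv]; apply: locint_L1per; last exact: W11loc_locint.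
by apply: (@derive1_periodic _ _ 0) => x; rewrite pv addr0.
Qed.

Lemma w11n_relabel f g v : relabeling f g -> W11per v -> w11n (v \o f) <= w11n v.
Proof.
move=> rf Wv; have [_ wvf] := W11per_relabel rf Wv; have [pv wv] := Wv.
apply: lerD.
  apply: supn_le => [|x _]; first exact: W11loc_continuous wvf.
  exact: (le_supn_periodic (f x) (W11loc_continuous wv) pv).
rewrite -(l1n_relabel rf (W11per_L1per Wv)) (l1n_ae _ _ (derive1_relabel rf wv))//.
  exact: (locint_measurable (W11loc_locint wvf)).
exact: (locint_measurable (relabeling_locint rf (W11loc_locint wv))).
Qed.

Lemma Etangent_relabel f g V : relabeling f g -> Etangent V -> Etangent (relabel V f).
Proof.
move=> rf [wy wU ln lr]; split => /=.
- exact: W11per_relabel rf wy.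
- exact: W11per_relabel rf wU.
- exact: L1per_relabel rf ln.
- exact: L1per_relabel rf lr.
Qed.

Lemma Enormr_relabel f g V : relabeling f g -> Etangent V -> Enormr (relabel V f) <= Enormr V.
Proof.
move=> rf [wy wU ln lr].
have H (a a1 b b1 d d1 e e1 : R) : a <= a1 -> b <= b1 -> d = d1 -> e = e1 ->
  a + b + d + e <= a1 + b1 + d1 + e1 by lra.
apply: H.
- exact: w11n_relabel rf wy.
- exact: w11n_relabel rf wU.
- exact: l1n_relabel rf ln.
- exact: l1n_relabel rf lr.
Qed.

Lemma relabel_sub V W f : relabel (lagr_sub V W) f = lagr_sub (relabel V f) (relabel W f).
Proof.
by rewrite /relabel /lagr_sub /=; congr Lagr; apply/funext => x /=; rewrite mulrBl.
Qed.

Lemma relabel_scale V f c : relabel (lagr_scale c V) f = lagr_scale c (relabel V f).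
Proof.
by rewrite /relabel /lagr_scale /=; congr Lagr; apply/funext => x /=; rewrite /GRing.scale/= mulrA.
Qed.

(** The first two components are continuous representatives and agree everywhere; the last two carry
    pointwise derivatives of relabelings, for which the chain rule holds only a.e. *)
Definition lagr_ae V W := [/\ ly V = ly W, lU V = lU W,
  {ae mu, forall x, lnu V x = lnu W x} & {ae mu, forall x, lr V x = lr W x}].

Lemma Enormr_ae V W : Etangent V -> Etangent W -> lagr_ae V W -> Enormr V = Enormr W.
Proof.
move=> [_ _ /L1per_locint nV /L1per_locint rV] [_ _ /L1per_locint nW /L1per_locint rW] [yE UE nE rE].
rewrite /Enormr yE UE (l1n_ae (locint_measurable nV) (locint_measurable nW) nE).
by rewrite (l1n_ae (locint_measurable rV) (locint_measurable rW) rE).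
Qed.

Lemma lagr_ae_sub V W V' W' : lagr_ae V W -> lagr_ae V' W' ->
  lagr_ae (lagr_sub V V') (lagr_sub W W').
Proof.
move=> [yE UE nE rE] [yE' UE' nE' rE']; split => /=; rewrite ?yE ?UE ?yE' ?UE'//.
  by apply: aeS2 nE nE' => x -> ->.
by apply: aeS2 rE rE' => x -> ->.
Qed.

(** Since phi o psi o f = f, the chain rule gives f_xi as the product of the two relabeling factors,
    for almost every x. *)
Lemma relabel_cancel X phi psi f g : relabeling phi psi -> relabeling (psi \o f) g ->
  lagr_ae (relabel (relabel X phi) (psi \o f)) (relabel X f).
Proof.
move=> rp rf.
have pf x : phi (psi (f x)) = f x by rewrite (relabKV rp).
have df : {ae mu, forall x, f^`() x = phi^`() (psi (f x)) * (psi \o f)^`() x}.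
  have := primitive_derive1 (relabeling_primitive rf (relab_prim rp)).
  have -> : phi \o (psi \o f) = f by apply/funext => x /=; rewrite pf.
  by [].
split => /=.
- by apply/funext => x /=; rewrite pf.
- by apply/funext => x /=; rewrite pf.
- by apply: aeS df => x ->; rewrite pf mulrA.
- by apply: aeS df => x ->; rewrite pf mulrA.
Qed.

Lemma lagr_hE X : L1per (lnu X) -> lagr_h X = l1n (lnu X).
Proof. by move=> /L1per_locint ln; rewrite /lagr_h l1nE. Qed.

Lemma setF_L1per_nu X : setF X -> L1per (lnu X).
Proof. by case=> -[]. Qed.

Lemma lagr_h_relabel X f g : relabeling f g -> L1per (lnu X) ->
  lagr_h (relabel X f) = lagr_h X.
Proof.
move=> rf ln; rewrite !lagr_hE//=; first exact: l1n_relabel rf ln.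
exact: L1per_relabel rf ln.
Qed.

Lemma setE_ly_W11loc X : setE X -> W11loc (ly X).
Proof.
move=> [[_ wy] _ _ _].
apply: (@primitive_W11loc _ _ ((ly X \- id)^`() \+ (fun=> 1))).
by apply: primitive_eq (primitiveD wy (@primitive_id R)) _ _ => x //=; rewrite subrK.
Qed.

Lemma setE_ly_per X : setE X -> forall x, ly X (x + 1) = ly X x + 1.
Proof. by move=> [[py _] _ _ _] x; have := py x; rewrite /=; lra. Qed.

Lemma setE_relabel X f g : relabeling f g -> setE X -> setE (relabel X f).
Proof.
move=> rf eX; have wy := setE_ly_W11loc eX; have [_ wU ln lr] := eX; split => /=.
- split; first by move=> x /=; rewrite (relab_per rf) (setE_ly_per eX); lra.
  exact: primitive_W11loc (primitiveB (relabeling_primitive rf wy) (@primitive_id R)).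
- exact: W11per_relabel rf wU.
- exact: L1per_relabel rf ln.
- exact: L1per_relabel rf lr.
Qed.

Lemma setF_bnd X : setF X -> exists2 L, 0 <= L &
  [/\ {ae mu, forall x, `|(ly X)^`() x| <= L}, {ae mu, forall x, `|(lU X)^`() x| <= L},
      {ae mu, forall x, `|lnu X x| <= L} & {ae mu, forall x, `|lr X x| <= L}].
Proof.
move=> [eX [[[_ _ Ly] [_ _ LU] Ln Lr] _]].
have [L1 L10 H1] : exists2 L, 0 <= L & {ae mu, forall x, `|(ly X)^`() x| <= L}.
  by apply: Linfloc_periodic_bnd => //; exact: derive1_periodic (setE_ly_per eX).
have [L2 L20 H2] : exists2 L, 0 <= L & {ae mu, forall x, `|(lU X)^`() x| <= L}.
  by apply: Linfloc_periodic_bnd => //; case: eX => _ /W11per_L1per[].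
have [L3 L30 H3] := Linf_bnd Ln; have [L4 L40 H4] := Linf_bnd Lr.
exists (L1 + L2 + L3 + L4); first by rewrite !addr_ge0.
split.
- by apply: aeS H1 => x; move: (`|_|) => z; lra.
- by apply: aeS H2 => x; move: (`|_|) => z; lra.
- by apply: aeS H3 => x; move: (`|_|) => z; lra.
- by apply: aeS H4 => x; move: (`|_|) => z; lra.
Qed.

(** y_xi, U_xi, nu and r all acquire the factor f_xi, and the defining identity of F is homogeneous
    of degree 2 in them. The bounds on f_xi from both sides preserve boundedness and the positive
    lower bound. *)
Lemma setF_relabel X f g : relabeling f g -> setF X -> setF (relabel X f).
Proof.
move=> rf FX; have [L L0 [Hy HU Hn Hr]] := setF_bnd FX.
have [K K0 HK] := relab_ub rf; have [c c0 Hc] := relab_lb rf.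
have [eX [_ [Fy Fn [e e0 Fe] Feq]]] := FX.
have wy := setE_ly_W11loc eX; have [_ [_ wU] ln Lr] := eX.
have dy := derive1_relabel rf wy; have dU := derive1_relabel rf wU.
have bnd h : {ae mu, forall x, `|h x| <= L} -> {ae mu, forall x, `|h (f x) * f^`() x| <= L * K}.
  move=> hL; apply: aeS2 (relabeling_ae rf hL) HK => x h1 h2.
  by rewrite normrM ler_pM.
split; first exact: setE_relabel rf eX.
split; [split => /=|split => /=].
- exact: W1infloc_intro (relabeling_primitive rf wy) (bnd _ Hy).
- exact: W1infloc_intro (relabeling_primitive rf wU) (bnd _ HU).
- by apply: bnd_Linf (bnd _ Hn); exact: (locint_measurable (relabeling_locint rf (L1per_locint ln))).
- by apply: bnd_Linf (bnd _ Hr); exact: (locint_measurable (relabeling_locint rf (L1per_locint Lr))).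
- apply: aeS3 dy (relabeling_ae rf Fy) (relabeling_ge0 rf) => x -> h1 h2.
  exact: mulr_ge0.
- by apply: aeS2 (relabeling_ae rf Fn) (relabeling_ge0 rf) => x h1 h2; exact: mulr_ge0.
- exists (e * c); first exact: mulr_gt0.
  apply: aeS3 dy (relabeling_ae rf Fe) Hc => x -> h1 h2.
  by rewrite -mulrDl ler_pM// ltW.
- apply: aeS3 dy dU (relabeling_ae rf Feq) => x -> -> E.
  move: E; move: ((ly X)^`() (f x)) (lnu X (f x)) (lU X (f x)) ((lU X)^`() (f x)) (lr X (f x)) (f^`() x).
  move=> p n u q r z E.
  have -> : p * z * (n * z) = (p * n) * z ^+ 2 by ring.
  by rewrite E; ring.
Qed.

(* J sees X only through its orbit under relabeling. *)
Lemma lagrJ_relabel X Y phi psi phi' psi' : setE X -> setE Y ->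
  relabeling phi psi -> relabeling psi phi ->
  relabeling phi' psi' -> relabeling psi' phi' ->
  (lagrJ (relabel X phi) (relabel Y phi') <= lagrJ X Y)%E.
Proof.
move=> eX eY rp rs rp' rs'; apply: le_ereal_inf_tmp => _ [f [f' [Gf Gf' ->]]].
have Gpf := setG_comp (relabeling_setG rs) Gf.
have Gpf' := setG_comp (relabeling_setG rs') Gf'.
have [k [rpf _]] := setG_relabeling Gpf; have [k' [rpf' _]] := setG_relabeling Gpf'.
have [g [rf _]] := setG_relabeling Gf; have [g' [rf' _]] := setG_relabeling Gf'.
have e1 := setE_relabel rf eX; have e2 := setE_relabel rf' eY.
have e3 := setE_relabel rpf (setE_relabel rp eX).
have e4 := setE_relabel rpf' (setE_relabel rp' eY).
have E := Enormr_ae (setE_sub e3 e4) (setE_sub e1 e2)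
  (lagr_ae_sub (relabel_cancel X rp rpf) (relabel_cancel Y rp' rpf')).
rewrite (EdistE e1 e2) -E -(EdistE e3 e4).
(* Composition with [psi] and [psi'] undoes the relabelings, so this pair reaches the distance that
   f and f' give for X and Y. *)
apply: ereal_inf_lbound; exists (psi \o f), (psi' \o f').
by split; [exact: Gpf|exact: Gpf'|reflexivity].
Qed.

End RelabelLagr.

(** * The nonlocal terms P and Q *)

Section Kernel.
Context {R : realType}.
Local Notation mu := (@lebesgue_measure R).
Local Notation e := (expR 1 : R).
Implicit Types (a b c x s xi th : R).

Lemma ae_eq_itg_in (f g : R -> R) a b : measurable_fun [set: R] f -> measurable_fun [set: R] g ->
  {ae mu, forall x, a <= x <= b -> f x = g x} -> itg a b f = itg a b g.
Proof.
move=> mf mg fg; rewrite /itg; congr fine; apply: ae_eq_integral => //.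
- by apply/measurable_EFinP; exact: measurable_funS mf.
- by apply/measurable_EFinP; exact: measurable_funS mg.
- by apply: aeS fg => x /= H; rewrite in_itv/= => /H ->.
Qed.

Lemma ae_neq c : {ae mu, forall x, x != c}.
Proof.
exists [set c]; split; [exact: measurable_set1|exact: lebesgue_measure_set1|].
by move=> x /= /negP; rewrite negbK => /eqP.
Qed.

(** Equivalent to 2 e <= 4 (e - 1), which makes 1 both a bound and a Lipschitz constant of the two
    kernels on [0, 1]. *)
Lemma expR1_ge2 : 2 <= e.
Proof. by have := expR_ge1Dx (1 : R); lra. Qed.

Lemma expR1B s : expR (1 - s) = e * expR (- s). Proof. by rewrite expRD. Qed.

(* The 1-periodic Green function of [1 - d^2/dx^2] on one period, and its
   derivative. *)
Definition green s : R := (expR s + expR (1 - s)) / (4 * (e - 1)).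
Definition dgreen s : R := (expR s - expR (1 - s)) / (4 * (e - 1)).

Lemma greenC s : green (1 - s) = green s.
Proof. by rewrite /green opprB subrKC addrC. Qed.

Lemma dgreenC s : dgreen (1 - s) = - dgreen s.
Proof. by rewrite /dgreen opprB subrKC -mulNr opprB. Qed.

Let e1 : 0 < e - 1. Proof. by have := expR1_ge2; lra. Qed.

(** The two integrals in [P01] thus merge into one, with s the distance between y xi and y th. *)
Lemma green_cosh s : 1 / (2 * (e - 1)) * cosh s + 1 / 4 * expR (- s) = green s.
Proof.
rewrite /green /cosh expR1B; move: e1; move: e (expR s) (expR (- s)) => E p q E1.
by field; rewrite gt_eqF.
Qed.

Lemma dgreen_sinh s : 1 / (2 * (e - 1)) * sinh s - 1 / 4 * expR (- s) = dgreen s.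
Proof.
rewrite /dgreen /sinh expR1B; move: e1; move: e (expR s) (expR (- s)) => E p q E1.
by field; rewrite gt_eqF.
Qed.

Lemma coshN s : cosh (- s) = cosh s. Proof. by rewrite /cosh opprK addrC. Qed.
Lemma sinhN s : sinh (- s) = - sinh s. Proof. by rewrite /sinh opprK -mulNr opprB. Qed.

Lemma continuous_green : continuous green.
Proof.
move=> s; apply: cvgM; last exact: cvg_cst.
apply: cvgD; first exact: continuous_expR.
apply: (@continuous_comp _ _ _ (fun s => 1 - s) expR); last exact: continuous_expR.
by apply: cvgB; [exact: cvg_cst|exact: cvg_id].
Qed.

Lemma continuous_dgreen : continuous dgreen.
Proof.
move=> s; apply: cvgM; last exact: cvg_cst.
apply: cvgB; first exact: continuous_expR.
apply: (@continuous_comp _ _ _ (fun s => 1 - s) expR); last exact: continuous_expR.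
by apply: cvgB; [exact: cvg_cst|exact: cvg_id].
Qed.

Let expR_le s : s <= 1 -> expR s <= e. Proof. by rewrite ler_expR. Qed.

Lemma green_bnd s : 0 <= s <= 1 -> `|green s| <= 1.
Proof.
move=> /andP[s0 s1].
have h1 := expR_le s1; have h2 : expR (1 - s) <= e by apply: expR_le; lra.
have := expR_gt0 s; have := expR_gt0 (1 - s); have := expR1_ge2.
rewrite /green; move: h1 h2 e1; move: e (expR s) (expR (1 - s)) => E p q h1 h2 E1 h3 q0 p0.
have d0 : 0 < 4 * (E - 1) by lra.
by rewrite normrM normfV (gtr0_norm d0) ler_pdivrMr// ger0_norm; lra.
Qed.

Lemma dgreen_bnd s : 0 <= s <= 1 -> `|dgreen s| <= 1.
Proof.
move=> /andP[s0 s1].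
have h1 := expR_le s1; have h2 : expR (1 - s) <= e by apply: expR_le; lra.
have := expR_gt0 s; have := expR_gt0 (1 - s); have := expR1_ge2.
rewrite /dgreen; move: h1 h2 e1; move: e (expR s) (expR (1 - s)) => E p q h1 h2 E1 h3 q0 p0.
have d0 : 0 < 4 * (E - 1) by lra.
by rewrite normrM normfV (gtr0_norm d0) ler_pdivrMr// ler_norml; apply/andP; split; lra.
Qed.

(** For t <= s, exp s - exp t = exp s (1 - exp (t - s)) <= exp s (s - t), and exp s <= e. *)
Lemma expR_lip s t : s <= 1 -> t <= 1 -> `|expR s - expR t| <= e * `|s - t|.
Proof.
wlog st : s t / t <= s => [H s1 t1|s1 t1].
  have [ts|/ltW ts] := leP t s; first exact: H.
  by rewrite distrC (distrC s); exact: H.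
rewrite !ger0_norm ?subr_ge0 ?ler_expR//.
have -> : expR t = expR s * expR (t - s) by rewrite -expRD subrKC.
have h := expR_ge1Dx (t - s); have h1 := expR_le s1; have h2 := expR_gt0 s.
have : expR s * (s - t) <= e * (s - t) by rewrite ler_wpM2r// subr_ge0.
have : expR s * (1 + (t - s)) <= expR s * expR (t - s) by rewrite ler_wpM2l// ltW.
move: (expR s * expR (t - s)) (expR s) => p q; lra.
Qed.

Let lip_aux (E p q p' q' d : R) : 2 <= E -> `|p - p'| <= E * d -> `|q - q'| <= E * d ->
  `|(p + q) / (4 * (E - 1)) - (p' + q') / (4 * (E - 1))| <= d.
Proof.
move=> E2 h1 h2; have d0 : 0 < 4 * (E - 1) by lra.
have dd : 0 <= d.
  have : 0 <= E * d by apply: le_trans h1.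
  by rewrite pmulr_rge0//; lra.
rewrite -mulrBl normrM normfV (gtr0_norm d0) ler_pdivrMr//.
have -> : p + q - (p' + q') = (p - p') + (q - q') by ring.
apply: le_trans (ler_normD _ _) _.
have : 2 * d <= E * d by rewrite ler_wpM2r.
by move: h1 h2; move: `|p - p'| `|q - q'| => u v; lra.
Qed.

Lemma green_lip s t : 0 <= s <= 1 -> 0 <= t <= 1 -> `|green s - green t| <= `|s - t|.
Proof.
move=> /andP[s0 s1] /andP[t0 t1]; apply: lip_aux; [exact: expR1_ge2|exact: expR_lip|].
rewrite (_ : `|s - t| = `|(1 - s) - (1 - t)|); first by apply: expR_lip; lra.
by rewrite distrC; congr `|_|; ring.
Qed.

Lemma dgreen_lip s t : 0 <= s <= 1 -> 0 <= t <= 1 -> `|dgreen s - dgreen t| <= `|s - t|.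
Proof.
move=> /andP[s0 s1] /andP[t0 t1]; apply: lip_aux; [exact: expR1_ge2|exact: expR_lip|].
rewrite (_ : - expR (1 - s) - - expR (1 - t) = expR (1 - t) - expR (1 - s)); last by ring.
rewrite (_ : `|s - t| = `|(1 - t) - (1 - s)|); first by apply: expR_lip; lra.
by congr `|_|; ring.
Qed.

End Kernel.

(** * Integrals of the Green function over a moving period *)

Section Nonlocal.
Context {R : realType}.
Local Notation mu := (@lebesgue_measure R).
Local Notation e := (expR 1 : R).
Implicit Types (a b c x s xi th : R) (k : R -> R).

Lemma primitive_window (h : R -> R) : locally_integrable [set: R] h ->
  primitive (fun x => itg x (x + 1) h) (fun x => h (x + 1) - h x).
Proof.
move=> lh; have PH := primitive_itg lh.
have PD := primitiveB (primitive_comp_shift 1 PH) PH.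
apply: primitive_eq PD _ _ => x //=.
by case: PH => _ ->//; rewrite lerDl.
Qed.

Variables y dy w : R -> R.
Hypotheses (Py : primitive y dy) (yp : forall x, y (x + 1) = y x + 1)
  (hy : {homo y : x z / x <= z}) (lw : locally_integrable [set: R] w)
  (wp : forall x, w (x + 1) = w x).

(** The period of integration starts at xi, so that y th - y xi runs through [0, 1]: the kernel is
    needed only there, and neither a sign nor an absolute value appears. *)
Definition nonlocal k xi := itg xi (xi + 1) (fun th => k (y th - y xi) * w th).

Let cy : continuous y := primitive_continuous Py.

Lemma locint_kernel k xi : continuous k ->
  locally_integrable [set: R] (fun th => k (y th - y xi) * w th).
Proof.
move=> ck; apply: (@locintM_cont _ _ (fun th => k (y th - y xi))) => // x.
apply: (@continuous_comp _ _ _ (fun th => y th - y xi) k); last exact: ck.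
by apply: cvgB; [exact: cy|exact: cvg_cst].
Qed.

Lemma nonlocal_per k xi : continuous k -> nonlocal k (xi + 1) = nonlocal k xi.
Proof.
move=> ck; rewrite /nonlocal itg_shift; last exact: locint_kernel.
by congr itg; apply/funext => th; rewrite !yp wp; congr (k _ * _); ring.
Qed.

(** Both kernels are combinations of exp s and exp (-s), hence separate into a function of xi times
    a function of th; xi then remains only in exponential factors and in the ends of the period. *)
Let ep := fun th : R => expR (y th) * w th.
Let em := fun th : R => expR (- y th) * w th.

Let Pym : primitive (fun x => - y x) (fun x => - dy x).
Proof.
by apply: primitive_eq (primitiveZ (-1) Py) _ _ => x /=; rewrite /GRing.scale/= mulN1r.
Qed.

Let lep : locally_integrable [set: R] ep.
Proof.
apply: (@locintM_cont _ _ (fun th => expR (y th))) => //.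
exact: primitive_continuous (primitive_expR Py).
Qed.

Let lem : locally_integrable [set: R] em.
Proof.
apply: (@locintM_cont _ _ (fun th => expR (- y th))) => //.
exact: primitive_continuous (primitive_expR Pym).
Qed.

Let A xi := itg xi (xi + 1) ep.
Let B xi := itg xi (xi + 1) em.
Let c0 : R := (4 * (e - 1))^-1.

Let c0K : c0 * (4 * (e - 1)) = 1.
Proof. by rewrite mulVf// gt_eqF//; have := expR1_ge2 (R := R); lra. Qed.

Let nonlocal_green xi :
  nonlocal green xi = c0 * (expR (- y xi) * A xi + e * (expR (y xi) * B xi)).
Proof.
rewrite /A /B -!itgZ//; last exact: locintZ.
rewrite -itgD ?itgZ//; [|exact: locintZ|by apply: locintZ; exact: locintZ].
rewrite -itgZ; last by apply: locally_integrableD; [exact: locintZ|by apply: locintZ; exact: locintZ].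
congr itg; apply/funext => th; rewrite /green /ep /em.
have -> : expR (y th - y xi) = expR (y th) * expR (- y xi) by rewrite -expRD.
have -> : expR (1 - (y th - y xi)) = e * expR (- y th) * expR (y xi).
  by rewrite -!expRD; congr expR; ring.
by rewrite -/c0; ring.
Qed.

Let nonlocal_dgreen xi :
  nonlocal dgreen xi = c0 * (expR (- y xi) * A xi - e * (expR (y xi) * B xi)).
Proof.
rewrite /A /B -!itgZ//; last exact: locintZ.
rewrite -itgB ?itgZ//; [|exact: locintZ|by apply: locintZ; exact: locintZ].
rewrite -itgZ; last by apply: locally_integrableB; [exact: locintZ|by apply: locintZ; exact: locintZ].
congr itg; apply/funext => th; rewrite /dgreen /ep /em.
have -> : expR (y th - y xi) = expR (y th) * expR (- y xi) by rewrite -expRD.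
have -> : expR (1 - (y th - y xi)) = e * expR (- y th) * expR (y xi).
  by rewrite -!expRD; congr expR; ring.
by rewrite -/c0; ring.
Qed.

Let PA : primitive A (fun x => (e - 1) * (expR (y x) * w x)).
Proof.
apply: primitive_eq (primitive_window lep) _ _ => x //=.
by rewrite /ep yp wp expRD; ring.
Qed.

Let PB : primitive B (fun x => (expR (-1) - 1) * (expR (- y x) * w x)).
Proof.
apply: primitive_eq (primitive_window lem) _ _ => x //=.
by rewrite /em yp wp opprD expRD; ring.
Qed.

Let eVe : e * expR (-1) = 1. Proof. by rewrite -expRD subrr expR0. Qed.
Let yVy x : expR (- y x) * expR (y x) = 1. Proof. by rewrite -expRD addNr expR0. Qed.

Let P1 := primitiveM (primitive_expR Pym) PA.
Let P2 := primitiveZ e (primitiveM (primitive_expR Py) PB).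

(** The ends of the period contribute (e - 1) w from the increasing exponential and (1 - e) w from
    the decreasing one, up to a common factor: they cancel. *)
Lemma primitive_nonlocal_green :
  primitive (nonlocal green) (fun x => - nonlocal dgreen x * dy x).
Proof.
apply: primitive_eq (primitiveZ c0 (primitiveD P1 P2)) _ _ => x /=; rewrite /GRing.scale/=.
  by rewrite nonlocal_green.
rewrite nonlocal_dgreen; move: eVe (yVy x).
move: (expR (-1)) (expR (- y x)) (expR (y x)) (A x) (B x) e c0 (dy x) (w x) => p q r a b E c d v h1 h2.
have -> : c * (q * - d * a + q * ((E - 1) * (r * v)) +
   E * (r * d * b + r * ((p - 1) * (q * v)))) =
   c * (q * - d * a + (q * r) * (E - 1) * v + E * (r * d * b) + (q * r) * (E * p - E) * v) by ring.
by rewrite h1 h2; ring.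
Qed.

(** Here the boundary contributions are subtracted: 2 (e - 1) w over 4 (e - 1) leaves w / 2, the
    unit jump of the derivative of the Green function with its factor 1/2. *)
Lemma primitive_nonlocal_dgreen :
  primitive (nonlocal dgreen) (fun x => w x / 2 - nonlocal green x * dy x).
Proof.
apply: primitive_eq (primitiveZ c0 (primitiveB P1 P2)) _ _ => x /=; rewrite /GRing.scale/=.
  by rewrite nonlocal_dgreen.
rewrite nonlocal_green; move: eVe (yVy x) c0K.
move: (expR (-1)) (expR (- y x)) (expR (y x)) (A x) (B x) e c0 (dy x) (w x) => p q r a b E c d v h1 h2 h3.
have -> : c * (q * - d * a + q * ((E - 1) * (r * v)) -
   E * (r * d * b + r * ((p - 1) * (q * v)))) =
   c * (q * - d * a + (q * r) * (E - 1) * v - E * (r * d * b) - (q * r) * (E * p - E) * v) by ring.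
have -> : v / 2 = (c * (4 * (E - 1))) * v / 2 by rewrite h3 mul1r.
by rewrite h1 h2; field.
Qed.

Lemma y_window x th : x <= th <= x + 1 -> 0 <= y th - y x <= 1.
Proof.
move=> /andP[xt tx]; have := hy xt; have := hy tx; rewrite yp.
by move: (y th) (y x) => p q h1 h2; apply/andP; split; lra.
Qed.

Lemma nonlocal_bnd k xi : continuous k -> (forall s, 0 <= s <= 1 -> `|k s| <= 1) ->
  `|nonlocal k xi| <= itg 0 1 (fun x => `|w x|).
Proof.
move=> ck k1; have lk := locint_kernel xi ck; have lnw := locint_norm lw.
rewrite (le_trans (itg_norm_le _ _ lk))//.
rewrite -(itg_periodic xi lnw); last by move=> x; rewrite wp.
apply: le_itg => //; first exact: locint_norm.
by move=> th /y_window/k1 kle; rewrite normrM ler_piMl.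
Qed.

End Nonlocal.

(** * P and Q in terms of the Green function *)

Section Representation.
Context {R : realType}.
Local Notation mu := (@lebesgue_measure R).
Local Notation e := (expR 1 : R).
Implicit Types (a b c x s xi th : R) (k : R -> R) (X : lagr R).

Lemma setF_ly_homo X : setF X -> {homo ly X : x z / x <= z}.
Proof.
move=> [eX [_ [Fy _ _ _]]]; exact: primitive_nondecreasing (setE_ly_W11loc eX) Fy.
Qed.

Lemma setE_energy_locint X : setE X -> locally_integrable [set: R] (energy X).
Proof.
move=> eX; have wy := setE_ly_W11loc eX; have [_ [_ wU] /L1per_locint ln _] := eX.
apply: locally_integrableD => //.
apply: (@locintM_cont _ _ (fun x => lU X x ^+ 2)); last exact: W11loc_locint.
by move=> x; apply: cvgM; exact: (W11loc_continuous wU).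
Qed.

Lemma setE_energy_per X : setE X -> forall x, energy X (x + 1) = energy X x.
Proof.
move=> eX x; have [_ [pU _] [pn _] _] := eX.
by rewrite /energy pU pn (derive1_periodic (setE_ly_per eX)).
Qed.

Section One.
Variable X : lagr R.
Hypothesis FX : setF X.
Let y := ly X.
Let w := energy X.
Let eX : setE X. Proof. by case: FX. Qed.
Let Py : primitive y y^`() := setE_ly_W11loc eX.
Let cy : continuous y := primitive_continuous Py.
Let yp : forall x, y (x + 1) = y x + 1 := setE_ly_per eX.
Let hy : {homo y : x z / x <= z} := setF_ly_homo FX.
Let lw : locally_integrable [set: R] w := setE_energy_locint eX.
Let wp : forall x, w (x + 1) = w x := setE_energy_per eX.

(** [0, 1] is cut at xi and its left piece moved by one period to [1, xi + 1]. There the kernel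
    argument becomes y (th + 1) - y xi = 1 - (y xi - y th), and the diagonal th = xi is a null
    set. *)
Let itg_nonlocal k (F : R -> R) xi : continuous k -> 0 <= xi <= 1 ->
  locally_integrable [set: R] F ->
  (forall th, xi < th -> F th = k (y th - y xi) * w th) ->
  (forall th, th < xi -> F th = k (1 - (y xi - y th)) * w th) ->
  itg 0 1 F = nonlocal y w k xi.
Proof.
move=> ck /andP[x0 x1] lF Fr Fl; have lk := locint_kernel Py lw xi ck.
have x1' : 1 <= xi + 1 by rewrite lerDr.
rewrite (itg_split lF x0 x1) /nonlocal (itg_split lk x1 x1').
rewrite addrC; congr (_ + _).
  apply: ae_eq_itg_in; [exact: locint_measurable|exact: locint_measurable|].
  by apply: aeS (ae_neq xi) => th txi /andP[xt _]; rewrite Fr// lt_neqAle eq_sym txi.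
rewrite -[X in itg X _ _ = _]/(0 : R) -[X in _ = itg X _ _]add0r itg_shift//.
apply: ae_eq_itg_in; [exact: locint_measurable|exact: (locint_measurable (locint_shift 1 lk))|].
apply: aeS (ae_neq xi) => th txi /andP[_ xt]; rewrite Fl ?lt_neqAle ?txi//.
by rewrite yp wp; congr (k _ * _); ring.
Qed.

(** y is nondecreasing, so the sign in the exponent only produces an absolute value and the factor
    is continuous in th. *)
Let sg_exp xi th : expR (- Num.sg (xi - th) * (y xi - y th)) = expR (- `|y xi - y th|).
Proof.
congr expR; have [xt|xt|->] := ltgtP xi th.
- by rewrite ltr0_sg ?subr_lt0// opprK mul1r ler0_norm ?opprK// subr_le0 hy// ltW.
- by rewrite gtr0_sg ?subr_gt0// mulN1r ger0_norm// subr_ge0 hy// ltW.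
- by rewrite !subrr normr0 mulr0 oppr0.
Qed.

Let cyd xi : continuous (fun th => y xi - y th).
Proof. by move=> th; apply: cvgB; [exact: cvg_cst|exact: cy]. Qed.

Let lexp xi : locally_integrable [set: R]
  (fun th => expR (- Num.sg (xi - th) * (y xi - y th)) * w th).
Proof.
apply: (@locintM_cont _ _ (fun th => expR (- Num.sg (xi - th) * (y xi - y th)))) => //.
rewrite (_ : (fun th => _) = (fun th => expR (- `|y xi - y th|))); last first.
  by apply/funext => th; exact: sg_exp.
move=> th; apply: (@continuous_comp _ _ _ (fun th => - `|y xi - y th|) expR); last exact: continuous_expR.
by apply: cvgN; apply: cvg_norm; exact: cyd.
Qed.

Let lsgexp xi : locally_integrable [set: R]
  (fun th => Num.sg (xi - th) * expR (- Num.sg (xi - th) * (y xi - y th)) * w th).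
Proof.
have := @locintM_bnd _ _ (fun th => Num.sg (xi - th)) _ _ (lexp xi).
rewrite (_ : (fun th => _) \* (fun th => _) = (fun th => Num.sg (xi - th) * expR (- Num.sg (xi - th) * (y xi - y th)) * w th)); last first.
  by apply/funext => th; rewrite /= mulrA.
apply.
  by move=> a b; exists 1 => th _; rewrite normr_sg; case: (_ != 0); rewrite ?lexx ?ler01.
apply: nonincreasing_measurable => // s t st.
rewrite /Num.sg !subr_eq0 !subr_lt0.
by case: (ltgtP xi s); case: (ltgtP xi t) => //; lra.
Qed.

Let lcosh xi : locally_integrable [set: R] (fun th => cosh (y xi - y th) * w th).
Proof.
apply: (@locintM_cont _ _ (fun th => cosh (y xi - y th))) => //.
move=> th; apply: cvgM; last exact: cvg_cst.
apply: cvgD.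
  by apply: (@continuous_comp _ _ _ (fun th => y xi - y th) expR); [exact: cyd|exact: continuous_expR].
apply: (@continuous_comp _ _ _ (fun th => - (y xi - y th)) expR); last exact: continuous_expR.
by apply: cvgN; exact: cyd.
Qed.

Let lsinh xi : locally_integrable [set: R] (fun th => sinh (y xi - y th) * w th).
Proof.
apply: (@locintM_cont _ _ (fun th => sinh (y xi - y th))) => //.
move=> th; apply: cvgM; last exact: cvg_cst.
apply: cvgB.
  by apply: (@continuous_comp _ _ _ (fun th => y xi - y th) expR); [exact: cyd|exact: continuous_expR].
apply: (@continuous_comp _ _ _ (fun th => - (y xi - y th)) expR); last exact: continuous_expR.
by apply: cvgN; exact: cyd.
Qed.

Let P01E xi : 0 <= xi <= 1 -> P01 X xi = nonlocal y w green xi.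
Proof.
move=> xi01; rewrite /P01 -!/(itg _ _ _) -!itgZ//.
rewrite -itgD//; try by [apply: locintZ; exact: lcosh|apply: locintZ; exact: lexp].
apply: itg_nonlocal => //.
- exact: continuous_green.
- by apply: locally_integrableD; apply: locintZ; [exact: lcosh|exact: lexp].
- move=> th xt; rewrite ltr0_sg ?subr_lt0// opprK [1 * (_ - _)]mul1r -/y -/w.
  by rewrite -green_cosh -(coshN (y th - y xi)) !opprB; ring.
- move=> th xt; rewrite gtr0_sg ?subr_gt0// mulN1r -/y -/w greenC.
  by rewrite -green_cosh; ring.
Qed.

(** The minus sign comes from sinh (y xi - y th) = - sinh (y th - y xi) to the right of xi, and from
    the antisymmetry [dgreenC] to its left. *)
Let Q01E xi : 0 <= xi <= 1 -> Q01 X xi = - nonlocal y w dgreen xi.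
Proof.
move=> xi01; rewrite /Q01 -!/(itg _ _ _) -!itgZ//.
rewrite -itgB//; try by [apply: locintZ; exact: lsinh|apply: locintZ; exact: lsgexp].
transitivity (nonlocal y w (fun s => - dgreen s) xi); last first.
  rewrite /nonlocal -[RHS]mulN1r -itgZ; last exact: (locint_kernel Py lw xi (@continuous_dgreen R)).
  by congr itg; apply/funext => th; rewrite mulN1r mulNr.
apply: itg_nonlocal => //.
- by move=> s; apply: cvgN; exact: continuous_dgreen.
- by apply: locally_integrableB; apply: locintZ; [exact: lsinh|exact: lsgexp].
- move=> th xt; rewrite ltr0_sg ?subr_lt0// opprK [1 * (_ - _)]mul1r -/y -/w.
  by rewrite -dgreen_sinh -[y xi - y th]opprB sinhN; ring.
- move=> th xt; rewrite gtr0_sg ?subr_gt0// mulN1r -/y -/w dgreenC.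
  by rewrite -dgreen_sinh; ring.
Qed.

Lemma lagrPE : lagrP X = nonlocal (ly X) (energy X) green.
Proof.
apply/funext => xi; rewrite /lagrP /per_ext (P01E (frac_itv xi)).
exact: (@periodic_frac _ (nonlocal y w green) xi
  (fun x => nonlocal_per Py yp lw wp x (@continuous_green R))).
Qed.

Lemma lagrQE : lagrQ X = (fun xi => - nonlocal (ly X) (energy X) dgreen xi).
Proof.
apply/funext => xi; rewrite /lagrQ /per_ext (Q01E (frac_itv xi)); congr (- _).
exact: (@periodic_frac _ (nonlocal y w dgreen) xi
  (fun x => nonlocal_per Py yp lw wp x (@continuous_dgreen R))).
Qed.

Lemma primitive_lagrP : primitive (lagrP X) (fun x => lagrQ X x * y^`() x).
Proof.
have := primitive_nonlocal_green Py yp lw wp.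
by move=> /primitive_eq; apply => x; rewrite ?lagrPE ?lagrQE.
Qed.

Lemma primitive_lagrQ : primitive (lagrQ X) (fun x => lagrP X x * y^`() x - w x / 2).
Proof.
have := primitiveZ (-1) (primitive_nonlocal_dgreen Py yp lw wp).
move=> /primitive_eq; apply => x; rewrite /= ?lagrPE ?lagrQE /GRing.scale/= mulN1r//.
by rewrite opprB.
Qed.

End One.
End Representation.

(** * Tangency and equivariance of the vector field *)

Section Rhs.
Context {R : realType}.
Local Notation mu := (@lebesgue_measure R).
Implicit Types (a b c x s xi th : R) (k f g : R -> R) (X : lagr R).

Lemma lagrP_per X : setF X -> periodic (lagrP X) 1.
Proof.
move=> FX; have [eX _] := FX; rewrite (lagrPE FX) => x.
exact: (nonlocal_per (setE_ly_W11loc eX) (setE_ly_per eX) (setE_energy_locint eX)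
  (setE_energy_per eX) x (@continuous_green R)).
Qed.

Lemma lagrQ_per X : setF X -> periodic (lagrQ X) 1.
Proof.
move=> FX; have [eX _] := FX; rewrite (lagrQE FX) => x.
exact: (congr1 -%R (nonlocal_per (setE_ly_W11loc eX) (setE_ly_per eX) (setE_energy_locint eX)
  (setE_energy_per eX) x (@continuous_dgreen R))).
Qed.

Lemma lagrP_continuous X : setF X -> continuous (lagrP X).
Proof. by move=> FX; exact: primitive_continuous (primitive_lagrP FX). Qed.

Lemma lagrQ_continuous X : setF X -> continuous (lagrQ X).
Proof. by move=> FX; exact: primitive_continuous (primitive_lagrQ FX). Qed.

(* nu_t is the xi-derivative of U^3 - 2 P U. *)
Lemma primitive_rhs_nu X : setF X ->
  primitive (fun x => lU X x ^+ 3 - 2 * (lagrP X x * lU X x)) (lnu (lagr_rhs X)).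
Proof.
move=> FX; have [eX _] := FX; have [_ [_ wU] _ _] := eX.
have PU : primitive (lU X) (lU X)^`() := wU.
have P3 := primitiveM (primitive_sqr PU) PU.
have P2 := primitiveZ 2 (primitiveM (primitive_lagrP FX) PU).
apply: primitive_eq (primitiveB P3 P2) _ _ => x /=; rewrite /GRing.scale/=.
  by rewrite -exprSr.
move: (lagrP X x) (lagrQ X x) (lU X x) ((lU X)^`() x) ((ly X)^`() x) => p q u v z.
by ring.
Qed.

Lemma Etangent_rhs X : setF X -> Etangent (lagr_rhs X).
Proof.
move=> FX; have [eX _] := FX; have [_ [pU wU] _ _] := eX.
have QN : (fun x => - lagrQ X x) = -1 \*: lagrQ X.
  by apply/funext => x; rewrite /= /GRing.scale/= mulN1r.
split.
- exact: (conj pU wU).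
- split; first by move=> x /=; rewrite (lagrQ_per FX).
  by rewrite /= QN; exact: primitive_W11loc (primitiveZ (-1) (primitive_lagrQ FX)).
- apply: locint_L1per; last by case: (primitive_rhs_nu FX).
  move=> x /=; rewrite (lagrQ_per FX) (lagrP_per FX) pU (derive1_periodic (setE_ly_per eX)).
  by rewrite (@derive1_periodic _ _ 0)// => z; rewrite pU addr0.
- by apply: locint_L1per; [move=> x|exact: locint_cst].
Qed.

Lemma itg_rhs_nu X : setF X -> itg 0 1 (lnu (lagr_rhs X)) = 0.
Proof.
move=> FX; have [eX _] := FX; have [_ [pU _] _ _] := eX.
have [_ H] := primitive_rhs_nu FX; rewrite -H//.
have := lagrP_per FX 0; have := pU 0; rewrite add0r => -> ->.
by rewrite subrr.
Qed.

Lemma energy_relabel X f g : relabeling f g -> setE X ->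
  {ae mu, forall x, energy (relabel X f) x = energy X (f x) * f^`() x}.
Proof.
move=> rf eX; apply: aeS (derive1_relabel rf (setE_ly_W11loc eX)) => x H.
by rewrite /energy /= H; ring.
Qed.

(** The energy transforms like a density, and f maps [xi, xi + 1] onto [f xi, f xi + 1]: this is a
    substitution. *)
Lemma nonlocal_relabel X f g k xi : relabeling f g -> setE X -> continuous k ->
  nonlocal (ly (relabel X f)) (energy (relabel X f)) k xi =
  nonlocal (ly X) (energy X) k (f xi).
Proof.
move=> rf eX ck; have lw := setE_energy_locint eX.
have lk := locint_kernel (setE_ly_W11loc eX) lw (f xi) ck.
have eXf := setE_relabel rf eX.
have lk' := locint_kernel (setE_ly_W11loc eXf) (setE_energy_locint eXf) xi ck.
rewrite /nonlocal -(relab_per rf) (relabeling_itg _ _ rf lk).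
apply: ae_eq_itg; [exact: locint_measurable|exact: (locint_measurable (relabeling_locint rf lk))|].
by apply: aeS (energy_relabel rf eX) => x ->; rewrite mulrA.
Qed.

Lemma relabel_rhs X f g : relabeling f g -> setF X ->
  lagr_ae (lagr_rhs (relabel X f)) (relabel (lagr_rhs X) f).
Proof.
move=> rf FX; have FXf := setF_relabel rf FX; have [eX _] := FX.
have wy := setE_ly_W11loc eX; have [_ [_ wU] _ _] := eX.
have PE x : lagrP (relabel X f) x = lagrP X (f x).
  by rewrite (lagrPE FXf) (lagrPE FX) (nonlocal_relabel x rf eX (@continuous_green R)).
have QE x : lagrQ (relabel X f) x = lagrQ X (f x).
  by rewrite (lagrQE FXf) (lagrQE FX) (nonlocal_relabel x rf eX (@continuous_dgreen R)).
split.
- by [].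
- by apply/funext => x /=; rewrite QE.
- apply: aeS2 (derive1_relabel rf wy) (derive1_relabel rf wU) => x /= -> ->.
  rewrite PE QE.
  move: (lagrP X (f x)) (lagrQ X (f x)) (lU X (f x)) ((lU X)^`() (f x)) ((ly X)^`() (f x)) (f^`() x) => p q u v z t.
  by ring.
- by apply: aeW => x /=; rewrite mul0r.
Qed.

End Rhs.

(** * Lipschitz bound for the vector field *)

Section Bounds.
Context {R : realType}.
Local Notation mu := (@lebesgue_measure R).
Implicit Types (a b c x s xi th M : R) (k f g : R -> R) (X : lagr R).

(** The bound on U^2 is 2 M + 2 D^2 with D = (1 + M) / 2. The summand 1 makes the constant at least
    1, so it also bounds |U| itself and its powers absorb lower-order terms; it dominates int |U_xi|
    and the total energy, hence P and Q. *)
Definition bndM M : R := 1 + 2 * M + (1 + M) ^+ 2 / 2.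

Lemma W11per_osc (v : R -> R) x z : W11per v -> 0 <= x <= 1 -> 0 <= z <= 1 ->
  `|v x - v z| <= l1n v^`().
Proof.
move=> [pv [lv vE]].
have H p q : p <= q -> 0 <= p -> q <= 1 -> `|v q - v p| <= l1n v^`().
  move=> pq p0 q1; rewrite vE// (le_trans (itg_norm_le _ _ lv))//.
  exact: (itg_sub (locint_norm lv) (fun=> normr_ge0 _) p0 pq q1).
move=> /andP[x0 x1] /andP[z0 z1].
by have [xz|/ltW zx] := leP x z; [rewrite distrC; exact: H|exact: H].
Qed.

Lemma itg_ly X : setE X -> itg 0 1 (ly X)^`() = 1.
Proof.
move=> eX; have [_ H] := setE_ly_W11loc eX; rewrite -[LHS]H ?ler01//.
by have := setE_ly_per eX 0; rewrite add0r => ->; rewrite addrAC subrr add0r.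
Qed.

Lemma setF_l1n_ly X : setF X -> l1n (ly X)^`() = 1.
Proof.
move=> [eX [_ [Fy _ _ _]]]; have [ly' _] := setE_ly_W11loc eX.
rewrite -(itg_ly eX); apply: ae_eq_itg.
- exact: (locint_measurable (locint_norm ly')).
- exact: (locint_measurable ly').
- by apply: aeS Fy => x; exact: ger0_norm.
Qed.

Lemma setF_itg_nu X : setF X -> itg 0 1 (lnu X) = lagr_h X.
Proof.
move=> FX; have [[_ _ Ln _] [_ [_ Fn _ _]]] := FX.
rewrite (lagr_hE Ln); have ln := L1per_locint Ln; apply: ae_eq_itg.
- exact: (locint_measurable ln).
- exact: (locint_measurable (locint_norm ln)).
- by apply: aeS Fn => x n0; rewrite ger0_norm.
Qed.

Lemma lagr_h_ge0 X : 0 <= lagr_h X.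
Proof. by rewrite fine_ge0// Lnorm_ge0. Qed.

(* U_xi^2 <= y_xi nu <= ((y_xi + nu) / 2)^2. *)
Lemma setF_l1n_lU X : setF X -> l1n (lU X)^`() <= (1 + lagr_h X) / 2.
Proof.
move=> FX; have [eX [_ [Fy Fn _ Fe]]] := FX; have [_ [_ wU] /L1per_locint ln _] := eX.
have [ly' _] := setE_ly_W11loc eX.
have -> : (1 + lagr_h X) / 2 = itg 0 1 (fun x => 2^-1 * ((ly X)^`() x + lnu X x)).
  rewrite itgZ ?itgD// ?(itg_ly eX) ?(setF_itg_nu FX) 1?mulrC//.
  exact: locally_integrableD.
apply: l1n_le.
- exact: W11loc_locint.
- by apply: locintZ; exact: locally_integrableD.
- apply: aeS3 Fy Fn Fe => x.
  move: ((ly X)^`() x) (lnu X x) (lU X x) ((lU X)^`() x) (lr X x) => p n u v r p0 n0 E.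
  have h0 : 0 <= 2^-1 * (p + n) by rewrite mulr_ge0// addr_ge0.
  rewrite -(ler_pXn2r (n := 2))// ?nnegrE// real_normK ?num_real//.
  have := sqr_ge0 (p * u); have := sqr_ge0 r; have := sqr_ge0 (p - n).
  by rewrite exprMn; nra.
Qed.

(** Where y_xi > 0, the identity y_xi nu = y_xi^2 U^2 + U_xi^2 + r^2 is divided by y_xi; where y_xi
    = 0, the left side is 0 and nu >= 0. *)
Lemma setF_kinetic_le X : setF X -> {ae mu, forall x, lU X x ^+ 2 * (ly X)^`() x <= lnu X x}.
Proof.
move=> [_ [_ [Fy Fn _ Fe]]]; apply: aeS3 Fy Fn Fe => x.
move: ((ly X)^`() x) (lnu X x) (lU X x) ((lU X)^`() x) (lr X x) => p n u v r p0 n0 E.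
have [p00|p_gt0] := eqVneq p 0; first by rewrite p00 mulr0.
have pp : 0 < p by rewrite lt_neqAle eq_sym p_gt0.
rewrite -(ler_pM2l pp); have := sqr_ge0 v; have := sqr_ge0 r; nra.
Qed.

Lemma locint_kinetic X : setE X ->
  locally_integrable [set: R] (fun x => lU X x ^+ 2 * (ly X)^`() x).
Proof.
move=> eX; have [ly' _] := setE_ly_W11loc eX; have [_ [_ wU] _ _] := eX.
apply: (@locintM_cont _ _ (fun x => lU X x ^+ 2)) => // x.
by apply: cvgM; exact: (W11loc_continuous wU).
Qed.

Lemma setF_itg_kinetic X : setF X ->
  itg 0 1 (fun x => lU X x ^+ 2 * (ly X)^`() x) <= lagr_h X.
Proof.
move=> FX; have [eX _] := FX; rewrite -(setF_itg_nu FX).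
apply: le_itg_ae (setF_kinetic_le FX); first exact: locint_kinetic.
by apply: L1per_locint; exact: setF_L1per_nu.
Qed.

(* U(x)^2 <= 2 U(z)^2 + 2 D^2 with D = int |U_xi|; average over z against y_xi,
   which has integral 1 and satisfies int U^2 y_xi <= h. *)
Lemma setF_lU_bnd X M x : setF X -> lagr_h X <= M -> `|lU X x| <= bndM M.
Proof.
move=> FX hM; have [eX [_ [Fy _ _ _]]] := FX; have [_ Wu _ _] := eX.
have [ly' _] := setE_ly_W11loc eX; have lk := locint_kinetic eX.
rewrite -(periodic_frac x Wu.1); have x01 := frac_itv x.
move: (x - _) x01 => {}x x01.
have h0 := lagr_h_ge0 X; set h := lagr_h X in hM h0 *.
set D := (1 + h) / 2.
have dU z : 0 <= z <= 1 -> `|lU X x - lU X z| <= D.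
  by move=> z01; rewrite (le_trans (W11per_osc Wu x01 z01))// setF_l1n_lU.
have key : lU X x ^+ 2 <= 2 * h + 2 * D ^+ 2.
  have -> : lU X x ^+ 2 = itg 0 1 (fun z => lU X x ^+ 2 * (ly X)^`() z).
    by rewrite itgZ// (itg_ly eX) mulr1.
  have lk2 : locally_integrable [set: R] (fun z => 2 * (lU X z ^+ 2 * (ly X)^`() z)) by exact: locintZ.
  have lD : locally_integrable [set: R] (fun z => 2 * D ^+ 2 * (ly X)^`() z) by exact: locintZ.
  apply: (@le_trans _ _ (itg 0 1 (fun z => 2 * (lU X z ^+ 2 * (ly X)^`() z) + 2 * D ^+ 2 * (ly X)^`() z))).
    rewrite -subr_ge0 -itgB; [|exact: locally_integrableD|exact: locintZ].
    rewrite (@ae_eq_itg_in _ _ (fun z => `|2 * (lU X z ^+ 2 * (ly X)^`() z) + 2 * D ^+ 2 * (ly X)^`() z - lU X x ^+ 2 * (ly X)^`() z|)).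
    - exact: l1n_ge0.
    - by apply: locint_measurable; apply: locally_integrableB; [exact: locally_integrableD|exact: locintZ].
    - apply: locint_measurable; apply: locint_norm; apply: locally_integrableB; [exact: locally_integrableD|exact: locintZ].
    - apply: aeS Fy => z p0 z01; rewrite ger0_norm//.
      have := dU z z01; rewrite ler_norml => /andP[].
      move: ((ly X)^`() z) (lU X x) (lU X z) p0 => p u v p0 h1 h2.
      have -> : 2 * (v ^+ 2 * p) + 2 * D ^+ 2 * p - u ^+ 2 * p = (2 * v ^+ 2 + 2 * D ^+ 2 - u ^+ 2) * p by ring.
      (* 2 v^2 + 2 D^2 - u^2 = (u - 2 v)^2 + 2 (D - (u - v)) (D + (u - v)). *)
      apply: mulr_ge0 => //; have := sqr_ge0 (u - 2 * v).
      have : 0 <= (D - (u - v)) * (D + (u - v)) by apply: mulr_ge0; lra.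
      by nra.
  rewrite itgD// !itgZ// (itg_ly eX) mulr1 lerD2r ler_pM2l//.
  exact: setF_itg_kinetic.
rewrite -(ler_pXn2r (n := 2))// ?nnegrE//; last first.
  by rewrite /bndM; have := sqr_ge0 (1 + M); lra.
rewrite real_normK ?num_real// (le_trans key)//.
rewrite /bndM /D; nra.
Qed.

Lemma setF_l1n_energy X M : setF X -> lagr_h X <= M -> l1n (energy X) <= bndM M.
Proof.
move=> FX hM; have [eX [_ [Fy Fn _ _]]] := FX; have lk := locint_kinetic eX.
have ln := L1per_locint (setF_L1per_nu FX); have h0 := lagr_h_ge0 X.
apply: (@le_trans _ _ (itg 0 1 (fun x => lU X x ^+ 2 * (ly X)^`() x + lnu X x))).
  apply: l1n_le; [exact: setE_energy_locint|exact: setE_energy_locint|].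
  apply: aeS2 Fy Fn => x p0 n0.
  by rewrite ger0_norm ?lexx//; apply: addr_ge0 => //; apply: mulr_ge0 => //; exact: sqr_ge0.
rewrite itgD// (setF_itg_nu FX); have := setF_itg_kinetic FX.
by rewrite /bndM; have := sqr_ge0 (1 + M); lra.
Qed.

Lemma bndM_ge1 M : 0 <= M -> 1 <= bndM M.
Proof. by rewrite /bndM => M0; have := sqr_ge0 (1 + M); lra. Qed.

Lemma setF_lagrP_bnd X M x : setF X -> lagr_h X <= M -> `|lagrP X x| <= bndM M.
Proof.
move=> FX hM; have [eX _] := FX; rewrite (lagrPE FX).
apply: le_trans (setF_l1n_energy FX hM).
exact: (nonlocal_bnd (setE_ly_W11loc eX) (setE_ly_per eX) (setF_ly_homo FX)
  (setE_energy_locint eX) (setE_energy_per eX) x (@continuous_green R) (@green_bnd R)).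
Qed.

Lemma setF_lagrQ_bnd X M x : setF X -> lagr_h X <= M -> `|lagrQ X x| <= bndM M.
Proof.
move=> FX hM; have [eX _] := FX; rewrite (lagrQE FX) normrN.
apply: le_trans (setF_l1n_energy FX hM).
exact: (nonlocal_bnd (setE_ly_W11loc eX) (setE_ly_per eX) (setF_ly_homo FX)
  (setE_energy_locint eX) (setE_energy_per eX) x (@continuous_dgreen R) (@dgreen_bnd R)).
Qed.

End Bounds.

(** * Differences of the vector field at two points *)

Section Lipschitz.
Context {R : realType}.
Local Notation mu := (@lebesgue_measure R).
Implicit Types (a b c x s xi th M : R) (k f g : R -> R) (X : lagr R).

(** Continuous coefficients are measured in the sup norm and densities only in L^1, as independence
    of the relabeling demands; the difference is (a1 - a2) g1 + a2 (g1 - g2). *)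
Lemma l1n_prod_sub (a1 a2 g1 g2 : R -> R) (s S : R) :
  continuous a1 -> continuous a2 ->
  locally_integrable [set: R] g1 -> locally_integrable [set: R] g2 ->
  (forall x, `|a1 x - a2 x| <= s) -> (forall x, `|a2 x| <= S) ->
  l1n (fun x => a1 x * g1 x - a2 x * g2 x) <= s * l1n g1 + S * l1n (g1 \- g2).
Proof.
move=> c1 c2 l1 l2 hs hS.
have ln1 := locint_norm l1; have ln12 := locint_norm (locally_integrableB l1 l2).
have -> : s * l1n g1 + S * l1n (g1 \- g2) =
    itg 0 1 (fun x => s * `|g1 x| + S * `|g1 x - g2 x|).
  by rewrite itgD ?itgZ//; exact: locintZ.
apply: l1n_le.
- by apply: locally_integrableB; [exact: (locintM_cont c1)|exact: (locintM_cont c2)].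
- by apply: locally_integrableD; exact: locintZ.
- apply: aeW => x.
  have -> : a1 x * g1 x - a2 x * g2 x = (a1 x - a2 x) * g1 x + a2 x * (g1 x - g2 x) by ring.
  rewrite (le_trans (ler_normD _ _))// !normrM.
  by apply: lerD; apply: ler_wpM2r => //; exact: normr_ge0.
Qed.

(** Both kernel arguments lie in [0, 1], where k is 1-Lipschitz; the factor 2 arises because they
    differ by y1 - y2 at th minus y1 - y2 at xi. *)
Lemma nonlocal_sub (y1 y2 dy1 dy2 w1 w2 : R -> R) k s xi :
  primitive y1 dy1 -> primitive y2 dy2 ->
  (forall x, y1 (x + 1) = y1 x + 1) -> (forall x, y2 (x + 1) = y2 x + 1) ->
  {homo y1 : x z / x <= z} -> {homo y2 : x z / x <= z} ->
  locally_integrable [set: R] w1 -> locally_integrable [set: R] w2 ->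
  (forall x, w1 (x + 1) = w1 x) -> (forall x, w2 (x + 1) = w2 x) ->
  continuous k -> (forall u, 0 <= u <= 1 -> `|k u| <= 1) ->
  (forall u v, 0 <= u <= 1 -> 0 <= v <= 1 -> `|k u - k v| <= `|u - v|) ->
  (forall x, `|y1 x - y2 x| <= s) ->
  `|nonlocal y1 w1 k xi - nonlocal y2 w2 k xi| <= 2 * s * l1n w1 + l1n (w1 \- w2).
Proof.
move=> P1 P2 yp1 yp2 hy1 hy2 lw1 lw2 wp1 wp2 ck k1 klip hs.
have lk1 := locint_kernel P1 lw1 xi ck; have lk2 := locint_kernel P2 lw2 xi ck.
have ln1 := locint_norm lw1; have ln12 := locint_norm (locally_integrableB lw1 lw2).
have lR : locally_integrable [set: R] (fun x => 2 * s * `|w1 x| + `|w1 x - w2 x|).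
  by apply: locally_integrableD => //; exact: locintZ.
have -> : 2 * s * l1n w1 + l1n (w1 \- w2) = itg xi (xi + 1) (fun x => 2 * s * `|w1 x| + `|w1 x - w2 x|).
  rewrite itg_periodic//; last by move=> x; rewrite wp1 wp2.
  by rewrite itgD ?itgZ//; exact: locintZ.
rewrite /nonlocal -itgB//.
have lB := locally_integrableB lk1 lk2.
apply: le_trans (itg_norm_le _ _ lB) _.
apply: le_itg => //; first exact: locint_norm.
move=> th thx /=.
have u1 := y_window yp1 hy1 thx; have u2 := y_window yp2 hy2 thx.
have -> : k (y1 th - y1 xi) * w1 th - k (y2 th - y2 xi) * w2 th =
  (k (y1 th - y1 xi) - k (y2 th - y2 xi)) * w1 th + k (y2 th - y2 xi) * (w1 th - w2 th) by ring.
apply: le_trans (ler_normD _ _) _; rewrite !normrM; apply: lerD; last by rewrite ler_piMl// k1.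
apply: ler_wpM2r; first exact: normr_ge0.
apply: le_trans (klip _ _ u1 u2) _.
have -> : y1 th - y1 xi - (y2 th - y2 xi) = (y1 th - y2 th) - (y1 xi - y2 xi) by ring.
apply: le_trans (ler_normB _ _) _.
have := hs th; have := hs xi; move: `|y1 th - y2 th| `|y1 xi - y2 xi| => p q; lra.
Qed.

Lemma le_bndM (m M : R) : 0 <= m -> m <= M -> (1 + m) / 2 <= bndM M.
Proof. by rewrite /bndM => m0 mM; have := sqr_ge0 (1 + M); lra. Qed.

(** 39 = 14 + 2 + 18 + 5. Plain reals replace the norms to keep the terms small for [lra]. *)
Let rhs_nu_arith (b d p q r : R) :
  2 * b ^+ 2 * p <= 2 * b ^+ 2 * d -> 18 * b ^+ 2 * d * q <= 18 * b ^+ 2 * d * b ->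
  5 * b ^+ 2 * r <= 5 * b ^+ 2 * d -> b ^+ 2 * d <= b ^+ 3 * d ->
  14 * b ^+ 3 * d * 1 + 2 * b ^+ 2 * p + (18 * b ^+ 2 * d * q + 5 * b ^+ 2 * r) <= 39 * b ^+ 3 * d.
Proof.
have -> : 18 * b ^+ 2 * d * b = 18 * (b ^+ 3 * d) by ring.
move: (2 * b ^+ 2 * p) (18 * b ^+ 2 * d * q) (5 * b ^+ 2 * r) => x y z.
by rewrite mulr1 -!mulrA; move: (b ^+ 2 * d) (b ^+ 3 * d) => u v; lra.
Qed.

Let rhs_arith (b d : R) : d <= b * d -> b * d <= b ^+ 2 * d -> b ^+ 2 * d <= b ^+ 3 * d ->
  d + 15 * b ^+ 2 * d + 39 * b ^+ 3 * d + 0 <= 55 * b ^+ 3 * d.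
Proof.
rewrite -!mulrA; move: (b * d) (b ^+ 2 * d) (b ^+ 3 * d) => u v w; lra.
Qed.

Section Two.
Variables (X1 X2 : lagr R) (M : R).
Hypotheses (F1 : setF X1) (F2 : setF X2) (h1 : lagr_h X1 <= M) (h2 : lagr_h X2 <= M).
Let e1 : setE X1. Proof. by case: F1. Qed.
Let e2 : setE X2. Proof. by case: F2. Qed.
Let B := bndM M.
Let D := Enormr (lagr_sub X1 X2).
Let B1 : 1 <= B. Proof. by apply: bndM_ge1; apply: le_trans h1; exact: lagr_h_ge0. Qed.
Let D0 : 0 <= D. Proof. exact: Enormr_ge0. Qed.
Let tX := setE_sub e1 e2.

Let parts : [/\ w11n (ly X1 \- ly X2) <= D, w11n (lU X1 \- lU X2) <= D &
  l1n (lnu X1 \- lnu X2) <= D].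
Proof.
have H (a b c d : R) : 0 <= a -> 0 <= b -> 0 <= c -> 0 <= d ->
    [/\ a <= a + b + c + d, b <= a + b + c + d & c <= a + b + c + d] by move=> *; split; lra.
by apply: H; rewrite ?l1n_ge0// addr_ge0 ?supn_ge0 ?l1n_ge0.
Qed.

Let split_w11 (v : R -> R) (C : R) : W11per v -> w11n v <= C ->
  (forall x, `|v x| <= C) /\ l1n v^`() <= C.
Proof.
move=> [pv wv] vC; split=> [x|].
  apply: le_trans vC; apply: le_trans (le_supn_periodic x (W11loc_continuous wv) pv) _.
  by rewrite lerDl l1n_ge0.
by apply: le_trans vC; rewrite lerDr supn_ge0.
Qed.

Let dy x : `|ly X1 x - ly X2 x| <= D.
Proof. by have [[wy _ _ _] [py _ _]] := (tX, parts); exact: (proj1 (split_w11 wy py)). Qed.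

Let dU x : `|lU X1 x - lU X2 x| <= D.
Proof. by have [[_ wU _ _] [_ pU _]] := (tX, parts); exact: (proj1 (split_w11 wU pU)). Qed.

Let wy1 := setE_ly_W11loc e1.
Let wy2 := setE_ly_W11loc e2.
Let wU1 : W11loc (lU X1). Proof. by have [_ [_]] := e1. Qed.
Let wU2 : W11loc (lU X2). Proof. by have [_ [_]] := e2. Qed.
Let cU1 : continuous (lU X1) := W11loc_continuous wU1.
Let cU2 : continuous (lU X2) := W11loc_continuous wU2.
Let cP1 := lagrP_continuous F1.
Let cP2 := lagrP_continuous F2.
Let cQ1 := lagrQ_continuous F1.
Let cQ2 := lagrQ_continuous F2.

Let l1n_derive1B (u v : R -> R) : W11loc u -> W11loc v ->
  l1n (u \- v)^`() = l1n (u^`() \- v^`()).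
Proof.
move=> wu wv; apply: l1n_ae (primitive_derive1 (primitiveB wu wv)).
  exact: (locint_measurable (W11loc_locint (W11locB wu wv))).
exact: (locint_measurable (locally_integrableB (W11loc_locint wu) (W11loc_locint wv))).
Qed.

Let dy' : l1n ((ly X1)^`() \- (ly X2)^`()) <= D.
Proof.
rewrite -(l1n_derive1B wy1 wy2).
by have [[wy _ _ _] [py _ _]] := (tX, parts); exact: (proj2 (split_w11 wy py)).
Qed.

Let dU' : l1n ((lU X1)^`() \- (lU X2)^`()) <= D.
Proof.
rewrite -(l1n_derive1B wU1 wU2).
by have [[_ wU _ _] [_ pU _]] := (tX, parts); exact: (proj2 (split_w11 wU pU)).
Qed.

Let lw1 := setE_energy_locint e1.
Let lw2 := setE_energy_locint e2.

Let BD : D <= B * D. Proof. by rewrite ler_peMl. Qed.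
Let BBD : B * D <= B ^+ 2 * D.
Proof. by rewrite expr2 -mulrA; apply: ler_peMl => //; rewrite mulr_ge0//; apply: le_trans B1. Qed.

Let bU1 x : `|lU X1 x| <= B := setF_lU_bnd x F1 h1.
Let bU2 x : `|lU X2 x| <= B := setF_lU_bnd x F2 h2.

Let dU2 x : `|lU X1 x ^+ 2 - lU X2 x ^+ 2| <= 2 * B * D.
Proof.
rewrite subr_sqr normrM mulrC; apply: ler_pM => //.
by apply: le_trans (ler_normD _ _) _; have := bU1 x; have := bU2 x; move: `|lU X1 x| `|lU X2 x| => p q; lra.
Qed.

Let bUU x : `|lU X2 x ^+ 2| <= B ^+ 2.
Proof. by rewrite normrX lerXn2r ?nnegrE//; apply: le_trans B1. Qed.

Let csqr (u : R -> R) : continuous u -> continuous (fun x => u x ^+ 2).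
Proof. by move=> cu x; apply: cvgM; exact: cu. Qed.

(** 2 B D from U^2, B^2 D from y_xi and D from nu, each at most a multiple of B^2 D because B >=
    1. *)
Let dw : l1n (energy X1 \- energy X2) <= 4 * B ^+ 2 * D.
Proof.
have ly1 := W11loc_locint wy1; have ly2 := W11loc_locint wy2.
have ln1 := L1per_locint (setF_L1per_nu F1); have ln2 := L1per_locint (setF_L1per_nu F2).
have H := l1n_prod_sub (csqr cU1) (csqr cU2) ly1 ly2 dU2 bUU.
have [_ _ pn] := parts.
have lk := locally_integrableB (locintM_cont (csqr cU1) ly1) (locintM_cont (csqr cU2) ly2).
have lnn := locally_integrableB ln1 ln2.
have -> : energy X1 \- energy X2 = (fun x => lU X1 x ^+ 2 * (ly X1)^`() x - lU X2 x ^+ 2 * (ly X2)^`() x)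
    \+ (lnu X1 \- lnu X2).
  by apply/funext => x /=; rewrite /energy; ring.
apply: le_trans (l1nD lk lnn) _.
rewrite (setF_l1n_ly F1) in H.
apply: le_trans (lerD H pn) _.
have : B ^+ 2 * l1n ((ly X1)^`() \- (ly X2)^`()) <= B ^+ 2 * D by apply: ler_wpM2l dy'; exact: sqr_ge0.
have := BD; have := BBD.
by move: (l1n _) => z; move: D B => d b; lra.
Qed.

(** 2 D B from the kernel and 4 B^2 D from the energy. *)
Let nonlocal_diff k xi : continuous k -> (forall u, 0 <= u <= 1 -> `|k u| <= 1) ->
  (forall u v, 0 <= u <= 1 -> 0 <= v <= 1 -> `|k u - k v| <= `|u - v|) ->
  `|nonlocal (ly X1) (energy X1) k xi - nonlocal (ly X2) (energy X2) k xi| <= 6 * B ^+ 2 * D.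
Proof.
move=> ck k1 klip.
apply: le_trans (nonlocal_sub xi wy1 wy2 (setE_ly_per e1) (setE_ly_per e2)
  (setF_ly_homo F1) (setF_ly_homo F2) lw1 lw2 (setE_energy_per e1) (setE_energy_per e2) ck k1 klip dy) _.
have H1 : 2 * D * l1n (energy X1) <= 2 * D * B.
  by apply: ler_wpM2l; [exact: mulr_ge0|exact: setF_l1n_energy F1 h1].
apply: le_trans (lerD H1 dw) _.
by have := BBD; move: D B => d b; lra.
Qed.

Let dP x : `|lagrP X1 x - lagrP X2 x| <= 6 * B ^+ 2 * D.
Proof.
rewrite (lagrPE F1) (lagrPE F2).
exact: (nonlocal_diff x (@continuous_green R) (@green_bnd R) (@green_lip R)).
Qed.

Let dQ x : `|lagrQ X1 x - lagrQ X2 x| <= 6 * B ^+ 2 * D.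
Proof.
have -> : lagrQ X1 x - lagrQ X2 x = - (nonlocal (ly X1) (energy X1) dgreen x -
    nonlocal (ly X2) (energy X2) dgreen x).
  by rewrite (lagrQE F1) (lagrQE F2); ring.
rewrite normrN.
exact: (nonlocal_diff x (@continuous_dgreen R) (@dgreen_bnd R) (@dgreen_lip R)).
Qed.

Let B0 : 0 <= B. Proof. exact: le_trans B1. Qed.

Let BBBD : B ^+ 2 * D <= B ^+ 3 * D.
Proof. by rewrite (exprS B 2) -mulrA; apply: ler_peMl => //; rewrite mulr_ge0// sqr_ge0. Qed.

Let bP2 x : `|lagrP X2 x| <= B := setF_lagrP_bnd x F2 h2.
Let bQ1 x : `|lagrQ X1 x| <= B := setF_lagrQ_bnd x F1 h1.
Let bQ2 x : `|lagrQ X2 x| <= B := setF_lagrQ_bnd x F2 h2.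

Let ly1 := W11loc_locint wy1.
Let ly2 := W11loc_locint wy2.
Let lU1 := W11loc_locint wU1.
Let lU2 := W11loc_locint wU2.

(** From Q_xi = P y_xi - energy / 2: 6 B^2 D for the change of P, B D for that of y_xi, and half of
    4 B^2 D for the energy. *)
Let dQ' : l1n (lagrQ X1 \- lagrQ X2)^`() <= 9 * B ^+ 2 * D.
Proof.
have PQ := primitiveB (primitive_lagrQ F1) (primitive_lagrQ F2).
set u := fun x => lagrP X1 x * (ly X1)^`() x - lagrP X2 x * (ly X2)^`() x.
have lu : locally_integrable [set: R] u.
  exact: locally_integrableB (locintM_cont cP1 ly1) (locintM_cont cP2 ly2).
have lw := locally_integrableB lw1 lw2.
have PQ' : primitive (lagrQ X1 \- lagrQ X2) (u \+ - 2^-1 \*: (energy X1 \- energy X2)).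
  by apply: primitive_eq PQ _ _ => x //=; rewrite /u /GRing.scale/=; ring.
rewrite (l1n_ae (locint_measurable (W11loc_locint (primitive_W11loc PQ')))
  (locint_measurable (proj1 PQ')) (primitive_derive1 PQ')).
apply: le_trans (l1nD lu (locintZ _ lw)) _.
have H1 : l1n u <= _ := l1n_prod_sub cP1 cP2 ly1 ly2 dP bP2.
rewrite (setF_l1n_ly F1) in H1.
have H2 : l1n (- 2^-1 \*: (energy X1 \- energy X2)) <= 2 * B ^+ 2 * D.
  rewrite (l1nZ _ lw) normrN gtr0_norm ?invr_gt0//.
  by move: dw; move: (l1n _) => z; move: D B => d b; lra.
apply: le_trans (lerD H1 H2) _.
have H3 : B * l1n ((ly X1)^`() \- (ly X2)^`()) <= B * D by exact: (ler_wpM2l B0 dy').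
move: H3 BBD; move: (l1n _) => z; move: D B => d b; lra.
Qed.

Let rhs_U : w11n ((fun x => - lagrQ X1 x) \- (fun x => - lagrQ X2 x)) <= 15 * B ^+ 2 * D.
Proof.
have wQ : W11loc (lagrQ X1 \- lagrQ X2).
  exact: primitive_W11loc (primitiveB (primitive_lagrQ F1) (primitive_lagrQ F2)).
have -> : (fun x => - lagrQ X1 x) \- (fun x => - lagrQ X2 x) = -1 \*: (lagrQ X1 \- lagrQ X2).
  by apply/funext => x /=; rewrite /GRing.scale/=; ring.
apply: le_trans (w11nZ (-1) wQ) _; rewrite normrN normr1 mul1r.
have H : supn (lagrQ X1 \- lagrQ X2) <= 6 * B ^+ 2 * D.
  by apply: supn_le => [x|x _]; [apply: cvgB; [exact: cQ1|exact: cQ2]|exact: dQ].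
apply: le_trans (lerD H dQ') _.
by move: D B => d b; lra.
Qed.

Let a1 x := - 2 * lagrQ X1 x * lU X1 x.
Let a2 x := - 2 * lagrQ X2 x * lU X2 x.
Let b1 x := 3 * lU X1 x ^+ 2 - 2 * lagrP X1 x.
Let b2 x := 3 * lU X2 x ^+ 2 - 2 * lagrP X2 x.

Let da x : `|a1 x - a2 x| <= 14 * B ^+ 3 * D.
Proof.
rewrite (_ : a1 x - a2 x = - 2 * (lagrQ X1 x * (lU X1 x - lU X2 x) + lU X2 x * (lagrQ X1 x - lagrQ X2 x))); last by rewrite /a1 /a2; ring.
rewrite normrM normrN (ger0_norm (ler0n _ 2)).
have H1 : `|lagrQ X1 x * (lU X1 x - lU X2 x)| <= B * D.
  by rewrite normrM; apply: ler_pM => //; exact: bQ1.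
have H2 : `|lU X2 x * (lagrQ X1 x - lagrQ X2 x)| <= B * (6 * B ^+ 2 * D).
  by rewrite normrM; apply: ler_pM => //.
have := le_trans (ler_normD _ _) (lerD H1 H2).
by move: BBD BBBD; move: (`|_ + _|) => z; move: D B => d b; rewrite !exprS expr0; lra.
Qed.

Let ba x : `|a2 x| <= 2 * B ^+ 2.
Proof.
rewrite /a2 !normrM normrN (ger0_norm (ler0n _ 2)) expr2 -mulrA ler_pM2l//.
by apply: ler_pM => //.
Qed.

Let db x : `|b1 x - b2 x| <= 18 * B ^+ 2 * D.
Proof.
rewrite (_ : b1 x - b2 x = 3 * (lU X1 x ^+ 2 - lU X2 x ^+ 2) - 2 * (lagrP X1 x - lagrP X2 x)); last by rewrite /b1 /b2; ring.
apply: le_trans (ler_normB _ _) _.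
rewrite (normrM 3) (ger0_norm (ler0n _ 3)) (normrM 2) (ger0_norm (ler0n _ 2)).
have := dU2 x; have := dP x; move: BBD.
by move: (`|_|) (`|_|) => p q; move: D B => d b; lra.
Qed.

Let bb x : `|b2 x| <= 5 * B ^+ 2.
Proof.
rewrite /b2; apply: le_trans (ler_normB _ _) _.
rewrite (normrM 3) (ger0_norm (ler0n _ 3)) (normrM 2) (ger0_norm (ler0n _ 2)).
have BB : B <= B ^+ 2 by rewrite expr2 ler_peMl.
have := bUU x; have := bP2 x; move: BB.
by move: (`|_|) (`|_|) => p q; move: B => b; lra.
Qed.

Let ca1 : continuous a1.
Proof. by move=> x; apply: cvgM; [apply: cvgM; [exact: cvg_cst|exact: cQ1]|exact: cU1]. Qed.
Let ca2 : continuous a2.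
Proof. by move=> x; apply: cvgM; [apply: cvgM; [exact: cvg_cst|exact: cQ2]|exact: cU2]. Qed.
Let cb1 : continuous b1.
Proof.
move=> x; apply: cvgB; apply: cvgM; [exact: cvg_cst|exact: (csqr cU1)|exact: cvg_cst|exact: cP1].
Qed.
Let cb2 : continuous b2.
Proof.
move=> x; apply: cvgB; apply: cvgM; [exact: cvg_cst|exact: (csqr cU2)|exact: cvg_cst|exact: cP2].
Qed.

Let rhs_nu : l1n (lnu (lagr_rhs X1) \- lnu (lagr_rhs X2)) <= 39 * B ^+ 3 * D.
Proof.
have HA := l1n_prod_sub ca1 ca2 ly1 ly2 da ba.
have HB := l1n_prod_sub cb1 cb2 lU1 lU2 db bb.
have lA := locally_integrableB (locintM_cont ca1 ly1) (locintM_cont ca2 ly2).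
have lB := locally_integrableB (locintM_cont cb1 lU1) (locintM_cont cb2 lU2).
have -> : lnu (lagr_rhs X1) \- lnu (lagr_rhs X2) =
  (fun x => a1 x * (ly X1)^`() x - a2 x * (ly X2)^`() x) \+
  (fun x => b1 x * (lU X1)^`() x - b2 x * (lU X2)^`() x).
  by apply/funext => x /=; rewrite /a1 /a2 /b1 /b2; ring.
apply: le_trans (l1nD lA lB) _.
apply: le_trans (lerD HA HB) _.
rewrite (setF_l1n_ly F1).
have uB : l1n (lU X1)^`() <= B.
  exact: le_trans (setF_l1n_lU F1) (le_bndM (lagr_h_ge0 X1) h1).
have H1 : 2 * B ^+ 2 * l1n ((ly X1)^`() \- (ly X2)^`()) <= 2 * B ^+ 2 * D.
  by apply: ler_wpM2l dy'; rewrite mulr_ge0// sqr_ge0.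
have H2 : 18 * B ^+ 2 * D * l1n (lU X1)^`() <= 18 * B ^+ 2 * D * B.
  by apply: ler_wpM2l uB; rewrite !mulr_ge0// sqr_ge0.
have H3 : 5 * B ^+ 2 * l1n ((lU X1)^`() \- (lU X2)^`()) <= 5 * B ^+ 2 * D.
  by apply: ler_wpM2l dU'; rewrite mulr_ge0// sqr_ge0.
exact: rhs_nu_arith H1 H2 H3 BBBD.
Qed.

(** 55 = 1 + 15 + 39 collects the components y, U and nu; the r component is zero. The cube of B
    comes from nu_t: in the coefficient - 2 Q U the change of Q costs B^2 D and U another B, and in
    the term with U_xi the factor int |U_xi| is at most B. *)
Lemma rhs_lipschitz :
  Enormr (lagr_sub (lagr_rhs X1) (lagr_rhs X2)) <= 55 * bndM M ^+ 3 * Enormr (lagr_sub X1 X2).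
Proof.
have [_ pU _] := parts.
have r0 : l1n ((fun=> 0) \- (fun=> 0) : R -> R) <= 0.
  rewrite /l1n (_ : (fun x => _) = (fun=> 0)); last by apply/funext => x /=; rewrite subr0 normr0.
  by rewrite itg_cst ?ler01// mul0r.
apply: le_trans (lerD (lerD (lerD pU rhs_U) rhs_nu) r0) _.
exact: rhs_arith BD BBD BBBD.
Qed.

End Two.
End Lipschitz.

(** * Stability of the flow *)

Section Gronwall.
Context {R : realType}.
Implicit Types (t s T L eta : R).

(** Differentiability is replaced by an upper bound on increments to the right and by the absence of
    upward jumps from the left, which are the two conditions that [real_induction] needs for phi <=
    psi. *)
Lemma gronwall (phi : R -> R) L T : 0 <= L -> 0 <= T -> (forall t, 0 <= phi t) ->
  (forall t eta, 0 <= t -> 0 < eta -> exists2 d, 0 < d &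
     forall s, t < s < t + d -> phi s <= phi t + (s - t) * (L * phi t + eta)) ->
  (forall t eta, 0 <= t -> 0 < eta -> exists2 d, 0 < d &
     forall s, 0 <= s -> t - d < s < t -> phi t <= phi s + eta) ->
  phi T <= expR (L * T) * phi 0.
Proof.
move=> L0 T0 phi0 Hr Hl.
have key eta : 0 < eta -> phi T <= expR (L * T) * (phi 0 + eta * T).
  (* The slack eta t absorbs the error eta (s - t) of a right increment, because exp (L s) >= 1. *)
  move=> eta0; pose psi t := expR (L * t) * (phi 0 + eta * t).
  have psi_homo s t : 0 <= s -> s <= t -> psi s <= psi t.
    move=> s0 st; apply: ler_pM; [exact: expR_ge0| |by rewrite ler_expR ler_wpM2l|].
      by rewrite addr_ge0// mulr_ge0// ltW.
    by rewrite lerD2l ler_pM2l.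
  apply: (@real_induction _ (fun t => phi t <= psi t) 0 T) => //.
  - by rewrite /psi !mulr0 addr0 expR0 mul1r.
  - move=> t /andP[t0 tT] /(_ t); rewrite t0 lexx => /(_ erefl) Pt.
    have [d d0 Hd] := Hr t eta t0 eta0; exists d => // s /andP[ts sd] _.
    have := Hd s; rewrite ts sd => /(_ erefl) /le_trans; apply.
    have st0 : 0 <= s - t by rewrite subr_ge0 ltW.
    have E1 : phi t * (1 + L * (s - t)) <= psi t * expR (L * (s - t)).
      by apply: ler_pM => //; [rewrite addr_ge0// mulr_ge0|exact: expR_ge1Dx].
    have E2 : psi s = psi t * expR (L * (s - t)) + expR (L * s) * (eta * (s - t)).
      rewrite /psi; have -> : expR (L * s) = expR (L * t) * expR (L * (s - t)).
        by rewrite -expRD; congr expR; ring.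
      by ring.
    have E3 : eta * (s - t) <= expR (L * s) * (eta * (s - t)).
      apply: ler_peMl; first by rewrite mulr_ge0// ltW.
      by rewrite -expR0 ler_expR mulr_ge0// (le_trans t0 (ltW ts)).
    rewrite E2; move: E1 E3; move: (psi t * _) (expR (L * s) * _) => p q; nra.
  - move=> t /andP[t0 tT] Pt; apply/ler_addgt0Pl => e e0.
    have [d d0 Hd] := Hl t e (ltW t0) e0.
    pose s := Num.max 0 (t - d / 2).
    have s0 : 0 <= s by rewrite le_max lexx.
    have st : s < t by rewrite gt_max t0/=; lra.
    have ds : t - d < s by rewrite lt_max; apply/orP; right; lra.
    have := Hd s s0; rewrite ds st => /(_ erefl) /le_trans; apply.
    rewrite addrC lerD2l; have := Pt s; rewrite s0 st => /(_ erefl) /le_trans; apply.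
    exact: psi_homo (ltW st).
apply/ler_addgt0Pl => e e0.
have c0 : 0 < expR (L * T) * T + 1 by rewrite ltr_wpDl// mulr_ge0// expR_ge0.
(* This eta makes the excess exp (L T) eta T at most e; the summand 1 covers T = 0. *)
apply: le_trans (key (e / (expR (L * T) * T + 1)) _) _; first exact: divr_gt0.
set c := _ + 1 in c0 *; set E := expR _.
have h : e / c * (E * T) <= e.
  apply: (@le_trans _ _ (e / c * c)); last by rewrite divfK// gt_eqF.
  by rewrite ler_pM2l ?divr_gt0// /c lerDl ler01.
by rewrite mulrDr mulrCA addrC lerD2r.
Qed.

End Gronwall.

(** * Differentiable curves in E and conservation of h *)

Section Flow.
Context {R : realType}.
Local Notation mu := (@lebesgue_measure R).
Implicit Types (X Y : lagr R) (Z W VZ VW : R -> lagr R) (t s T L eta : R).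

(** The error of the difference quotient at t, whose seminorm tends to 0 as s tends to t. *)
Definition lagr_dq Z VZ s t : lagr R :=
  lagr_sub (lagr_scale (s - t)^-1 (lagr_sub (Z s) (Z t))) (VZ t).

(** Differentiability in the seminorm of E in epsilon-delta form, which passes to relabeled curves
    by a single norm inequality. *)
Record curve Z VZ : Prop := Curve {
  curve_E : forall t, 0 <= t -> setE (Z t);
  curve_T : forall t, 0 <= t -> Etangent (VZ t);
  curve_dq : forall t eta, 0 <= t -> 0 < eta -> exists2 d, 0 < d &
    forall s, 0 <= s -> s != t -> `|s - t| < d -> Enormr (lagr_dq Z VZ s t) <= eta }.

Lemma Etangent_dq Z VZ s t : curve Z VZ -> 0 <= s -> 0 <= t -> Etangent (lagr_dq Z VZ s t).
Proof.
move=> [ZE ZT _] s0 t0; apply: Etangent_sub; last exact: ZT.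
by apply: Etangent_scale; apply: setE_sub; exact: ZE.
Qed.

Lemma C1_curve Z VZ : C1_with_derivative Z VZ -> curve Z VZ.
Proof.
move=> H.
have ZE t : 0 <= t -> setE (Z t) by move=> /H[].
have ZT t : 0 <= t -> Etangent (VZ t) by move=> /H[].
split=> // t eta t0 eta0; have [_ _ Hq _] := H t t0.
have : \forall x \near (0%E : \bar R), (x < eta%:E)%E by apply: open_ereal_lt'; rewrite lte_fin.
move=> /Hq; rewrite /nbhs/= /nbhs/= => -[d /= d0 Hd].
exists d => // s s0 st sd.
have := Hd s; rewrite /ball_/= distrC => /(_ sd st s0).
rewrite EnormE ?lte_fin; first exact: ltW.
apply: Etangent_sub; last exact: ZT.
by apply: Etangent_scale; apply: setE_sub; exact: ZE.
Qed.

(** For fixed f, relabeling is linear and does not increase the seminorm, hence acts on difference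
    quotients. *)
Lemma curve_relabel Z VZ f g : relabeling f g -> curve Z VZ ->
  curve (fun t => relabel (Z t) f) (fun t => relabel (VZ t) f).
Proof.
move=> rf cZ; have [ZE ZT Zd] := cZ; split.
- by move=> t t0; exact: setE_relabel rf (ZE t t0).
- by move=> t t0; exact: Etangent_relabel rf (ZT t t0).
- move=> t eta t0 eta0; have [d d0 Hd] := Zd t eta t0 eta0.
  exists d => // s s0 st sd; rewrite /lagr_dq -relabel_sub -relabel_scale -relabel_sub.
  apply: le_trans (Hd s s0 st sd).
  exact: Enormr_relabel rf (Etangent_dq cZ s0 t0).
Qed.

Lemma lagr_dqE Z VZ W VW s t : s != t -> lagr_sub (Z s) (W s) =
  lagr_add (lagr_sub (Z t) (W t))
    (lagr_scale (s - t) (lagr_add (lagr_sub (lagr_dq Z VZ s t) (lagr_dq W VW s t))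
       (lagr_sub (VZ t) (VW t)))).
Proof.
rewrite -subr_eq0 => st; rewrite /lagr_dq /lagr_sub /lagr_add /lagr_scale /=.
congr Lagr; apply/funext => x; rewrite /= /GRing.scale/=.
- by move: (ly (Z s) x) (ly (Z t) x) (ly (W s) x) (ly (W t) x) (ly (VZ t) x) (ly (VW t) x) => a b c d e f; field.
- by move: (lU (Z s) x) (lU (Z t) x) (lU (W s) x) (lU (W t) x) (lU (VZ t) x) (lU (VW t) x) => a b c d e f; field.
- by move: (lnu (Z s) x) (lnu (Z t) x) (lnu (W s) x) (lnu (W t) x) (lnu (VZ t) x) (lnu (VW t) x) => a b c d e f; field.
- by move: (lr (Z s) x) (lr (Z t) x) (lr (W s) x) (lr (W t) x) (lr (VZ t) x) (lr (VW t) x) => a b c d e f; field.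
Qed.

(** Both expansions are centred at t. This one is solved for the value at t and yields the left
    condition of [gronwall]. *)
Lemma lagr_dqE_rev Z VZ W VW s t : s != t -> lagr_sub (Z t) (W t) =
  lagr_add (lagr_sub (Z s) (W s))
    (lagr_scale (t - s) (lagr_add (lagr_sub (lagr_dq Z VZ s t) (lagr_dq W VW s t))
       (lagr_sub (VZ t) (VW t)))).
Proof.
rewrite -subr_eq0 => st; rewrite /lagr_dq /lagr_sub /lagr_add /lagr_scale /=.
congr Lagr; apply/funext => x; rewrite /= /GRing.scale/=.
- by move: (ly (Z s) x) (ly (Z t) x) (ly (W s) x) (ly (W t) x) (ly (VZ t) x) (ly (VW t) x) => a b c d e f; field.
- by move: (lU (Z s) x) (lU (Z t) x) (lU (W s) x) (lU (W t) x) (lU (VZ t) x) (lU (VW t) x) => a b c d e f; field.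
- by move: (lnu (Z s) x) (lnu (Z t) x) (lnu (W s) x) (lnu (W t) x) (lnu (VZ t) x) (lnu (VW t) x) => a b c d e f; field.
- by move: (lr (Z s) x) (lr (Z t) x) (lr (W s) x) (lr (W t) x) (lr (VZ t) x) (lr (VW t) x) => a b c d e f; field.
Qed.

Lemma curve_gronwall Z VZ W VW L T : curve Z VZ -> curve W VW -> 0 <= L -> 0 <= T ->
  (forall t, 0 <= t ->
    Enormr (lagr_sub (VZ t) (VW t)) <= L * Enormr (lagr_sub (Z t) (W t))) ->
  Enormr (lagr_sub (Z T) (W T)) <= expR (L * T) * Enormr (lagr_sub (Z 0) (W 0)).
Proof.
move=> cZ cW L0 T0 VL; pose phi t := Enormr (lagr_sub (Z t) (W t)).
have phi0 t : 0 <= phi t by exact: Enormr_ge0.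
have tD t : 0 <= t -> Etangent (lagr_sub (Z t) (W t)).
  by move=> t0; apply: setE_sub; [exact: curve_E cZ t t0|exact: curve_E cW t t0].
have inc t eta : 0 <= t -> 0 < eta -> exists2 d, 0 < d & forall s, 0 <= s -> s != t -> `|s - t| < d ->
   Etangent (lagr_add (lagr_sub (lagr_dq Z VZ s t) (lagr_dq W VW s t)) (lagr_sub (VZ t) (VW t))) /\
   Enormr (lagr_add (lagr_sub (lagr_dq Z VZ s t) (lagr_dq W VW s t)) (lagr_sub (VZ t) (VW t)))
     <= L * phi t + eta.
  move=> t0 eta0; have e2 : 0 < eta / 2 by rewrite divr_gt0.
  have [d1 d10 H1] := curve_dq cZ t0 e2; have [d2 d20 H2] := curve_dq cW t0 e2.
  exists (Num.min d1 d2); first by rewrite lt_min d10.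
  move=> s s0 st; rewrite lt_min => /andP[sd1 sd2].
  have q1 := Etangent_dq cZ s0 t0; have q2 := Etangent_dq cW s0 t0.
  have q12 := Etangent_sub q1 q2; have v12 := Etangent_sub (curve_T cZ t0) (curve_T cW t0).
  split; first exact: Etangent_add.
  apply: le_trans (EnormrD q12 v12) _; rewrite addrC; apply: lerD; first exact: VL.
  apply: le_trans (EnormrB q1 q2) _; rewrite [leRHS]splitr.
  by apply: lerD; [exact: H1|exact: H2].
apply: (@gronwall _ phi) => //.
- move=> t eta t0 eta0; have [d d0 Hd] := inc t eta t0 eta0; exists d => // s /andP[ts sd].
  have s0 : 0 <= s by rewrite (le_trans t0)// ltW.
  have st : s != t by rewrite gt_eqF.
  have st0 : 0 < s - t by rewrite subr_gt0.
  have [|ta le] := Hd s s0 st; first by rewrite gtr0_norm//; lra.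
  rewrite /phi (lagr_dqE Z VZ W VW st).
  apply: le_trans (EnormrD (tD t t0) (Etangent_scale _ ta)) _; rewrite lerD2l.
  apply: le_trans (EnormrZ _ ta) _; rewrite gtr0_norm//.
  by rewrite ler_pM2l.
- move=> t eta t0 eta0; have [d d0 Hd] := inc t 1 t0 ltr01.
  have c0 : 0 < L * phi t + 1 by rewrite ltr_wpDl// mulr_ge0.
  (* On this range (t - s) (L phi t + 1) <= eta. *)
  exists (Num.min d (eta / (L * phi t + 1))); first by rewrite lt_min d0 divr_gt0.
  move=> s s0 /andP[ts st'].
  have st : s != t by rewrite lt_eqF.
  have st0 : 0 < t - s by rewrite subr_gt0.
  have : t - s < Num.min d (eta / (L * phi t + 1)) by lra.
  rewrite lt_min => /andP[tsd tse].
  have [|ta le] := Hd s s0 st; first by rewrite distrC gtr0_norm.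
  rewrite {1}/phi (lagr_dqE_rev Z VZ W VW st).
  apply: le_trans (EnormrD (tD s s0) (Etangent_scale _ ta)) _; rewrite lerD2l.
  apply: le_trans (EnormrZ _ ta) _; rewrite gtr0_norm//.
  apply: (@le_trans _ _ ((t - s) * (L * phi t + 1))); first by rewrite ler_pM2l.
  by rewrite -ler_pdivlMr// ltW.
Qed.

Variable S : R -> lagr R -> lagr R.
Hypothesis FS : lagrangian_flow S.

Lemma flow_curve X : setF X -> curve (fun t => S t X) (fun t => lagr_rhs (S t X)).
Proof. by move=> /FS[_ _ /C1_curve]. Qed.

Lemma flow_F X t : setF X -> 0 <= t -> setF (S t X).
Proof. by move=> /FS[_ + _]; apply. Qed.

(** On F the norm h is the integral of nu, hence linear in nu, and nu_t has integral zero.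
    [gronwall] with L = 0 and initial value 0 then keeps |m t - m 0| at 0. *)
Lemma flow_h X T : setF X -> 0 <= T -> lagr_h (S T X) = lagr_h X.
Proof.
move=> FX T0; have cS := flow_curve FX.
pose m t := itg 0 1 (lnu (S t X)); pose phi t := `|m t - m 0|.
have ln t : 0 <= t -> locally_integrable [set: R] (lnu (S t X)).
  by move=> t0; apply: L1per_locint; apply: setF_L1per_nu; exact: flow_F.
have inc t eta : 0 <= t -> 0 < eta -> exists2 d, 0 < d & forall s, 0 <= s -> s != t -> `|s - t| < d ->
    `|m s - m t| <= `|s - t| * eta.
  move=> t0 eta0; have [d d0 Hd] := curve_dq cS t0 eta0; exists d => // s s0 st sd.
  have tq := Etangent_dq cS s0 t0.
  have lq : locally_integrable [set: R] (lnu (lagr_dq (fun t => S t X) (fun t => lagr_rhs (S t X)) s t)).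
    by case: tq => _ _ /L1per_locint.
  have lv : locally_integrable [set: R] (lnu (lagr_rhs (S t X))).
    by case: (Etangent_rhs (flow_F FX t0)) => _ _ /L1per_locint.
  have st0 : s - t != 0 by rewrite subr_eq0.
  have -> : m s - m t = (s - t) * itg 0 1 (lnu (lagr_dq (fun t => S t X) (fun t => lagr_rhs (S t X)) s t)).
    (* Adding the vanishing integral of nu_t turns the error term back into the full difference
       quotient. *)
    rewrite -[itg 0 1 (lnu (lagr_dq _ _ _ _))]addr0 -[X in _ * (_ + X)](itg_rhs_nu (flow_F FX t0)).
    rewrite -itgD// -itgZ; last exact: locally_integrableD.
    rewrite /m -itgB; [|exact: ln|exact: ln].
    congr itg; apply/funext => x; rewrite /lagr_dq /= /GRing.scale/=.
    by move: (lnu (S s X) x) (lnu (S t X) x) (_ + _) => a b c; field.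
  rewrite normrM; apply: ler_wpM2l; first exact: normr_ge0.
  apply: le_trans (Hd s s0 st sd); apply: le_trans (itg_norm_le _ _ lq) _.
  have H (a b u v : R) : 0 <= a -> 0 <= b -> 0 <= v -> u <= a + b + u + v by move=> *; lra.
  by apply: H; rewrite ?l1n_ge0// addr_ge0 ?supn_ge0 ?l1n_ge0.
have : phi T <= expR (0 * T) * phi 0.
  apply: gronwall => //.
  - by move=> t; exact: normr_ge0.
  - move=> t eta t0 eta0; have [d d0 Hd] := inc t eta t0 eta0; exists d => // s /andP[ts sd].
    rewrite mul0r add0r /phi.
    have -> : m s - m 0 = (m t - m 0) + (m s - m t) by ring.
    apply: le_trans (ler_normD _ _) _; rewrite lerD2l.
    have st0 : 0 < s - t by rewrite subr_gt0.
    rewrite -[X in X * eta]gtr0_norm//; apply: Hd.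
    + by rewrite (le_trans t0)// ltW.
    + by rewrite gt_eqF.
    + by rewrite gtr0_norm//; lra.
  - move=> t eta t0 eta0; have [d d0 Hd] := inc t 1 t0 ltr01.
    exists (Num.min d eta); first by rewrite lt_min d0.
    move=> s s0 /andP[ts st].
    have st0 : 0 < t - s by rewrite subr_gt0.
    have : t - s < Num.min d eta by lra.
    rewrite lt_min => /andP[tsd tse].
    have -> : phi t = `|(m s - m 0) - (m s - m t)| by rewrite /phi; congr `|_|; ring.
    apply: le_trans (ler_normB _ _) _; rewrite lerD2l.
    have := Hd s s0; rewrite lt_eqF// distrC gtr0_norm// => /(_ erefl tsd); rewrite mulr1 => /le_trans; apply.
    exact: ltW.
have [S0 _ _] := FS FX.
rewrite {2}/phi subrr normr0 mulr0 normr_le0 subr_eq0 /m S0 => /eqP mE.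
by rewrite -(setF_itg_nu (flow_F FX T0)) -(setF_itg_nu FX).
Qed.

End Flow.

(** * The projection onto H *)

Section Projection.
Context {R : realType}.
Local Notation mu := (@lebesgue_measure R).
Implicit Types (a b c x z M : R) (X Y : lagr R).

Section Pi1.
Variable X : lagr R.
Hypothesis FX : setF X.
Let h := lagr_h X.
Let phi := Pi1_fun X.
Let h0 : 0 < 1 + h. Proof. by rewrite ltr_wpDr// lagr_h_ge0. Qed.
Let eX : setE X. Proof. by case: FX. Qed.
Let Ln := setF_L1per_nu FX.
Let ln := L1per_locint Ln.
Let dphi x := (1 + h)^-1 * ((ly X)^`() x + lnu X x).

Let Pphi : primitive phi dphi.
Proof.
apply: primitive_eq (primitiveZ (1 + h)^-1 (primitiveD (setE_ly_W11loc eX) (primitive_itg ln))) _ _ => x //.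
by rewrite /phi /Pi1_fun /= /GRing.scale/= div1r.
Qed.

Let phi_per x : phi (x + 1) = phi x + 1.
Proof.
have [_ H] := primitive_itg ln.
have E : oriented_int 0 (x + 1) (lnu X) = oriented_int 0 x (lnu X) + h.
  have E0 : oriented_int 0 (x + 1) (lnu X) - oriented_int 0 x (lnu X) = h.
    by rewrite H ?lerDl// (itg_periodic x ln Ln.1) (setF_itg_nu FX).
  by rewrite -E0 subrKC.
rewrite /phi /Pi1_fun (setE_ly_per eX) E -/h.
have -> : ly X x + 1 + (oriented_int 0 x (lnu X) + h) = ly X x + oriented_int 0 x (lnu X) + (1 + h) by ring.
by rewrite mulrDr div1r mulVf// gt_eqF.
Qed.

Let dphi_bnd : exists c L, 0 < c /\ {ae mu, forall x, c <= dphi x <= L}.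
Proof.
have [L L0 [Hy _ Hn _]] := setF_bnd FX; have [_ [_ [_ _ [c c0 Hc] _]]] := FX.
exists ((1 + h)^-1 * c), ((1 + h)^-1 * (L + L)); split; first by rewrite mulr_gt0// invr_gt0.
apply: aeS3 Hy Hn Hc => x Hy Hn Hc.
rewrite /dphi !ler_pM2l ?invr_gt0// Hc/=; apply: lerD.
  by rewrite (le_trans (ler_norm _)).
by rewrite (le_trans (ler_norm _)).
Qed.

Let phi_incr : {homo phi : x z / x < z}.
Proof.
have [c [L [c0 Hc]]] := dphi_bnd; move=> x z xz; rewrite -subr_gt0.
have [ldp ->] := Pphi; last exact: ltW.
apply: (@lt_le_trans _ _ (itg x z (fun=> c))).
  by rewrite itg_cst ?ltW// mulr_gt0// subr_gt0.
apply: le_itg_ae => //; first exact: locint_cst.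
by apply: aeS Hc => u /andP[].
Qed.

Let phi_homo : {homo phi : x z / x <= z}.
Proof. by move=> x z; rewrite le_eqVlt => /predU1P[->//|/phi_incr/ltW]. Qed.

(** phi - id is periodic, so phi k = phi 0 + k at integers; z lies between two consecutive such
    values. *)
Let phi_surj z : exists x, phi x = z.
Proof.
have pp : periodic (phi \- id) 1 by move=> x /=; rewrite phi_per; ring.
have E (k : int) : phi k%:~R = phi 0 + k%:~R.
  have := @periodic_int _ _ k 0 pp; rewrite /= add0r subr0 => H.
  by rewrite -H subrK.
pose k := Num.floor (z - phi 0).
have kz : phi k%:~R <= z by rewrite E -lerBrDl ge_floor.
have zk : z <= phi (k + 1)%:~R by rewrite E -lerBlDl ltW// floorD1_gt.
have kk : k%:~R <= (k + 1)%:~R :> R by rewrite ler_int lerDl.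
have [|x _ <-] := @IVT _ phi _ _ z kk (continuous_subspaceT (primitive_continuous Pphi)).
  by rewrite ge_min kz/= le_max zk orbT.
by exists x.
Qed.

Lemma Pi1_relabeling : relabeling (Pi1_fun X) (pinv [set: R] (Pi1_fun X)) /\
  relabeling (pinv [set: R] (Pi1_fun X)) (Pi1_fun X).
Proof.
have phi_inj : injective phi.
  move=> x z E; apply/eqP; rewrite eq_le; apply/andP; split; rewrite leNgt; apply/negP => /phi_incr; rewrite E ltxx//.
have pK : cancel (pinv [set: R] phi) phi.
  have sur : set_surj setT setT phi by move=> z _; have [x <-] := phi_surj z; exists x.
  by move=> z; have := @surjpK R R (fun=> point) setT setT phi sur z; rewrite inE; exact.
have Kp : cancel phi (pinv [set: R] phi) by move=> x; apply: phi_inj; rewrite pK.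
have [c [L [c0 Hc]]] := dphi_bnd.
(* The inverse [g] obtained from membership in G is unspecified; injectivity of phi identifies it
   with [pinv]. *)
have [g [r1 r2]] := setG_relabeling (setG_intro Pphi Kp pK phi_per phi_homo c0 Hc).
have gE : g = pinv [set: R] phi.
  by apply/funext => z; apply: phi_inj; rewrite pK (relabKV r1).
by rewrite gE in r1 r2.
Qed.

(** (1 + h) phi_xi = y_xi + nu, and the chain rule for phi o phi^-1 = id makes the relabeled sum
    equal to 1 + h. *)
Lemma setF0_Pi1 : setF0 (Pi1 X).
Proof.
have [r1 r2] := Pi1_relabeling; have FP := setF_relabel r2 FX; split=> //.
rewrite /Pi1 (lagr_h_relabel r2 Ln) -/h.
have D1 := relabeling_ae r2 (primitive_derive1 Pphi).
have D2 : {ae mu, forall x, 1 = phi^`() (pinv [set: R] phi x) * (pinv [set: R] phi)^`() x}.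
  have := primitive_derive1 (relabeling_primitive r2 (relab_prim r1)).
  have -> : Pi1_fun X \o pinv [set: R] (Pi1_fun X) = id by apply/funext => x /=; rewrite (relabKV r1).
  by apply: aeS2 (primitive_derive1 (@primitive_id R)) => x ->.
apply: aeS3 (derive1_relabel r2 (setE_ly_W11loc eX)) D1 D2 => x E1 E2 E3.
rewrite E1 /= -mulrDl.
transitivity ((1 + h) * (phi^`() (pinv [set: R] phi x) * (pinv [set: R] phi)^`() x)).
  rewrite E2 /dphi; move: ((ly X)^`() _ + _) ((pinv _ _)^`() x) => p q.
  by field; rewrite gt_eqF.
by rewrite -E3 mulr1.
Qed.

End Pi1.

Lemma derive1_shift a x : (fun x : R => x - a)^`() x = 1.
Proof.
rewrite derive1E; apply: derive_val.
by rewrite -[X in is_derive _ _ _ X]subr0; apply: is_deriveB.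
Qed.

(** [Pi2] is thereby a relabeling too, so whatever relabeling preserves is preserved by the whole
    projection. *)
Lemma relabel_shift a X : lagr_translate a X = relabel X (fun x => x - a).
Proof.
by rewrite /lagr_translate /relabel; congr Lagr; apply/funext => x /=; rewrite derive1_shift mulr1.
Qed.

Lemma shift_relabeling a : exists g, relabeling (fun x : R => x - a) g /\ relabeling g (fun x : R => x - a).
Proof. exact: setG_relabeling (setG_shift (- a)). Qed.

Lemma setF0_relabel_shift a X : setF0 X -> setF0 (relabel X (fun x => x - a)).
Proof.
move=> [FX H]; have [g [r _]] := shift_relabeling a; split; first exact: setF_relabel r FX.
rewrite (lagr_h_relabel r (setF_L1per_nu FX)); have [eX _] := FX.
apply: aeS2 (derive1_relabel r (setE_ly_W11loc eX)) (relabeling_ae r H) => x -> /=.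
by rewrite derive1_shift !mulr1.
Qed.

Lemma lagrPiE X : setF X -> exists g1 g2 k1 k2,
  [/\ lagrPi X = relabel (relabel X g1) g2, relabeling g1 k1, relabeling k1 g1,
      relabeling g2 k2 & relabeling k2 g2].
Proof.
move=> FX; have [r1 r2] := Pi1_relabeling FX.
have [k [s1 s2]] := shift_relabeling (\int[mu]_(x in `[0, 1]) ly (Pi1 X) x).
exists (pinv [set: R] (Pi1_fun X)), (fun x => x - \int[mu]_(x in `[0, 1]) ly (Pi1 X) x), (Pi1_fun X), k.
by split=> //; rewrite -relabel_shift.
Qed.

Lemma lagr_h_Pi X : setF X -> lagr_h (lagrPi X) = lagr_h X.
Proof.
move=> FX; have [g1 [g2 [k1 [k2 [-> r1 _ r2 _]]]]] := lagrPiE FX.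
have Ln := setF_L1per_nu FX.
by rewrite (lagr_h_relabel r2) ?(lagr_h_relabel r1)//; exact: L1per_relabel r1 Ln.
Qed.

Lemma lagrPi_H X : setF X -> setH (lagrPi X).
Proof.
move=> FX; have F0 := setF0_Pi1 FX; have [[eP _] _] := F0.
rewrite /lagrPi /Pi2; set a := \int[mu]_(x in _) _.
split; first by rewrite relabel_shift; exact: setF0_relabel_shift.
rewrite /= -/(itg 0 1 (fun x => ly (Pi1 X) (x - a))).
have [py wy] : W11per (ly (Pi1 X) \- id) by case: eP.
(* y = zeta + id with zeta periodic: the shift leaves the mean of zeta unchanged and lowers that of
   id by a, the mean of y. *)
set zeta := ly (Pi1 X) \- id in py wy.
have lz : locally_integrable [set: R] zeta by apply: locint_cont; exact: W11loc_continuous.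
have lid : locally_integrable [set: R] (@id R) by apply: locint_cont => x; exact: cvg_id.
have aE : a = itg 0 1 zeta + itg 0 1 id.
  by rewrite -itgD//; congr itg; apply/funext => x; rewrite /zeta /= subrK.
have -> : (fun x => ly (Pi1 X) (x - a)) = (fun x => zeta (x - a) + (x - a)).
  by apply/funext => x; rewrite /zeta /= subrK.
rewrite itgD; [|exact: locint_shift|by apply: locally_integrableB => //; exact: locint_cst].
rewrite -itg_shift// (@itgB _ id (fun=> a) _ _ lid (locint_cst a)).
rewrite itg_cst// subr0 mulr1 add0r [1 - a]addrC itg_periodic//.
by rewrite addrA -aE subrr.
Qed.

Lemma lagrJ_Pi X Y : setF X -> setF Y -> (lagrJ (lagrPi X) (lagrPi Y) <= lagrJ X Y)%E.
Proof.
move=> FX FY; have [eX _] := FX; have [eY _] := FY.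
have [g1 [g2 [k1 [k2 [-> r1 s1 r2 s2]]]]] := lagrPiE FX.
have [g1' [g2' [k1' [k2' [-> r1' s1' r2' s2']]]]] := lagrPiE FY.
apply: le_trans (lagrJ_relabel (setE_relabel r1 eX) (setE_relabel r1' eY) r2 s2 r2' s2') _.
exact: lagrJ_relabel eX eY r1 s1 r1' s1'.
Qed.

End Projection.

(** * Stability of J and of the metric *)

Section Stability.
Context {R : realType}.
Implicit Types (T M t : R) (X Y : lagr R).

Definition lipM M : R := 55 * bndM M ^+ 3.

Lemma lipM_ge0 M : 0 <= M -> 0 <= lipM M.
Proof.
by move=> M0; rewrite mulr_ge0// exprn_ge0// (le_trans ler01)// bndM_ge1.
Qed.

Lemma lagrJ_ge0 X Y : (0 <= lagrJ X Y)%E.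
Proof.
apply: le_ereal_inf_tmp => _ [f [g [_ _ ->]]].
by rewrite !adde_ge0// Lnorm_ge0.
Qed.

(** A pair (f, g) that competes for J at time 0 is kept at time t; the exponential factor is the
    same for all pairs, so the infimum can be taken afterwards. *)
Lemma lagrJ_flow S M t X Y : lagrangian_flow S -> 0 <= t ->
  setF X -> setF Y -> lagr_h X <= M -> lagr_h Y <= M ->
  (lagrJ (S t X) (S t Y) <= (expR (lipM M * t))%:E * lagrJ X Y)%E.
Proof.
move=> FS t0 FX FY hX hY; rewrite -ereal_inf_pZl ?expR_gt0//.
apply: le_ereal_inf_tmp => _ [_ [f [g [Gf Gg ->]]] <-].
have [f' [rf _]] := setG_relabeling Gf; have [g' [rg _]] := setG_relabeling Gg.
have M0 : 0 <= M by exact: le_trans (lagr_h_ge0 X) hX.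
have cX := curve_relabel rf (flow_curve FS FX); have cY := curve_relabel rg (flow_curve FS FY).
have [SX _ _] := FS X FX; have [SY _ _] := FS Y FY.
have H := curve_gronwall cX cY (lipM_ge0 M0) t0 _.
apply: ge_ereal_inf; exists (Edist (relabel (S t X) f) (relabel (S t Y) g)).
  by exists f, g; split; [exact: Gf|exact: Gg|reflexivity].
have [eX _] := FX; have [eY _] := FY.
have [eSX _] := flow_F FS FX t0; have [eSY _] := flow_F FS FY t0.
rewrite (EdistE (setE_relabel rf eX) (setE_relabel rg eY)).
rewrite (EdistE (setE_relabel rf eSX) (setE_relabel rg eSY)) -EFinM lee_fin.
rewrite SX SY in H; apply: H => s s0.
have FXs := flow_F FS FX s0; have FYs := flow_F FS FY s0.
have FXf := setF_relabel rf FXs; have FYg := setF_relabel rg FYs.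
have aX := relabel_rhs rf FXs; have aY := relabel_rhs rg FYs.
(* The relabeled velocity agrees a.e. with the vector field at the relabeled point, to which the
   Lipschitz bound applies. *)
rewrite -(Enormr_ae (Etangent_sub (Etangent_rhs FXf) (Etangent_rhs FYg))
  (Etangent_sub (Etangent_relabel rf (Etangent_rhs FXs)) (Etangent_relabel rg (Etangent_rhs FYs)))
  (lagr_ae_sub aX aY)).
apply: rhs_lipschitz => //.
- by rewrite (lagr_h_relabel rf (setF_L1per_nu FXs)) (flow_h FS FX s0).
- by rewrite (lagr_h_relabel rg (setF_L1per_nu FYs)) (flow_h FS FY s0).
Qed.

Lemma Sbar_HM S M t X : lagrangian_flow S -> 0 <= t -> setHM M X -> setHM M (Sbar S t X).
Proof.
move=> FS t0 [[[FX _] _] hX]; have FXt := flow_F FS FX t0; split; first exact: lagrPi_H.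
by rewrite /Sbar lagr_h_Pi// (flow_h FS FX t0).
Qed.

End Stability.

Theorem theorem3p3 (R : realType) (T M : R) (hT : 0 < T) (hM : 0 < M) :
  exists C : R,
    forall S : R -> lagr R -> lagr R, lagrangian_flow S ->
    forall Xa Xb : lagr R, setHM M Xa -> setHM M Xb ->
    forall t : R, 0 <= t <= T ->
      (dM M (Sbar S t Xa) (Sbar S t Xb) <= C%:E * dM M Xa Xb)%E.
Proof.
(* The rate exp ([lipM M] t) is increased to its value at t = T, which serves all t and every S. *)
exists (expR (lipM M * T)) => S FS Xa Xb _ _ t /andP[t0 tT].
rewrite -ereal_inf_pZl ?expR_gt0//; apply: le_ereal_inf_tmp => _ [_ [N [Z [Z0 ZN ZH ->]]] <-].
apply: ge_ereal_inf; exists (\sum_(n < N) lagrJ (Sbar S t (Z n)) (Sbar S t (Z n.+1)))%E.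
  exists N, (fun n => Sbar S t (Z n)); split.
  - by rewrite Z0.
  - by rewrite ZN.
  - by move=> n nN; apply: Sbar_HM => //; exact: ZH.
  - by [].
rewrite ge0_sume_distrr; last by move=> n _; exact: lagrJ_ge0.
apply: lee_sum => n _.
have [[[Fn _] _] hn] := ZH n (ltnW (ltn_ord n)).
have [[[Fn1 _] _] hn1] := ZH n.+1 (ltn_ord n).
apply: le_trans (lagrJ_Pi (flow_F FS Fn t0) (flow_F FS Fn1 t0)) _.
apply: le_trans (lagrJ_flow FS t0 Fn Fn1 hn hn1) _.
rewrite lee_wpmul2r ?lagrJ_ge0// lee_fin ler_expR.
by apply: ler_wpM2l => //; apply: lipM_ge0; exact: ltW.
Qed.
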